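(* Fix an integer $n\ge 1$. For the family of equations $u''+P(x)u'+Q(x)u=0$ parameterized by $\mathbb{P}_{2n}$, the following hold: (a) There are infinitely many integers $d\ge 0$ such that $\mathbb{L}_{2n,d}\neq\emptyset$. (b) Whenever $\mathbb{L}_{2n,d}\neq\emptyset$, it is an algebraic subvariety of $\mathbb{P}_{2n}$ of codimension at most $n$. (c) For integers $d\neq k$, $\mathbb{L}_{2n,d}\cap\mathbb{L}_{2n,k}=\emptyset$. (d) Every compact subset of $\mathbb{P}_{2n}$ meets only finitely many of the sets $\mathbb{L}_{2n,d}$, $d\in\mathbb{Z}_{\ge0}$. Moreover $\mathbb{L}_{2n}=\bigcup_{d=0}^{\infty}\mathbb{L}_{2n,d}$; hence $\mathbb{L}_{2n}$ is a countable union of pairwise disjoint, non-accumulating algebraic subvarieties of $\mathbb{P}_{2n}$, each of codimension at most $n$.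
   Context: Parameter space: $\mathbb{P}_{2n}$ is the set of pairs $(P,Q)$ of complex polynomials $P(x)=\sum_{j=0}^n p_jx^j$, $Q(x)=\sum_{j=0}^{2n}q_jx^j$ (affine coordinates $p_0,\dots,p_n,q_0,\dots,q_{2n}$) satisfying the non-degeneracy condition that $R(x)=\frac{P(x)^2}{4}+\frac{P'(x)}{2}-Q(x)$ has exact degree $2n$, i.e. $\frac{p_n^2}{4}-q_{2n}\neq0$. (The d'Alembert substitution $u=\exp(-\frac12\int P\,dx)\,y$ transforms $u''+Pu'+Qu=0$ into $y''=R(x)y$.) A Liouvillian solution means a nonzero solution lying in a Liouvillian differential field extension of $(\mathbb{C}(x),d/dx)$. A polynomial-hyperexponential function of polynomial degree $d$ is a function $u(x)=P_d(x)\exp\left(\int A(x)\,dx\right)$ where $P_d$ is a polynomial of degree exactly $d$ and $A$ is a polynomial. $\mathbb{L}_{2n}\subseteq\mathbb{P}_{2n}$ (the spectral set) is the set of $(P,Q)$ for which $u''+Pu'+Qu=0$ has a Liouvillian solution; $\mathbb{L}_{2n,d}\subseteq\mathbb{P}_{2n}$ (spectral variety) is the set of $(P,Q)$ for which the equation has a polynomial-hyperexponential solution of polynomial degree $d$. *)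

(* Defs.v *)
From HB Require Import structures.
From mathcomp Require Import all_boot all_order all_algebra.
(* mpoly must be imported before mathcomp-analysis (notation-level clash) *)
From mathcomp Require Import mpoly.
From mathcomp Require Import all_classical all_reals all_analysis.
From mathcomp Require Import complex.
Import numFieldTopology.Exports.

Set Implicit Arguments.
Unset Strict Implicit.
Unset Printing Implicit Defensive.
Import Order.TTheory GRing.Theory Num.Theory.
Local Open Scope ring_scope.

(* The complex numbers are modelled as R[i] for R : realType (so R ~ the reals,
   R[i] ~ C).  We equip R[i] with its usual metric topology (|z| = modulus),
   so that 'rV[R[i]]_N carries the usual (product = Euclidean) topology. *)
HB.instance Definition _ (R : rcfType) :=
  PseudoPointedMetric.copy R[i] (R[i] : numClosedFieldType)^o.

(* A differential field extension of (F(x), d/dx) is a field K with a       *)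
(* derivation D and an injective ring embedding iota of F[x] into K         *)
(* compatible with the derivations (D (iota p) = iota p'); the subfield      *)
(* generated by iota(F[x]) is then (a copy of) F(x) with d/dx.              *)
Record diff_ext (F : fieldType) := DiffExt {
  de_K :> fieldType;
  de_D : de_K -> de_K;
  de_iota : {rmorphism {poly F} -> de_K};
  de_DD : forall a b : de_K, de_D (a + b) = de_D a + de_D b;
  de_DM : forall a b : de_K, de_D (a * b) = de_D a * b + a * de_D b;
  de_inj : injective de_iota;
  de_Dpoly : forall p : {poly F}, de_D (de_iota p) = de_iota (p^`())
}.

Definition in_gen (F : fieldType) (E : diff_ext F) (S : seq E) (z : E) : Prop :=
  forall P : E -> Prop,
    (forall p : {poly F}, P (@de_iota _ E p)) ->
    (forall t, t \in S -> P t) ->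
    (forall a b, P a -> P b -> P (a - b)) ->
    (forall a b, P a -> P b -> P (a * b)) ->
    (forall a, P a -> P a^-1) ->
    P z.

Definition liouv_tower (F : fieldType) (E : diff_ext F) (ts : seq E) : Prop :=
  forall i : nat, (i < size ts)%N ->
    let t := nth 0 ts i in
    let Fi := in_gen (take i ts) in
    [\/ exists p : {poly de_K E}, [/\ p != 0, (forall j, Fi p`_j) & root p t],
        Fi (@de_D _ E t)
      | t != 0 /\ Fi (@de_D _ E t / t)].

Definition liouvillian (F : fieldType) (E : diff_ext F) (y : E) : Prop :=
  exists ts : seq E, liouv_tower ts /\ in_gen ts y.

Definition is_sol (F : fieldType) (E : diff_ext F) (P Q : {poly F}) (u : E) :=
  @de_D _ E (@de_D _ E u) + @de_iota _ E P * @de_D _ E u + @de_iota _ E Q * u = 0.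

Definition has_liouv_sol (F : fieldType) (P Q : {poly F}) : Prop :=
  exists (E : diff_ext F) (u : E), [/\ u != 0, is_sol P Q u & liouvillian u].

(* the equation has a polynomial-hyperexponential solution
   u = P_d * exp(int A), with deg P_d = d exactly and A a polynomial;
   exp(int A) is an element e != 0 with e' = A e. *)
Definition has_phexp_sol (F : fieldType) (d : nat) (P Q : {poly F}) : Prop :=
  exists (E : diff_ext F) (Pd A : {poly F}) (e : E),
    [/\ size Pd = d.+1, e != 0, @de_D _ E e = @de_iota _ E A * e
      & is_sol P Q (@de_iota _ E Pd * e)].

(* The parameter space P_{2n}: points of C^(3n+2) = 'rV_(n.+1 + (2n).+1),   *)
(* coordinates (p_0..p_n, q_0..q_2n).                                        *)
Notation Ndim n := (n.+1 + (n.*2).+1)%N.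
Notation pt R n := 'rV[R[i]]_(Ndim n).

Definition Ppol (R : rcfType) (n : nat) (v : pt R n) : {poly R[i]} :=
  rVpoly (lsubmx v).
Definition Qpol (R : rcfType) (n : nat) (v : pt R n) : {poly R[i]} :=
  rVpoly (rsubmx v).

Definition Pspace (R : rcfType) (n : nat) : set (pt R n) :=
  fun v => (Ppol v)`_n ^+ 2 / 4%:R - (Qpol v)`_(n.*2) != 0.

Definition Lspec (R : rcfType) (n : nat) : set (pt R n) :=
  fun v => Pspace v /\ has_liouv_sol (Ppol v) (Qpol v).

Definition Lvar (R : rcfType) (n d : nat) : set (pt R n) :=
  fun v => Pspace v /\ has_phexp_sol d (Ppol v) (Qpol v).

Definition alg_subvariety (R : rcfType) (n : nat) (V : set (pt R n)) : Prop :=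
  exists (m : nat) (fs : 'I_m -> mpoly.mpoly (Ndim n) R[i]),
    forall v, V v <-> (Pspace v /\
      forall l : 'I_m, mpoly.meval (fun j => v ord0 j) (fs l) = 0).

(* dim V >= k: some k of the coordinates are algebraically independent on V
   (no nonzero polynomial in these k coordinates vanishes on V); for an
   algebraic set this is the usual dimension (transcendence degree). *)
Definition dim_ge (R : rcfType) (n : nat) (V : set (pt R n)) (k : nat) : Prop :=
  exists s : 'I_k -> 'I_(Ndim n), injective s /\
    forall f : mpoly.mpoly k R[i],
      (forall v, V v -> mpoly.meval (fun j => v ord0 (s j)) f = 0) -> f = 0.

Definition codim_le (R : rcfType) (n : nat) (V : set (pt R n)) (c : nat) : Prop :=
  dim_ge V (Ndim n - c).

Arguments Pspace : clear implicits.
Arguments Lspec : clear implicits.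
Arguments Lvar : clear implicits.

(* Main.v *)
(* Write R = P^2/4 + P'/2 - Q, of degree 2n.

   Liouvillian implies polynomial-hyperexponential.  Let X = d/dx + (R - W^2) d/dW,
   acting on polynomials in W.  A solution u gives a polynomial W - w with
   w = u'/u + P/2 that divides its image under X.  Such "Darboux polynomials"
   descend along a Liouvillian tower: through an algebraic step by taking a
   multiple with coefficients in the smaller field, through a transcendental
   step by taking the top coefficient in t, so one exists over C(x).  Over C[x] it
   can be made primitive, and then X F = (mu - m W) F with mu in C[x].  If F and
   dF/dW have a common factor, their gcd is a Darboux polynomial of smaller
   degree; otherwise the discriminant D of F satisfies D' = (2m - 2) mu D up to a
   normalisation, which forces mu = 0 when m >= 2, and comparing leading
   coefficients in x excludes mu = 0.  Hence m = 1, and F = f W + g with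
   g = mu f - f' yields the solution f exp(-int (mu + P/2)).

   The spectral varieties.  A solution M exp(int A) with B = A + P/2 satisfies
   M'' + 2 B M' + (B' + B^2 - R) M = 0.  Comparing degrees, B = b C where b^2 is the
   leading coefficient r of R and C is the monic polynomial part of the square
   root of R/r, and the coefficient of x^(n-1) gives r s^2 = (n + 2 deg M)^2, where s
   is a regular function of (P,Q).  This yields disjointness and local
   finiteness; it also makes b a rational function of (P,Q), so that solving for
   the coefficients of M from the top down leaves n equations in all.

   Codimension.  Let B be real with a large negative coefficient of x and the
   other coefficients in [0,1], and let W' = B.  A maximum on [-1,1]^d of
   prod_(i<j) |x_i - x_j| exp (sum_i W(x_i)) is interior (Stieltjes), so that
   M = prod (x - x_i) divides M'' + 2 B M'.  This gives points of the variety for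
   which P is arbitrary and the coefficients q_2n, .., q_n vary one after the
   other over infinite sets. *)
Require Import Defs.
From HB Require Import structures.
From mathcomp Require Import all_boot all_order all_algebra.
From mathcomp Require Import generic_quotient mpoly.
From mathcomp Require Import all_classical all_reals all_analysis.
From mathcomp Require Import complex.
From mathcomp Require Import ring lra zify.
Import numFieldTopology.Exports numFieldNormedType.Exports.

Set Implicit Arguments.
Unset Strict Implicit.
Unset Printing Implicit Defensive.
Import Order.TTheory GRing.Theory Num.Theory.
Local Open Scope ring_scope.

(** * Derivations and the Riccati vector field *)

Definition derivation (A : nzRingType) (D : A -> A) : Prop :=
  (forall a b, D (a + b) = D a + D b) /\ (forall a b, D (a * b) = D a * b + a * D b).

Lemma derivation_deriv (A : comNzRingType) : derivation (@deriv A).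
Proof. by split=> p q; [rewrite derivD | rewrite derivM]. Qed.

Section Derivation.
Variables (A : comNzRingType) (D : A -> A).
Hypothesis hD : derivation D.

Lemma derD a b : D (a + b) = D a + D b. Proof. exact: hD.1. Qed.
Lemma derM a b : D (a * b) = D a * b + a * D b. Proof. exact: hD.2. Qed.
Lemma der0 : D 0 = 0.
Proof. by apply: (@addrI _ (D 0)); rewrite -derD !addr0. Qed.
Lemma derN a : D (- a) = - D a.
Proof. by apply: (@addrI _ (D a)); rewrite -derD !subrr der0. Qed.
Lemma derB a b : D (a - b) = D a - D b. Proof. by rewrite derD derN. Qed.
Lemma der1 : D 1 = 0.
Proof.
by apply: (@addrI _ (D 1)); rewrite addr0 -[in RHS](mulr1 1) derM mulr1 mul1r.
Qed.
Lemma der_sum (I : Type) (r : seq I) (P : pred I) (f : I -> A) :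
  D (\sum_(i <- r | P i) f i) = \sum_(i <- r | P i) D (f i).
Proof. exact: (big_morph D derD der0). Qed.
Lemma derMn a n : D (a *+ n) = D a *+ n.
Proof. by elim: n => [|n IH]; rewrite ?mulr0n ?der0 // !mulrS derD IH. Qed.
Lemma derXn a n : D (a ^+ n) = a ^+ n.-1 * D a *+ n.
Proof.
elim: n => [|n IH]; first by rewrite expr0 der1 mulr0n.
rewrite exprS derM IH; case: n {IH} => [|n] /=.
  by rewrite !expr0 mulr0n mulr0 addr0 mulr1 mul1r.
by rewrite mulrnAr mulrA -exprS [D a * _]mulrC -mulrS.
Qed.

End Derivation.

Section FieldDerivation.
Variables (K : fieldType) (D : K -> K).
Hypothesis hD : derivation D.

Lemma derV a : a != 0 -> D a^-1 = - (D a / a ^+ 2).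
Proof.
move=> a0; have := derM hD a a^-1; rewrite divff // der1 //.
move/esym/eqP; rewrite addrC addr_eq0 => /eqP h.
by apply: (mulfI a0); rewrite h expr2 invfM !mulrN !mulrA [a * D a]mulrC mulfK.
Qed.

Lemma der_div a b : b != 0 -> D (a / b) = (D a * b - a * D b) / b ^+ 2.
Proof.
move=> b0; rewrite derM // derV //; field; exact: b0.
Qed.

End FieldDerivation.

Section Xfield.
Variables (A : comNzRingType) (D : A -> A) (rho : A).
Hypothesis hD : derivation D.

(* The derivation of [A[W]] extending [D] with [W' = rho - W^2]: a root [w] of
   [F] satisfies the Riccati equation [w' + w^2 = rho] when [F] divides
   [riccati_field D rho F]. *)
Definition riccati_field (F : {poly A}) : {poly A} :=
  map_poly D F + (rho%:P - 'X ^+ 2) * F^`().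

Local Notation X := riccati_field.

Lemma coef_mapD F i : (map_poly D F)`_i = D F`_i.
Proof. exact: (coef_map_id0 _ _ (der0 hD)). Qed.

Lemma derivation_map_poly : derivation (map_poly D).
Proof.
split=> F G; apply/polyP => i.
  by rewrite coefD !coef_mapD coefD derD.
rewrite coefD coef_mapD !coefM der_sum // -big_split /=.
by apply: eq_bigr => j _; rewrite !coef_mapD derM.
Qed.

Lemma derivation_riccati : derivation X.
Proof.
split=> F G; rewrite /X.
  by rewrite (derD derivation_map_poly) derivD mulrDr addrACA.
rewrite (derM derivation_map_poly) derivM; ring.
Qed.

Lemma map_polyD_C a : map_poly D a%:P = (D a)%:P.
Proof. by apply/polyP => i; rewrite coef_mapD !coefC; case: ifP => // _; rewrite der0. Qed.

Lemma riccati_C a : X a%:P = (D a)%:P.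
Proof. by rewrite /X map_polyD_C derivC mulr0 addr0. Qed.

Lemma riccati_X : X 'X = rho%:P - 'X ^+ 2.
Proof.
rewrite /X derivX mulr1; suff -> : map_poly D 'X = 0 by rewrite add0r.
apply/polyP => i; rewrite coef_mapD coefX coef0.
by case: eqP => _; rewrite ?der0 ?(der1 hD).
Qed.

Lemma size_mapD F : (size (map_poly D F) <= size F)%N.
Proof. exact: size_poly. Qed.

Lemma coef_riccati F i :
  (X F)`_i = D F`_i + rho * F`_i.+1 *+ i.+1 - F`_i.-1 *+ i.-1.
Proof.
rewrite /X coefD coef_mapD -addrA; congr (_ + _).
rewrite mulrBl coefB coefCM coef_deriv mulrnAr; congr (_ - _).
rewrite coefXnM; case: i => [|[|i]] //=; rewrite ?mulr0n ?coef_deriv ?subn2 //=.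
Qed.

Lemma der_horner a t : D a.[t] = (map_poly D a).[t] + a^`().[t] * D t.
Proof.
elim/poly_ind: a => [|a c IH].
  by rewrite (der0 derivation_map_poly) derivC !horner0 mul0r addr0 (der0 hD).
rewrite (derD derivation_map_poly) (derM derivation_map_poly).
rewrite derivD derivM derivX derivC map_polyD_C !hornerE (derD hD) (derM hD) IH.
suff -> : map_poly D 'X = 0 by rewrite horner0; ring.
by apply/polyP => i; rewrite coef_mapD coefX coef0; case: eqP; rewrite ?(der0 hD) ?(der1 hD).
Qed.

(** The commutator of [X] with d/dW is [2 W d/dW], because [W^2] is the only part of the field
    depending on [W]. It governs how [X] acts on the derivative of a Darboux polynomial. *)
Lemma riccati_deriv F : X F^`() = (X F)^`() + 2%:R * 'X * F^`().
Proof.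
rewrite /X derivD derivM derivB derivC derivXn /=.
have -> : map_poly D F^`() = (map_poly D F)^`().
  by apply/polyP => i; rewrite coef_mapD !coef_deriv coef_mapD (derMn hD).
rewrite expr1 -mulr_natl; ring.
Qed.

Lemma size_riccati F : (size (X F) <= (size F).+1)%N.
Proof.
apply/leq_sizeP => i hi; rewrite coef_riccati.
have h1 j : (size F <= j)%N -> F`_j = 0 by move/leq_sizeP; exact.
case: i hi => // i hi; rewrite !h1 ?(der0 hD) ?mulr0 ?mul0rn ?addr0 ?subr0 //=.
all: by rewrite ltnW ?ltnS // ltnW.
Qed.

(** Only the term [- W^2 d/dW] raises the degree in [W]. *)
Lemma riccati_top F : (X F)`_(size F) = - (lead_coef F *+ (size F).-1).
Proof.
rewrite coef_riccati lead_coefE nth_default // (der0 hD).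
by rewrite [F`_(size F).+1]nth_default ?mulr0 ?mul0rn ?addr0 ?add0r.
Qed.

End Xfield.

(** * Descent of Darboux polynomials *)

Section Subfield.
Variables (E : fieldType) (K : divringClosed E).
(** The subfield as a field type of its own, so that algebraic and integral elements over it make
    sense. *)
Definition subf := {x : E | x \in K}.
HB.instance Definition _ := SubChoice.on subf.
HB.instance Definition _ := [SubChoice_isSubComUnitRing of subf by <:].
HB.instance Definition _ := [SubComUnitRing_isSubIntegralDomain of subf by <:].
HB.instance Definition _ := [SubIntegralDomain_isSubField of subf by <:].

Lemma subf_polyOverP (p : {poly E}) :
  p \is a polyOver K <-> exists q : {poly subf}, p = map_poly val q.
Proof.
split=> [/polyOverP h | [q ->]]; last first.
  by apply/polyOverP => i; rewrite coef_map /=; exact: valP.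
exists (\poly_(i < size p) (Sub p`_i (h i) : subf)).
apply/polyP => i; rewrite coef_map coef_poly.
by case: ltnP => [//|hi]; rewrite nth_default // raddf0.
Qed.

Definition algebraic_over (z : E) : Prop :=
  exists p : {poly E}, [/\ p != 0, p \is a polyOver K & root p z].

Lemma algebraic_overP z : algebraic_over z <-> algebraicOver (val : subf -> E) z.
Proof.
split=> [[p [p0 /subf_polyOverP[q pE] pz]] | [q q0 qz]].
  by exists q; rewrite ?pE // in p0 pz *; apply: contraNneq p0 => ->; rewrite map_poly0.
exists (map_poly val q); split=> //; first by rewrite map_poly_eq0.
by apply/subf_polyOverP; exists q.
Qed.

Variables (D : E -> E) (rho : E).
Hypothesis hD : derivation D.
Hypothesis KD : forall a, a \in K -> D a \in K.
Hypothesis Krho : rho \in K.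
Local Notation X := (riccati_field D rho).

Lemma riccati_over F : F \is a polyOver K -> X F \is a polyOver K.
Proof.
move=> /polyOverP hF; apply/polyOverP => i; rewrite coef_riccati //.
by rewrite rpredB ?rpredD ?rpredMn ?rpredM ?KD.
Qed.

(* The class of the indeterminate in [E[W]/(F)] is integral over [K]. *)
Lemma integral_multiple (F : {poly E}) : F \is monic -> (1 < size F)%N ->
  (forall i, algebraic_over F`_i) ->
  exists2 G : {poly subf}, G != 0 & F %| map_poly val G.
Proof.
move=> Fm Fs Falg.
(* The quotient [{poly %/ F}] is taken modulo [mk_monic F], which is [F] itself because [F] is monic
   of positive degree. *)
have mkF : mk_monic F = F by rewrite /mk_monic Fm Fs.
pose c : {rmorphism E -> {poly %/ F}} := in_qpoly F \o polyC.
have evalX p : (map_poly c p).[in_qpoly F 'X] = in_qpoly F p.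
  rewrite -[in RHS](comp_polyXr p) /comp_poly -horner_map -map_poly_comp //.
have [] := @integral_root_monic _ _ (c \o (val : subf -> E)) (in_qpoly F 'X) (map_poly c F).
- by rewrite map_monic.
- rewrite /root evalX; apply/eqP/val_inj => /=.
  by rewrite mkF Pdiv.RingMonic.rmodpp // Pdiv.Ring.rmod0p.
- apply/integral_poly => i; rewrite coef_map.
  by apply/integral_rmorph/integral_algebraic/algebraic_overP.
move=> G Gm; rewrite map_poly_comp /root evalX => /eqP h; exists G; first exact: monic_neq0.
have /= := congr1 val h; rewrite mkF => {}h.
by rewrite dvdpE /Pdiv.Ring.rdvdp h.
Qed.

(** For every multiple [G] of [F], the image [X G] is again divisible by [F]. If [G] has least size
    among the nonzero multiples over [K], the remainder of [X G] modulo [G] is a smaller multiple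
    over [K], hence zero. *)
Lemma darboux_algebraic (F : {poly E}) : (1 < size F)%N -> F %| X F ->
  (forall i, algebraic_over F`_i) ->
  exists G, [/\ G \is a polyOver K, (1 < size G)%N & G %| X G].
Proof.
move=> Fs FX Falg.
have F0 : F != 0 by rewrite -size_poly_gt0 ltnW.
have l0 : (lead_coef F)^-1 != 0 by rewrite invr_eq0 lead_coef_eq0.
have [|||G0 G0n G0F] := @integral_multiple ((lead_coef F)^-1 *: F).
- by rewrite monicE lead_coefZ mulVf // lead_coef_eq0.
- by rewrite size_scale.
- move=> i; rewrite coefZ; apply/algebraic_overP; apply: algebraic_mul; last exact/algebraic_overP.
  by apply/algebraic_inv/algebraic_overP/Falg.
rewrite dvdpZl // in G0F.
have ex : exists n, `[< exists G : {poly subf}, [/\ G != 0, F %| map_poly val G & size G = n] >].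
  by exists (size G0); apply/asboolP; exists G0.
case: (ex_minnP ex) => n /asboolP[G [Gn0 FG Gn]] Gmin.
have [XG XGE] : exists XG : {poly subf}, X (map_poly val G) = map_poly val XG.
  by apply/subf_polyOverP/riccati_over/subf_polyOverP; exists G.
have FXG : F %| map_poly val XG.
  rewrite -XGE; case/dvdpP: FG => H ->; rewrite (derM (derivation_riccati _ hD)).
  by rewrite dvdp_addr ?dvdp_mulIr // dvdp_mull.
exists (map_poly val G); split.
- by apply/subf_polyOverP; exists G.
- rewrite (leq_trans Fs) // dvdp_leq // map_poly_eq0 //.
rewrite XGE dvdp_map /dvdp; apply/negPn/negP => r0.
suff : (n <= size (modp XG G))%N by rewrite -Gn leqNgt ltn_modp Gn0.
apply: Gmin; apply/asboolP; exists (XG %% G); split=> //.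
have -> : map_poly val (XG %% G) = map_poly val XG - map_poly val (XG %/ G) * map_poly val G.
  by rewrite [in X in X - _](divp_eq XG G) rmorphD rmorphM /= addrAC subrr add0r.
by rewrite dvdp_sub // dvdp_mull.
Qed.

End Subfield.

Lemma coefM_top (A : nzRingType) (p q : {poly A}) i j :
  (size p <= i.+1)%N -> (size q <= j.+1)%N -> (p * q)`_(i + j) = p`_i * q`_j.
Proof.
move=> hp hq; rewrite coefM.
rewrite (bigD1 (Ordinal (leq_addr j i : (i < (i + j).+1)%N))) //= addKn big1 ?addr0 // => k.
rewrite -val_eqE /= => ki; case: (ltngtP k i) ki => // [ki|ik] _.
  rewrite [q`_ _]nth_default ?mulr0 // (leq_trans hq) // ltn_subRL ltn_add2r //.
by rewrite [p`_ _]nth_default ?mul0r // (leq_trans hp).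
Qed.

Lemma size_mul_top (A : nzRingType) (p q : {poly A}) i j :
  (size p <= i.+1)%N -> (size q <= j.+1)%N -> (size (p * q)%R <= (i + j).+1)%N.
Proof.
move=> hp hq; apply: leq_trans (size_polyMleq _ _) _.
by rewrite -[(i + j).+1]/((i + j).+2.-1) -!subn1 leq_sub2r // -addnS -addSn leq_add.
Qed.

(** * Descent through a transcendental step *)

Section Transcendental.
Variables (E : fieldType) (D : E -> E) (rho : E).
Hypothesis hD : derivation D.
Local Notation X := (riccati_field D rho).

(** The field raises the degree in [W] by at most one, so the quotient is at most linear, and
    [riccati_top] gives its coefficient of [W]. *)
Lemma riccati_cofactor (F : {poly E}) : (1 < size F)%N -> F %| X F ->
  exists mu, X F = (mu%:P - ((size F).-1)%:R *: 'X) * F.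
Proof.
move=> Fs /dvdpP[L HL].
have F0 : F != 0 by rewrite -size_poly_gt0 ltnW.
have [L0|L0] := eqVneq L 0.
  exists 0; rewrite HL L0; suff -> : ((size F).-1)%:R = 0 :> E by rewrite scale0r subr0.
  have := riccati_top rho hD F; rewrite HL L0 mul0r coef0 => /esym/eqP.
  by rewrite oppr_eq0 -[X in X == 0]mulr_natr mulf_eq0 lead_coef_eq0 (negPf F0) => /eqP.
have Ls : (size L <= 2)%N.
  have := size_riccati rho hD F; rewrite HL size_mul // -ltnS.
  rewrite prednK ?addn_gt0 ?size_poly_gt0 ?L0 //.
  by rewrite -addn2 addnC leq_add2l.
exists L`_0; rewrite HL; congr (_ * _).
have L1 : L`_1 = - ((size F).-1)%:R.
  have := riccati_top rho hD F; rewrite HL.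
  have e : size F = (1 + (size F).-1)%N by rewrite add1n prednK // ltnW.
  rewrite [X in _`_X = _]e.
  rewrite coefM_top //; last by rewrite -add1n -e.
  rewrite -lead_coefE -[lead_coef F *+ _]mulr_natl -mulNr => /mulIf; apply.
  by rewrite lead_coef_eq0.
apply/polyP => -[|[|i]]; rewrite coefB coefC coefZ coefX /= ?mulr0 ?subr0 //.
  by rewrite L1 mulr1 sub0r.
by rewrite nth_default ?(leq_trans Ls) ?subrr //.
Qed.

Lemma coef_linearM (mu : E) n (F : {poly E}) i :
  ((mu%:P - n%:R *: 'X) * F)`_i = mu * F`_i - n%:R * (if i == 0 then 0 else F`_i.-1).
Proof. by rewrite mulrBl coefB coefCM -scalerAl coefZ coefXM. Qed.

Variables (K L : divringClosed E) (t alpha beta : E).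
Hypothesis KD : forall a, a \in K -> D a \in K.
Hypothesis LD : forall a, a \in L -> D a \in L.
Hypothesis Krho : rho \in K.
Hypothesis KL : {subset K <= L}.
Hypothesis Lt : t \in L.
Hypothesis Kalpha : alpha \in K.
Hypothesis Kbeta : beta \in K.
Hypothesis Dt : D t = alpha + beta * t.
Hypothesis t_tr : forall p, p \is a polyOver K -> p.[t] = 0 -> p = 0.

Definition fraction_over (z : E) : Prop := exists a b : {poly E},
  [/\ a \is a polyOver K, b \is a polyOver K, b.[t] != 0 & z = a.[t] / b.[t]].

Hypothesis Lfrac : forall z, z \in L -> fraction_over z.

(** The derivation on polynomials in a formal [t] that evaluation carries to [D]. As [D t] is affine
    in [t], it does not raise degrees. The case [beta = 0] is that of an antiderivative, [alpha = 0]
    that of an exponential. *)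
Let dt (a : {poly E}) : {poly E} := map_poly D a + (alpha%:P + beta *: 'X) * a^`().

Lemma der_horner_dt a : D a.[t] = (dt a).[t].
Proof.
by rewrite (der_horner hD) Dt /dt hornerD hornerM hornerD hornerC hornerZ hornerX mulrC.
Qed.

Lemma dt_over a : a \is a polyOver K -> dt a \is a polyOver K.
Proof.
move=> aK; rewrite /dt rpredD //.
  by apply/polyOverP => j; rewrite coef_mapD // KD // (polyOverP aK).
rewrite rpredM ?polyOver_deriv // rpredD ?polyOverC //.
by apply: polyOverZ => //; apply: polyOverX.
Qed.

Lemma common_denominator (f : nat -> E) n : (forall i, f i \in L) ->
  exists2 b : {poly E}, b \is a polyOver K /\ b.[t] != 0 &
  forall i, (i < n)%N -> exists2 a, a \is a polyOver K & b.[t] * f i = a.[t].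
Proof.
move=> fL; elim: n => [|n [b [bK b0] IH]].
  by exists 1; rewrite ?rpred1 ?hornerC ?oner_neq0.
have [a1 [b1 [a1K b1K b10 fE]]] := Lfrac (fL n).
exists (b * b1); first by rewrite rpredM // hornerM mulf_neq0.
move=> i; rewrite ltnS leq_eqVlt => /orP[/eqP-> | /IH[a aK aE]].
  exists (b * a1); first by rewrite rpredM.
  by rewrite !hornerM fE mulrA [b.[t] * b1.[t]]mulrC mulrC -mulrA mulrCA mulrA mulrA mulrAC mulfVK // mulrC.
by exists (b1 * a); [rewrite rpredM | rewrite !hornerM -aE; ring].
Qed.

Lemma size_dt (a : {poly E}) J : (size a <= J)%N -> (size (dt a) <= J)%N.
Proof.
move=> aJ; apply/leq_sizeP => i Ji; rewrite /dt coefD coef_mapD // mulrDl.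
rewrite coefD coefCM -scalerAl coefZ coefXM !coef_deriv.
have h j : (J <= j)%N -> a`_j = 0 by move=> hj; rewrite nth_default // (leq_trans aJ).
rewrite (h i) // (h i.+1) ?(leqW Ji) // (der0 hD) mul0rn mulr0 !add0r.
by case: i Ji => [|i] Ji /=; rewrite ?mulr0 // h // mul0rn mulr0.
Qed.

Lemma coef_dt_top (a : {poly E}) J : (size a <= J.+1)%N -> (dt a)`_J = D a`_J + J%:R * beta * a`_J.
Proof.
move=> aJ; rewrite /dt coefD coef_mapD // mulrDl; congr (_ + _).
rewrite coefD coefCM -scalerAl coefZ coefXM !coef_deriv nth_default // mul0rn mulr0 add0r.
case: J aJ => [|J] _ /=; first by rewrite mulr0 !mul0r.
by rewrite -mulr_natl; ring.
Qed.

Lemma darboux_transcendental (F : {poly E}) :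
  (forall n, n.+1%:R != 0 :> E) ->
  F \is a polyOver L -> (1 < size F)%N -> F %| X F ->
  exists G, [/\ G \is a polyOver K, (1 < size G)%N & G %| X G].
Proof.
move=> char0 /polyOverP FL Fs FX.
have [b [bK b0] hb] := @common_denominator (fun i => F`_i) (size F) FL.
have [mu XF] := riccati_cofactor Fs FX.
set m := (size F).-1 in XF; have mS : size F = m.+1 by rewrite /m prednK // ltnW.
have m0 : m%:R != 0 :> E by rewrite -[m]prednK // -ltnS -mS.
have F0 : F != 0 by rewrite -size_poly_gt0 ltnW.
pose H := b.[t] *: F.
have Hs : size H = m.+1 by rewrite size_scale.
have [nu XH] : exists nu, X H = (nu%:P - m%:R *: 'X) * H.
  rewrite -[m]/(m.+1.-1) -Hs; apply: riccati_cofactor; first by rewrite Hs -mS.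
  by rewrite /H dvdpZl // -mul_polyC (derM (derivation_riccati _ hD)) dvdp_add ?dvdp_mulIr ?dvdp_mull.
have XHi i : D H`_i + rho * H`_i.+1 *+ i.+1 - H`_i.-1 *+ i.-1
    = nu * H`_i - m%:R * (if i == 0 then 0 else H`_i.-1).
  by rewrite -coef_riccati // XH coef_linearM.
have /choice[a ha] : forall i, exists a, a \is a polyOver K /\ H`_i = a.[t].
  move=> i; rewrite coefZ; case: (ltnP i (size F)) => [/hb[a]|hi]; first by exists a.
  by exists 0; rewrite rpred0 horner0 nth_default ?mulr0.
have aK i := (ha i).1; have aE i := (ha i).2.
have HL i : H`_i \in L.
  rewrite coefZ rpredM // rpred_horner //.
  by apply/polyOverP => j; apply/KL/(polyOverP bK).
have Hm0 : H`_m != 0.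
  by rewrite -[m]/(m.+1.-1) -Hs -lead_coefE lead_coef_eq0 -size_poly_gt0 Hs.
have [e [c [eK cK c0 nuE]]] : fraction_over nu.
  apply: Lfrac.
  suff -> : nu = (D H`_m + rho * H`_m.+1 *+ m.+1 - H`_m.-1 *+ m.-1 +
     m%:R * (if m == 0 then 0 else H`_m.-1)) / H`_m.
    have vL : (if m == 0 then 0 else H`_m.-1) \in L by case: (m == 0); rewrite ?rpred0 ?HL.
    have rL := KL Krho; have DL := LD (HL m).
    by rewrite rpred_div ?rpredD ?rpredB ?rpredD ?rpredN ?rpredMn ?rpredM ?rpred_nat ?HL.
  by rewrite XHi subrK mulfK.
(* This is the Darboux equation of [H] at [W^i], multiplied by [c.[t]]; transcendence of [t] lifts
   it from values at [t] to polynomials in [t]. *)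
have key i : c * (dt (a i) + (rho *+ i.+1) *: a i.+1 - a i.-1 *+ i.-1)
    + (m%:R *: (c * (if i == 0 then 0 else a i.-1))) - e * a i = 0.
  apply: t_tr.
    rewrite rpredB ?rpredD ?rpredM //; last first.
      by apply: polyOverZ; rewrite ?rpred_nat // rpredM //; case: ifP; rewrite ?rpred0.
    rewrite rpredB ?rpredMn // rpredD //; last by apply: polyOverZ; rewrite ?rpredMn.
    exact: dt_over.
  rewrite hornerD hornerN hornerD !hornerM hornerD hornerN hornerD hornerMn !hornerZ hornerM.
  have -> : (if i == 0 then 0 else a i.-1).[t] = if i == 0 then 0 else H`_i.-1.
    by case: ifP => _; rewrite ?horner0 // aE.
  rewrite -der_horner_dt -!aE.
  have -> : e.[t] = nu * c.[t] by rewrite nuE divfK.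
  have /eqP := XHi i; rewrite -subr_eq0 => /eqP h.
  apply: etrans (etrans (congr1 (fun z => c.[t] * z) h) (mulr0 _)).
  by rewrite -[rho * _ *+ _]mulrnAl; ring.
have a0 i : (m < i)%N -> a i = 0.
  by move=> mi; apply: t_tr => //; rewrite -aE nth_default // Hs.
(* The coefficients of the highest power of [t] form a Darboux polynomial [G]
   over [K]; as its cofactor still has leading term [- m W], it is not constant. *)
have [i0 hi0] : exists i0, forall j, (size (a j) <= size (a i0))%N.
  case: (@arg_maxnP _ (ord0 : 'I_m.+1) xpredT (fun j => size (a j)) isT) => i0 _ h.
  exists i0 => j; case: (ltnP m j) => [/a0->|jm]; first by rewrite size_poly0.
  exact: (h (Ordinal (jm : (j < m.+1)%N))).
have ai0 : a i0 != 0.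
  rewrite -size_poly_gt0 (leq_trans _ (hi0 m)) // size_poly_gt0.
  by apply: contraNneq Hm0; rewrite aE => ->; rewrite horner0.
set J := (size (a i0)).-1.
have aJ j : (size (a j) <= J.+1)%N.
  by rewrite /J prednK ?size_poly_gt0.
have cn0 : c != 0 by apply: contraNneq c0 => ->; rewrite horner0.
set g := (size c).-1.
have cg : (size c <= g.+1)%N by rewrite /g prednK ?size_poly_gt0.
set u := fun i => dt (a i) + (rho *+ i.+1) *: a i.+1 - a i.-1 *+ i.-1 in key.
have uJ i : (size (u i) <= J.+1)%N.
  rewrite /u; apply: leq_trans (size_polyD _ _) _; rewrite geq_max size_polyN.
  rewrite -scaler_nat (leq_trans (size_scale_leq _ _) (aJ _)) andbT.
  apply: leq_trans (size_polyD _ _) _; rewrite geq_max size_dt ?aJ //=.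
  exact: leq_trans (size_scale_leq _ _) _.
set v := fun i => if i == 0 then 0 else a i.-1 in key.
have vJ i : (size (v i) <= J.+1)%N by rewrite /v; case: ifP; rewrite ?size_poly0.
have cM (w : {poly E}) : (size w <= J.+1)%N -> (size (c * w)%R <= (g + J).+1)%N.
  exact: size_mul_top.
(* No term on the other side exceeds degree [g + J] in [t], so the equation at [i0], where the
   maximal degree [J] is attained, bounds the degree of [e] by that of [c]. *)
have eg : (size e <= g.+1)%N.
  have [->|e0] := eqVneq e 0; first by rewrite size_poly0.
  have : (size (e * a i0)%R <= (g + J).+1)%N.
    move/eqP: (key i0); rewrite subr_eq0 => /eqP <-.
    apply: leq_trans (size_polyD _ _) _; rewrite geq_max (cM _ (uJ _)) /=.
    by apply: leq_trans (size_scale_leq _ _) _; exact: cM (vJ _).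
  by rewrite size_mul // -[size (a i0)]prednK ?size_poly_gt0 // addnS /= -addSn leq_add2r.
have cg0 : c`_g != 0 by rewrite -lead_coefE lead_coef_eq0.
pose G := \poly_(i < m.+1) (a i)`_J.
have Gi i : G`_i = (a i)`_J.
  by rewrite coef_poly; case: ltnP => // /a0->; rewrite coef0.
(* Compare the coefficients of [t^(g + J)]; the shift [J%:R * beta] of the cofactor comes from
   differentiating [t^J]. *)
have XG : X G = ((e`_g / c`_g - J%:R * beta)%:P - m%:R *: 'X) * G.
  apply/polyP => i; rewrite coef_riccati // coef_linearM !Gi.
  have := congr1 (fun p : {poly E} => p`_(g + J)) (key i).
  rewrite coefB coefD coefZ !coefM_top //; last 2 first; [exact: vJ|exact: uJ|].
  rewrite coef0 coefB coefD coefZ coefMn coef_dt_top // [rho *+ _ * _]mulrnAl.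
  have -> : (if i == 0 then 0 else a i.-1)`_J = if i == 0 then 0 else (a i.-1)`_J.
    by case: ifP; rewrite ?coef0.
  move=> h; apply: (mulfI cg0); apply/eqP; rewrite -subr_eq0; apply/eqP; apply: etrans h.
  move: (rho * _ *+ i.+1) (_ *+ i.-1) (if _ then _ else _) (J%:R : E) (m%:R : E) => r1 r2 r3 r4 r5.
  field; exact: cg0.
have G0 : G != 0.
  have : G`_i0 != 0 by rewrite Gi -lead_coefE lead_coef_eq0.
  by apply: contraNneq => ->; rewrite coef0.
exists G; split; last by rewrite XG dvdp_mull.
  by apply/polyOverP => i; rewrite Gi (polyOverP (aK i)).
rewrite ltnNge; apply/negP => /size1_polyC GC.
have := congr1 (fun p : {poly E} => p`_1) XG.
rewrite coef_linearM /= {1}GC riccati_C // coefC /= [G`_1]nth_default.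
  rewrite mulr0 sub0r => /esym/eqP; rewrite oppr_eq0 mulf_eq0 (negPf m0) /=.
  by apply/negP; apply: contraNneq G0; rewrite {2}GC => ->.
by rewrite GC size_polyC_leq1.
Qed.
End Transcendental.

(** * The subfields generated along a tower *)

Section Generated.
Variables (F : fieldType) (E : diff_ext F).
Local Notation D := (@de_D _ E).
Local Notation iota := (@de_iota _ E).

Lemma derivation_de : derivation D.
Proof. by split; [exact: de_DD | exact: de_DM]. Qed.
Let hD := derivation_de.

Definition gen_pred (S : seq E) : {pred E} := fun z => `[< in_gen S z >].

Lemma gen_predP S z : reflect (in_gen S z) (z \in gen_pred S).
Proof. exact: asboolP. Qed.

Lemma gen_divring_closed S : divring_closed (gen_pred S).
Proof.
split=> [|a b /gen_predP ha /gen_predP hb|a b /gen_predP ha /gen_predP hb];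
  apply/gen_predP => P h1 h2 h3 h4 h5.
- by have := h1 1; rewrite rmorph1.
- by apply: (h3); [exact: (ha P) | exact: (hb P)].
- by apply: (h4); [exact: (ha P) | exact: (h5 _ (hb P h1 h2 h3 h4 h5))].
Qed.

HB.instance Definition _ S := GRing.isDivringClosed.Build E (gen_pred S) (gen_divring_closed S).

Lemma gen_poly S p : iota p \in gen_pred S.
Proof. by apply/gen_predP => P h1 *; apply: h1. Qed.

Lemma gen_mem S t : t \in S -> t \in gen_pred S.
Proof. by move=> tS; apply/gen_predP => P _ h2 *; apply: h2. Qed.

Lemma gen_sub S (P : divringClosed E) :
  (forall p, iota p \in P) -> {subset S <= P} -> {subset gen_pred S <= P}.
Proof.
move=> h1 h2 z /gen_predP hz; apply: (hz (fun x => x \in P)) => //.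
- by move=> a b; apply: rpredB.
- by move=> a b; apply: rpredM.
- by move=> a; rewrite rpredV.
Qed.

Lemma gen_der S : (forall t, t \in S -> D t \in gen_pred S) ->
  forall a, a \in gen_pred S -> D a \in gen_pred S.
Proof.
move=> hS a aS; suff [] : a \in gen_pred S /\ D a \in gen_pred S by [].
move/gen_predP: (aS) => ha.
apply: (ha (fun x => x \in gen_pred S /\ D x \in gen_pred S)).
- by move=> p; rewrite de_Dpoly !gen_poly.
- by move=> t tS; rewrite gen_mem ?hS.
- by move=> b c [? ?] [? ?]; rewrite (derB hD) !rpredB.
- by move=> b c [? ?] [? ?]; rewrite (derM hD) rpredD ?rpredM.
- move=> b [? ?]; rewrite rpredV; split=> //.
  have [->|b0] := eqVneq b 0; first by rewrite invr0 (der0 hD) rpred0.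
  by rewrite (derV hD) // rpredN rpred_div // rpredX.
Qed.

Lemma gen_nil z : z \in gen_pred [::] -> exists p q, q != 0 /\ z = iota p / iota q.
Proof.
have inj0 q : q != 0 -> iota q != 0.
  by move=> q0; rewrite -(rmorph0 iota) (inj_eq (@de_inj _ E)).
move/gen_predP=> hz; apply: (hz (fun z => exists p q, q != 0 /\ z = iota p / iota q)) => //.
- by move=> p; exists p, 1; rewrite oner_neq0 rmorph1 divr1.
- move=> a b [p [q [q0 ->]]] [p' [q' [q'0 ->]]]; exists (p * q' - p' * q), (q * q').
  rewrite mulf_neq0 // rmorphB !rmorphM /=; split=> //.
  by field; rewrite !inj0.
- move=> a b [p [q [q0 ->]]] [p' [q' [q'0 ->]]]; exists (p * p'), (q * q').
  by rewrite mulf_neq0 // !rmorphM /=; split=> //; field; rewrite !inj0.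
- move=> a [p [q [q0 ->]]]; have [->|p0] := eqVneq p 0.
    by exists 0, 1; rewrite oner_neq0 rmorph0 !mul0r invr0.
  by exists q, p; rewrite invf_div.
Qed.

Lemma gen_rcons_sub S t : {subset gen_pred S <= gen_pred (rcons S t)}.
Proof.
apply: gen_sub => [p|s sS]; first exact: gen_poly.
by apply: gen_mem; rewrite mem_rcons inE sS orbT.
Qed.

Lemma gen_rcons_last S t : t \in gen_pred (rcons S t).
Proof. by apply: gen_mem; rewrite mem_rcons mem_head. Qed.

Lemma gen_der_rcons S t : (forall a, a \in gen_pred S -> D a \in gen_pred S) ->
  D t \in gen_pred (rcons S t) ->
  forall a, a \in gen_pred (rcons S t) -> D a \in gen_pred (rcons S t).
Proof.
move=> hS ht; apply: gen_der => s; rewrite mem_rcons inE => /orP[/eqP->//|sS].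
by apply/gen_rcons_sub/hS/gen_mem.
Qed.

Lemma gen_rcons_algebraic S t z : algebraic_over (gen_pred S) t ->
  z \in gen_pred (rcons S t) -> algebraic_over (gen_pred S) z.
Proof.
move=> talg /gen_predP h.
have inK a : a \in gen_pred S -> algebraic_over (gen_pred S) a.
  move=> aS; apply/algebraic_overP.
  by rewrite -[a]/(val (Sub a aS : subf (gen_pred S))); apply: algebraic_id.
apply: (h (algebraic_over (gen_pred S))) => [p|s|a b /algebraic_overP ha /algebraic_overP hb
  |a b /algebraic_overP ha /algebraic_overP hb|a /algebraic_overP ha].
- exact/inK/gen_poly.
- by rewrite mem_rcons inE => /orP[/eqP->//|/gen_mem/inK].
- by apply/algebraic_overP/algebraic_sub.
- by apply/algebraic_overP/algebraic_mul.
- by apply/algebraic_overP/algebraic_inv.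
Qed.

Lemma gen_rcons_fraction S t z :
  (forall p, p \is a polyOver (gen_pred S) -> p.[t] = 0 -> p = 0) ->
  z \in gen_pred (rcons S t) -> fraction_over (gen_pred S) t z.
Proof.
move=> tr /gen_predP h; set K := gen_pred S.
have inK a : a \in K -> fraction_over K t a.
  by move=> aK; exists a%:P, 1; rewrite polyOverC aK rpred1 !hornerC oner_neq0 divr1.
apply: (h (fraction_over K t)).
- by move=> p; apply/inK/gen_poly.
- move=> s; rewrite mem_rcons inE => /orP[/eqP->|/gen_mem/inK//].
  by exists 'X, 1; rewrite polyOverX rpred1 hornerX hornerC oner_neq0 divr1.
- move=> a b [p [q [pK qK q0 ->]]] [p' [q' [p'K q'K q'0 ->]]].
  exists (p * q' - p' * q), (q * q'); rewrite !(hornerE, mulf_neq0) //; split=> //.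
  + by rewrite rpredB ?rpredM.
  + by rewrite rpredM.
  + by field; rewrite q0 q'0.
- move=> a b [p [q [pK qK q0 ->]]] [p' [q' [p'K q'K q'0 ->]]].
  exists (p * p'), (q * q'); rewrite !hornerM mulf_neq0 //; split=> //.
  + by rewrite rpredM.
  + by rewrite rpredM.
  + by field; rewrite q0 q'0.
- move=> a [p [q [pK qK q0 ->]]]; have [p0|p0] := eqVneq p.[t] 0.
    by exists 0, 1; rewrite rpred0 rpred1 p0 horner0 hornerC oner_neq0 !mul0r invr0.
  by exists q, p; rewrite invf_div.
Qed.

Hypothesis char0 : forall n, n.+1%:R != 0 :> F.

Lemma de_char0 n : n.+1%:R != 0 :> E.
Proof.
rewrite -(rmorph_nat iota) -(rmorph0 iota) (inj_eq (@de_inj _ E)).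
by rewrite -polyC_natr polyC_eq0.
Qed.

(** Differentiate [p.[t] = 0] for a [p] of least size: the derivative of [p] does not vanish at [t],
    by minimality and characteristic zero, so the relation can be solved for [D t]. *)
Lemma algebraic_der S t : (forall a, a \in gen_pred S -> D a \in gen_pred S) ->
  algebraic_over (gen_pred S) t -> D t \in gen_pred (rcons S t).
Proof.
move=> SD [p0 [p00 p0K p0t]].
have ex : exists n, `[< exists p, [/\ p != 0, p \is a polyOver (gen_pred S), root p t & size p = n] >].
  by exists (size p0); apply/asboolP; exists p0.
case: (ex_minnP ex) => n /asboolP[p [pn0 pK pt pn]] pmin.
have ps : (1 < size p)%N.
  rewrite ltnNge; apply/negP => /size1_polyC pC; move: pt pn0.
  by rewrite pC rootC polyC_eq0 => ->.
have p't : p^`().[t] != 0.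
  apply/negP => p't; suff : (n <= size p^`())%N by rewrite -pn leqNgt lt_size_deriv.
  apply: pmin; apply/asboolP; exists p^`().
  rewrite polyOver_deriv //; split=> //.
  apply: contraTneq ps => /(congr1 (fun q : {poly E} => q`_(size p).-2)).
  rewrite coef_deriv coef0 -ltnNge ltnS; case: (size p) (lead_coefE p) => [|[|m]] //= lE /eqP.
  by rewrite -lE -mulr_natr mulf_eq0 lead_coef_eq0 (negPf pn0) (negPf (de_char0 _)).
have -> : D t = - ((map_poly D p).[t] / p^`().[t]).
  apply: (mulIf p't); rewrite mulNr divfK //; apply/eqP; rewrite -addr_eq0 addrC mulrC.
  by rewrite -der_horner // (rootP pt) der0.
have sub q : q \is a polyOver (gen_pred S) -> q.[t] \in gen_pred (rcons S t).
  move=> /polyOverP qK; rewrite rpred_horner ?gen_rcons_last //.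
  by apply/polyOverP => i; apply: gen_rcons_sub.
rewrite rpredN rpred_div ?sub ?polyOver_deriv //.
by apply/polyOverP => i; rewrite coef_mapD // SD // (polyOverP pK).
Qed.

End Generated.

(** * Descent along a whole tower to the rational functions *)

Section Descent.
Variables (F : fieldType) (E : diff_ext F) (R : {poly F}).
Local Notation D := (@de_D _ E).
Local Notation iota := (@de_iota _ E).
Hypothesis char0 : forall n, n.+1%:R != 0 :> F.
Local Notation X := (riccati_field D (iota R)).
Local Notation X0 := (riccati_field (@deriv F) R).

(** Closure under [D] belongs to the same induction, because each descent step needs it for the
    field below. *)
Lemma darboux_tower_prefix (ts : seq E) i : liouv_tower ts -> (i <= size ts)%N ->
    (forall a, a \in gen_pred (take i ts) -> D a \in gen_pred (take i ts)) /\
    forall G, G \is a polyOver (gen_pred (take i ts)) -> (1 < size G)%N -> G %| X G ->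
  exists H, [/\ H \is a polyOver (gen_pred ([::] : seq E)), (1 < size H)%N & H %| X H].
Proof.
move=> tower; have hD := derivation_de E.
elim: i => [_|i IH lti]; first by rewrite take0; split=> [|H]; [exact: gen_der | exists H].
have [KD desc] := IH (ltnW lti); have {IH} step := tower i lti.
rewrite (take_nth 0 lti); set t := nth 0 ts i in step *; set S := take i ts in step desc KD *.
(* The division is by the nature of [t] and not by the clause of the tower: an antiderivative or
   exponential that happens to be algebraic falls under the algebraic case. *)
have [talg|ttr] := pselect (algebraic_over (gen_pred S) t).
  have Dt := algebraic_der char0 KD talg.
  split=> [|H Hover Hs HX]; first exact: gen_der_rcons.
  have [G' [? ? ?]] : exists G', [/\ G' \is a polyOver (gen_pred S), (1 < size G')%N & G' %| X G'].
    apply: (darboux_algebraic hD KD (gen_poly _ _) Hs HX) => j.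
    by apply: (gen_rcons_algebraic talg); apply: (polyOverP Hover).
  exact: (desc G').
have tr p : p \is a polyOver (gen_pred S) -> p.[t] = 0 -> p = 0.
  by move=> pS pt; apply: contra_notP ttr => /eqP p0; exists p; split=> //; apply/eqP.
have [al [be [alS beS Dt]]] : exists al be,
    [/\ al \in gen_pred S, be \in gen_pred S & D t = al + be * t].
  case: step => [[p [p0 pS pt]]|/gen_predP h|[t0 /gen_predP h]].
  - by case: ttr; exists p; split=> //; apply/polyOverP => j; apply/gen_predP.
  - by exists (D t), 0; rewrite h rpred0 mul0r addr0.
  - by exists 0, (D t / t); rewrite h rpred0 add0r divfK.
have LD : forall a, a \in gen_pred (rcons S t) -> D a \in gen_pred (rcons S t).
  apply: gen_der_rcons => //; rewrite Dt rpredD ?rpredM //; try exact: gen_rcons_sub.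
  exact: gen_rcons_last.
split=> // H Hover Hs HX.
have [G' [? ? ?]] : exists G', [/\ G' \is a polyOver (gen_pred S), (1 < size G')%N & G' %| X G'].
  apply: (darboux_transcendental hD KD LD (gen_poly _ _) (@gen_rcons_sub _ _ _ _)
    (gen_rcons_last _ _) alS beS Dt tr _ (de_char0 _ char0) Hover Hs HX).
  by move=> z; apply: gen_rcons_fraction.
exact: (desc G').
Qed.

Lemma tower_der (ts : seq E) : liouv_tower ts ->
  forall a, a \in gen_pred ts -> D a \in gen_pred ts.
Proof. by move=> /darboux_tower_prefix /(_ (leqnn _)) []; rewrite take_size. Qed.

Lemma darboux_tower (ts : seq E) (G : {poly E}) : liouv_tower ts ->
  G \is a polyOver (gen_pred ts) -> (1 < size G)%N -> G %| X G ->
  exists H, [/\ H \is a polyOver (gen_pred ([::] : seq E)), (1 < size H)%N & H %| X H].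
Proof. by move=> /darboux_tower_prefix /(_ (leqnn _)) [_]; rewrite take_size; apply. Qed.

Lemma iota_neq0 q : q != 0 -> iota q != 0.
Proof. by move=> q0; rewrite -(rmorph0 iota) (inj_eq (@de_inj _ E)). Qed.

Lemma map_iota_inj : injective (map_poly iota).
Proof.
move=> p q /polyP h; apply/polyP => i; apply: (@de_inj _ E).
by have := h i; rewrite !coef_map.
Qed.

Lemma map_iota_riccati (G : {poly {poly F}}) : X (map_poly iota G) = map_poly iota (X0 G).
Proof.
apply/polyP => i; rewrite coef_map (coef_riccati _ (derivation_de E)) !coef_map.
rewrite (coef_riccati _ (derivation_deriv F)) /= de_Dpoly.
by rewrite rmorphB rmorphD !rmorphMn rmorphM.
Qed.

Lemma clear_denominators (f : nat -> E) n :
  (forall i, f i \in gen_pred ([::] : seq E)) ->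
  exists2 b : {poly F}, b != 0 & forall i, (i < n)%N -> exists a, iota b * f i = iota a.
Proof.
move=> fK; elim: n => [|n [b b0 IH]]; first by exists 1; rewrite ?oner_neq0.
have [p [q [q0 fE]]] := gen_nil (fK n).
exists (b * q) => [|i]; first by rewrite mulf_neq0.
rewrite ltnS leq_eqVlt => /orP[/eqP->|/IH[a aE]].
  by exists (b * p); rewrite fE !rmorphM /=; field; rewrite iota_neq0.
by exists (q * a); rewrite rmorphM -aE rmorphM /=; ring.
Qed.

Lemma darboux_base (G : {poly E}) :
  G \is a polyOver (gen_pred ([::] : seq E)) -> (1 < size G)%N -> G %| X G ->
  exists (b : {poly F}) (H : {poly {poly F}}) (c e : {poly F}),
    [/\ b != 0, map_poly iota H = iota b *: G, c != 0 &
     c%:P * X0 H = (e%:P - (((size G).-1)%:R * c)%:P * 'X) * H].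
Proof.
move=> /polyOverP GK Gs GX; have hD := derivation_de E.
have KD : forall a, a \in gen_pred ([::] : seq E) -> D a \in gen_pred ([::] : seq E).
  exact: gen_der.
have [mu XG] := riccati_cofactor hD Gs GX.
set m := (size G).-1 in XG *.
have G0 : G`_m != 0 by rewrite -lead_coefE lead_coef_eq0 -size_poly_gt0 ltnW.
have [e [c [c0 muE]]] : exists e c, c != 0 /\ mu = iota e / iota c.
  apply: gen_nil.
  suff -> : mu = ((X G)`_m + m%:R * (if m == 0 then 0 else G`_m.-1)) / G`_m.
    rewrite coef_riccati //.
    have vL : (if m == 0 then 0 else G`_m.-1) \in gen_pred ([::] : seq E).
      by case: (m == 0); rewrite ?rpred0 ?GK.
    have rL := gen_poly ([::] : seq E) R; have DL := KD _ (GK m).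
    by rewrite rpred_div ?rpredD ?rpredB ?rpredD ?rpredN ?rpredMn ?rpredM ?rpred_nat ?GK.
  by rewrite XG coef_linearM subrK mulfK.
have [b b0 hb] := clear_denominators (size G) GK.
have /choice[a aE] : forall i, exists a, iota b * G`_i = iota a.
  move=> i; case: (ltnP i (size G)) => [/hb//|hi]; exists 0.
  by rewrite rmorph0 nth_default ?mulr0.
pose H := \poly_(i < size G) a i.
have HE : map_poly iota H = iota b *: G.
  apply/polyP => i; rewrite coef_map coefZ aE coef_poly; case: ltnP => // hi.
  by rewrite raddf0 -aE nth_default ?mulr0.
(* Here [b] clears the coefficients and [c] the cofactor; the term with the derivative of [b] arises
   because [X] differentiates the factor [b]. *)
exists b, H, (c * b), (c * b^`() + e * b); split=> //; first by rewrite mulf_neq0.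
apply: map_iota_inj; rewrite !rmorphM /= -map_iota_riccati HE rmorphB /= rmorphM /=.
rewrite !map_polyC /= map_polyX -[iota b *: G]mul_polyC (derM (derivation_riccati _ hD)) riccati_C // XG.
rewrite !rmorphD !rmorphM /= rmorph_nat de_Dpoly muE.
have -> : (iota e / iota c)%:P = (iota e)%:P * (iota c)^-1%:P by rewrite polyCM.
rewrite rmorph_nat !map_polyC /= -[m%:R *: 'X]mul_polyC polyC_natr.
have cV : (iota c)%:P * (iota c)^-1%:P = 1 by rewrite -polyCM divff ?iota_neq0.
rewrite -[(iota e)%:P in RHS]mulr1 -cV; ring.
Qed.

End Descent.

(** * Rational functions and exponentials of polynomials *)

Lemma quotient_rule_add (K : fieldType) (m q n p n' m' p' q' : K) : m != 0 -> q != 0 ->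
  ((n' * q + n * q' + (p' * m + p * m')) * (m * q)
     - (n * q + p * m) * (m' * q + m * q')) / (m * q) ^+ 2
  = (n' * m - n * m') / m ^+ 2 + (p' * q - p * q') / q ^+ 2.
Proof. by move=> m0 q0; field; rewrite m0 q0. Qed.

Lemma quotient_rule_mul (K : fieldType) (m q n p n' m' p' q' : K) : m != 0 -> q != 0 ->
  ((n' * p + n * p') * (m * q) - n * p * (m' * q + m * q')) / (m * q) ^+ 2
  = (n' * m - n * m') / m ^+ 2 * (p / q) + n / m * ((p' * q - p * q') / q ^+ 2).
Proof. by move=> m0 q0; field; rewrite m0 q0. Qed.

(** * Extending a derivation to the field of fractions *)

Section FractionDerivation.
Local Open Scope quotient_scope.
Variables (A : idomainType) (d : A -> A).
Hypothesis hd : derivation d.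
Local Notation fr := (@FracField.tofrac A).

Lemma fraction_divE (x : {fraction A}) : exists n m, m != 0 /\ x = fr n / fr m.
Proof.
elim/quotW: x => r; exists (frac r).1, (frac r).2; split; first exact: denom_ratioP.
unlock FracField.tofrac; rewrite -[X in _ = _ * X]FracField.pi_inv -[RHS]FracField.pi_mul.
rewrite /FracField.mulf /FracField.invf !numden_Ratio ?oner_neq0 ?denom_ratioP //.
by rewrite mulr1 mul1r Ratio_numden.
Qed.

Definition fraction_num x := sval (cid (fraction_divE x)).
Definition fraction_den x := sval (cid (svalP (cid (fraction_divE x)))).

Lemma fraction_numdenP x :
  fraction_den x != 0 /\ x = fr (fraction_num x) / fr (fraction_den x).
Proof. exact: (svalP (cid (svalP (cid (fraction_divE x))))). Qed.

Definition fraction_der (x : {fraction A}) : {fraction A} :=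
  fr (d (fraction_num x) * fraction_den x - fraction_num x * d (fraction_den x))
  / fr (fraction_den x) ^+ 2.

(** Two representatives satisfy [n * b = a * m]; this relation and its derivative together show that
    the quotient rule does not depend on the chosen one. *)
Lemma fraction_derE n m : m != 0 ->
  fraction_der (fr n / fr m) = fr (d n * m - n * d m) / fr m ^+ 2.
Proof.
move=> m0; rewrite /fraction_der; set x := fr n / fr m.
have [] := fraction_numdenP x; move: (fraction_num x) (fraction_den x) => a b b0.
rewrite {}/x => /eqP; have fm0 : fr m != 0 by rewrite tofrac_eq0.
have fb0 : fr b != 0 by rewrite tofrac_eq0.
rewrite eqr_div // -!rmorphM tofrac_eq => /eqP nb.
have nb' := congr1 d nb; rewrite !(derM hd) in nb'.
apply/eqP; rewrite -!rmorphXn eqr_div -?rmorphM ?rmorphXn ?expf_neq0 // tofrac_eq; apply/eqP.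
apply/eqP; rewrite -subr_eq0.
have -> : (d a * b - a * d b) * m ^+ 2 - (d n * m - n * d m) * b ^+ 2
  = (n * b - a * m) * (m * d b + b * d m)
    - m * b * (d n * b + n * d b - (d a * m + a * d m)) by ring.
by rewrite nb nb' !subrr mul0r mulr0 subrr.
Qed.

Lemma derivation_fraction : derivation fraction_der.
Proof.
split=> x y; have [n [m [m0 ->]]] := fraction_divE x;
  have [p [q [q0 ->]]] := fraction_divE y;
  have fm0 : fr m != 0 by [rewrite tofrac_eq0]; have fq0 : fr q != 0 by [rewrite tofrac_eq0].
  rewrite addf_div // -!rmorphM -rmorphD !fraction_derE ?mulf_neq0 //.
  rewrite (derD hd) !(derM hd) !(rmorphB, rmorphD, rmorphM).
  exact: quotient_rule_add.
rewrite mulf_div -!rmorphM !fraction_derE ?mulf_neq0 //.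
rewrite !(derM hd) !(rmorphB, rmorphD, rmorphM).
exact: quotient_rule_mul.
Qed.

Lemma fraction_der_tofrac a : fraction_der (fr a) = fr (d a).
Proof.
have -> : fr a = fr a / fr 1 by rewrite rmorph1 divr1.
by rewrite fraction_derE ?oner_neq0 // (der1 hd) mulr0 subr0 mulr1 rmorph1 expr1n divr1.
Qed.

End FractionDerivation.

Lemma tofrac_inj (A : idomainType) : injective (@FracField.tofrac A).
Proof. by move=> x y /eqP; rewrite tofrac_eq => /eqP. Qed.

(** Polynomials in [W] over [F[x]] are viewed over this field when a gcd or a discriminant is
    taken. *)
Definition ratfun_ext (F : fieldType) : diff_ext F :=
  @DiffExt F {fraction {poly F}} (fraction_der (@deriv F)) (@FracField.tofrac {poly F})
    (derivation_fraction (derivation_deriv F)).1 (derivation_fraction (derivation_deriv F)).2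
    (@tofrac_inj _) (fraction_der_tofrac (derivation_deriv F)).

Lemma ratfun_gen (F : fieldType) (z : ratfun_ext F) : z \in gen_pred ([::] : seq (ratfun_ext F)).
Proof.
have [n [m [_ ->]]] := fraction_divE (z : {fraction {poly F}}).
by apply: rpred_div; exact: (gen_poly (E := ratfun_ext F)).
Qed.

Section Exponential.
Variables (F : fieldType) (A : {poly F}).

(* The indeterminate ['X] plays the role of [exp (int A)]. *)
Definition exp_der (p : {poly {poly F}}) : {poly {poly F}} :=
  map_poly (@deriv F) p + A%:P * 'X * p^`().

Lemma derivation_exp_der : derivation exp_der.
Proof.
have h := derivation_map_poly (derivation_deriv F).
split=> p q; rewrite /exp_der.
  by rewrite (derD h) derivD mulrDr addrACA.
by rewrite (derM h) derivM; ring.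
Qed.

Lemma exp_der_C p : exp_der p%:P = (p^`())%:P.
Proof. by rewrite /exp_der (map_polyD_C (derivation_deriv F)) derivC mulr0 addr0. Qed.

Definition exp_iota : {rmorphism {poly F} -> {fraction {poly {poly F}}}} :=
  @FracField.tofrac {poly {poly F}} \o polyC.

Lemma exp_iota_inj : injective exp_iota.
Proof. by move=> p q /tofrac_inj /polyC_inj. Qed.

Lemma exp_iota_der p : fraction_der exp_der (exp_iota p) = exp_iota p^`().
Proof. by rewrite /exp_iota /= (fraction_der_tofrac derivation_exp_der) exp_der_C. Qed.

Definition exp_ext : diff_ext F :=
  @DiffExt F {fraction {poly {poly F}}} (fraction_der exp_der) exp_iota
    (derivation_fraction derivation_exp_der).1 (derivation_fraction derivation_exp_der).2
    exp_iota_inj exp_iota_der.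

Definition exp_elt : exp_ext := @FracField.tofrac {poly {poly F}} 'X.

Lemma exp_elt_neq0 : exp_elt != 0.
Proof. by rewrite tofrac_eq0 polyX_eq0. Qed.

Lemma exp_eltE : @de_D _ exp_ext exp_elt = @de_iota _ exp_ext A * exp_elt.
Proof.
rewrite /= (fraction_der_tofrac derivation_exp_der) /exp_elt -rmorphM /=; congr (FracField.tofrac _).
rewrite /exp_der derivX mulr1; suff -> : map_poly (@deriv F) 'X = 0 by rewrite add0r.
apply/polyP => i; rewrite (coef_mapD (derivation_deriv F)) coefX coef0.
by case: eqP => _; rewrite ?deriv0 -?polyC1 ?derivC.
Qed.

End Exponential.

(* With [B = A + P/2], the equation satisfied by the polynomial factor [M] of a
   solution [M exp(int A)]. *)
Definition spectral_eq (F : fieldType) (R M B : {poly F}) : Prop :=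
  M^`()^`() + 2%:R * B * M^`() + (B^`() + B ^+ 2 - R) * M = 0.

(** The potential [R] of [y'' = R y], reached by the d'Alembert substitution. *)
Definition normal_potential (F : fieldType) (P Q : {poly F}) : {poly F} :=
  4%:R^-1 *: P ^+ 2 + 2%:R^-1 *: P^`() - Q.

Lemma phexp_spectral (F : fieldType) d (P Q : {poly F}) : 2%:R != 0 :> F ->
  has_phexp_sol d P Q <->
  exists M B : {poly F}, size M = d.+1 /\ spectral_eq (normal_potential P Q) M B.
Proof.
move=> two0.
have eqE (M A : {poly F}) : M^`()^`() + (2%:R * A + P) * M^`() + (A^`() + A ^+ 2 + P * A + Q) * M
   = M^`()^`() + 2%:R * (A + 2%:R^-1 *: P) * M^`() +
   ((A + 2%:R^-1 *: P)^`() + (A + 2%:R^-1 *: P) ^+ 2 - normal_potential P Q) * M.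
  have h2 : 2%:R * (2%:R^-1)%:P = 1 :> {poly F} by rewrite -polyC_natr -polyCM divff.
  have h4 : (4%:R^-1)%:P = (2%:R^-1)%:P * (2%:R^-1)%:P :> {poly F}.
    by rewrite -polyCM -invfM -natrM.
  rewrite /normal_potential derivD derivZ -!mul_polyC h4.
  set h := (2%:R^-1)%:P in h2 *.
  have e1 : P = 2%:R * h * P by rewrite h2 mul1r.
  rewrite [in (_ + P) * _]e1 [in P * A]e1; ring.
have solE (E : diff_ext F) (M A : {poly F}) (e : E) : @de_D _ E e = @de_iota _ E A * e ->
  @de_D _ E (@de_D _ E (@de_iota _ E M * e)) + @de_iota _ E P * @de_D _ E (@de_iota _ E M * e)
   + @de_iota _ E Q * (@de_iota _ E M * e) =
  @de_iota _ E (M^`()^`() + (2%:R * A + P) * M^`() + (A^`() + A ^+ 2 + P * A + Q) * M) * e.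
  move=> De; rewrite !de_DM De !de_DD !de_DM De !de_Dpoly.
  rewrite !(rmorphD, rmorphM, rmorphXn, rmorph_nat) /=; ring.
split=> [[E [M [A [e [Ms e0 De]]]]]|[M [B [Ms MB]]]].
  rewrite /is_sol (solE _ _ _ _ De) => /eqP; rewrite mulf_eq0 (negPf e0) orbF.
  rewrite -(rmorph0 (@de_iota _ E)) (inj_eq (@de_inj _ E)) eqE => /eqP h.
  by exists M, (A + 2%:R^-1 *: P).
(* Take [A = B - P/2] and adjoin its exponential as a new indeterminate. *)
exists (exp_ext (B - 2%:R^-1 *: P)), M, (B - 2%:R^-1 *: P), (exp_elt _).
rewrite exp_elt_neq0 exp_eltE; split=> //.
by rewrite /is_sol (solE _ _ _ _ (exp_eltE _)) eqE subrK MB rmorph0 mul0r.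
Qed.

(** * Darboux polynomials over C[x] *)

Section Primitive.
Variables (F : closedFieldType) (R : {poly F}).
Local Notation X0 := (riccati_field (@deriv F) R).

(** Linear factors of [c] are removed one at a time. Each removal lowers the degree of [c] or, when
    [H] is divided instead, that of its leading coefficient; the sum of the two sizes decreases
    until [c] is constant. *)
Lemma primitive_darboux m (H : {poly {poly F}}) (c e : {poly F}) : c != 0 -> H != 0 ->
  c%:P * X0 H = (e%:P - (m%:R * c)%:P * 'X) * H ->
  exists (H' : {poly {poly F}}) (mu : {poly F}), size H' = size H /\ X0 H' = (mu%:P - m%:R%:P * 'X) * H'.
Proof.
have [N] := ubnP (size c + size (lead_coef H)).
elim: N H c e => // N IH H c e; rewrite ltnS => hN c0 H0 XH.
have hd := derivation_riccati R (derivation_deriv F).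
have [c1|cs] := leqP (size c) 1.
  have [c' c'0 cE] : exists2 c', c' != 0 & c = c'%:P.
    by exists c`_0; [rewrite -polyC_eq0|]; rewrite -(size1_polyC c1).
  have cV : (c'^-1)%:P%:P * c%:P = 1 :> {poly {poly F}}.
    by rewrite -polyCM cE -polyCM mulVf.
  exists H, ((c'^-1)%:P * e); split=> //.
  rewrite -[LHS]mul1r -cV -mulrA XH !polyCM mulrA; congr (_ * _).
  by rewrite mulrBr !mulrA; congr (_ - _ * _); rewrite mulrAC cV mul1r.
(* A root of [c] is either a root of [e] or of all the coefficients of [H]. *)
have [x0] : exists x0, root c x0 by apply/closed_rootP; rewrite neq_ltn cs orbT.
case/factor_theorem=> c' cE; set l := 'X - x0%:P in cE.
have l0 : l != 0 by rewrite polyXsubC_eq0.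
have c'0 : c' != 0 by apply: contraNneq c0; rewrite cE => ->; rewrite mul0r.
pose ev : {rmorphism {poly {poly F}} -> {poly F}} := map_poly (horner_eval x0).
have evl : horner_eval x0 l = 0 by rewrite /horner_eval /l hornerXsubC subrr.
have evc : ev c%:P = 0 by rewrite /ev /= map_polyC cE /= rmorphM /= evl mulr0.
have := congr1 ev XH; rewrite polyCM !rmorphM rmorphB !rmorphM evc mul0r mulr0 mul0r subr0.
rewrite {1}/ev /= map_polyC /= => /esym/eqP.
rewrite mulf_eq0 polyC_eq0 => /orP[ex0|Hx0].
  have [e' eE] : exists e', e = e' * l by apply/factor_theorem; rewrite /root.
  have l0' : l%:P != 0 :> {poly {poly F}} by rewrite polyC_eq0.
  apply: (IH H c' e') => //.
    rewrite (leq_trans _ hN) // ltn_add2r cE size_Mmonic ?monicXsubC //.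
    by rewrite size_XsubC addn2 /=.
  apply: (mulfI l0'); rewrite mulrA -polyCM mulrC [in LHS]mulrC [l * c']mulrC -cE XH eE.
  by rewrite !polyCM cE !polyCM; ring.
have [H' HE] : exists H', H = l%:P * H'.
  have /choice[f fE] : forall i, exists q, H`_i = q * l.
    move=> i; apply/factor_theorem; rewrite /root.
    by have /eqP/polyP/(_ i) := Hx0; rewrite coef_map coef0 /= => /eqP.
  exists (\poly_(i < size H) f i); apply/polyP => i; rewrite coefCM coef_poly.
  by case: ltnP => hi; [rewrite fE mulrC | rewrite mulr0 nth_default].
have l0' : l%:P != 0 :> {poly {poly F}} by rewrite polyC_eq0.
have H'0 : H' != 0 by apply: contraNneq H0; rewrite HE => ->; rewrite mulr0.
have sH : size H' = size H by rewrite HE size_Cmul.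
(* As [l] has derivative 1, applying the field to [l * H'] produces the extra term [c * H'], which
   equals [l * (c' * H')]. *)
have XH' : c%:P * X0 H' = ((e - c')%:P - (m%:R * c)%:P * 'X) * H'.
  apply: (mulfI l0').
  move: XH; rewrite HE (derM hd) riccati_C; last exact: derivation_deriv.
  rewrite derivXsubC mulrDr => XH; rewrite [(e - c')%:P]polyCB.
  apply/eqP; rewrite -subr_eq0; move/eqP: XH; rewrite -subr_eq0 => /eqP XH.
  apply/eqP; apply: etrans XH; rewrite cE !polyCM; ring.
rewrite -sH; apply: (IH H' c (e - c')) => //.
rewrite (leq_trans _ hN) // ltn_add2l HE lead_coefM lead_coefC.
by rewrite mulrC size_Mmonic ?lead_coef_eq0 ?monicXsubC // size_XsubC addn2.
Qed.

End Primitive.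

(** * No Darboux polynomial of positive degree in [W] has [mu = 0] *)

Section Positivity.
Variables (F : numFieldType) (R : {poly F}) (n : nat).
Hypothesis n0 : (0 < n)%N.
Hypothesis sizeR : size R = n.*2.+1.
Local Notation X0 := (riccati_field (@deriv F) R).
Let r := lead_coef R.

Lemma r_neq0 : r != 0.
Proof. by rewrite lead_coef_eq0 -size_poly_gt0 sizeR. Qed.

Section Recursion.
Variables (m : nat) (f : nat -> {poly F}).
Hypothesis m0 : (0 < m)%N.
Hypothesis f00 : f 0 != 0.
Hypothesis f1E : f 1 = - (f 0)^`().
Hypothesis fE : forall i, (i < m)%N ->
  f i.+2 *+ i.+2 = - ((f i.+1)^`() + (R * f i) *+ (m - i)).
Hypothesis fm : f m.+1 = 0.

Let s := (size (f 0)).-1.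
Let l := lead_coef (f 0).
Let N j := (s + n.*2 * j)%N.

Let coefR (p : {poly F}) k : (size p <= k.+1)%N -> (R * p)`_(n.*2 + k) = r * p`_k.
Proof. by move=> pk; rewrite coefM_top ?sizeR // /r lead_coefE sizeR. Qed.

Let sizeRM (p : {poly F}) k : (size p <= k)%N -> (size (R * p)%R <= n.*2 + k)%N.
Proof.
case: k => [|k] pk; last by rewrite addnS size_mul_top ?sizeR.
by move: pk; rewrite leqn0 size_poly_eq0 => /eqP->; rewrite mulr0 size_poly0.
Qed.

Lemma size_mulrn_le (p : {poly F}) k i : (size (p *+ k.+1) <= i)%N -> (size p <= i)%N.
Proof.
move=> h; rewrite -(@size_scale _ k.+1%:R p) ?scaler_nat //; by rewrite pnatr_eq0.
Qed.

(* Up to the factor [(-r)^j l], the recursion for the leading coefficients of the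
   even and (negated) odd terms has positive coefficients. *)
Lemma recursion_lead j : (j.*2 <= m)%N ->
  [/\ (size (f j.*2) <= (N j).+1)%N, (size (f j.*2.+1) <= N j)%N,
   exists2 g : F, 0 < g & (f j.*2)`_(N j) = g * ((- r) ^+ j * l) &
   exists2 e : F, (0 <= e) && ((0 < j)%N ==> (0 < e)) &
     (f j.*2.+1)`_(N j).-1 = - e * ((- r) ^+ j * l)].
Proof.
elim: j => [_|j IH jm].
  have sf : size (f 0) = s.+1 by rewrite /s prednK // size_poly_gt0.
  rewrite /N muln0 addn0 f1E; split.
  - by rewrite sf.
  - by rewrite size_polyN -ltnS -sf lt_size_deriv.
  - by exists 1; rewrite ?ltr01 // expr0 !mul1r /l lead_coefE.
  - exists s%:R; first by rewrite ler0n.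
    rewrite coefN coef_deriv expr0 mul1r mulNr; congr (- _).
    have lE : l = (f 0)`_s by [].
    case: (s) sf lE => [|s'] sf lE /=; last by rewrite lE mulr_natl.
    by rewrite mul0r nth_default // sf.
have jm' : (j.*2.+1 < m)%N by move: jm; rewrite doubleS.
have [sE sO [g g0 gE] [e /andP[e0 e0'] eE]] := IH (ltnW (ltnW jm')).
have NS : N j.+1 = (n.*2 + N j)%N by rewrite /N mulnS addnCA.
have N1 : (1 < N j.+1)%N by rewrite NS; lia.
have E2 := fE (ltnW jm'); have O2 := fE jm'.
rewrite doubleS.
have sE' : (size (f j.*2.+2) <= (N j.+1).+1)%N.
  apply: (@size_mulrn_le _ j.*2.+1); rewrite E2 size_polyN.
  apply: leq_trans (size_polyD _ _) _; rewrite geq_max.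
  rewrite (leq_trans (leq_trans (size_poly _ _) (leq_pred _))) /=; last first.
    by rewrite (leq_trans sO) // NS; lia.
  rewrite -scaler_nat (leq_trans (size_scale_leq _ _)) // NS -addnS sizeRM //.
have k2 : j.*2.+2%:R != 0 :> F by rewrite pnatr_eq0.
have k3 : j.*2.+3%:R != 0 :> F by rewrite pnatr_eq0.
pose g' := (m - j.*2)%:R / j.*2.+2%:R * g.
have g'0 : 0 < g' by rewrite mulr_gt0 // divr_gt0 ?ltr0n // subn_gt0 ltnW.
have gE' : (f j.*2.+2)`_(N j.+1) = g' * ((- r) ^+ j.+1 * l).
  apply: (mulIf k2); rewrite mulr_natr -coefMn E2 coefN coefD coef_deriv coefMn.
  rewrite [(f _)`__]nth_default; last by rewrite (leq_trans sO) // NS; lia.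
  rewrite mul0rn add0r NS coefR // gE -[_ *+ _]mulr_natr /g' exprS.
  move: (j.*2.+2%:R : F) k2 => q k2; field; exact: k2.
have sO' : (size (f j.*2.+3) <= N j.+1)%N.
  apply: (@size_mulrn_le _ j.*2.+2); rewrite O2 size_polyN.
  apply: leq_trans (size_polyD _ _) _; rewrite geq_max; apply/andP; split.
    case: (ltnP 0 (size (f j.*2.+2))) => [fs|]; last first.
      by rewrite leqn0 size_poly_eq0 => /eqP->; rewrite derivC size_poly0.
    by rewrite -ltnS (leq_trans _ sE') // lt_size_deriv // -size_poly_gt0.
  by rewrite -scaler_nat (leq_trans (size_scale_leq _ _)) // NS sizeRM.
pose e' := ((N j.+1)%:R * g' + (m - j.*2.+1)%:R * e) / j.*2.+3%:R.
have e'0 : 0 < e'.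
  rewrite divr_gt0 ?ltr0n // ltr_wpDr ?mulr_ge0 ?ler0n // mulr_gt0 // ltr0n.
  by rewrite ltnW.
split=> //; first by exists g'.
exists e'; first by rewrite ltW // e'0 implybT.
apply: (mulIf k3); rewrite mulr_natr -coefMn O2 coefN coefD coef_deriv coefMn.
rewrite prednK; last exact: ltnW.
rewrite gE'.
have -> : (R * f j.*2.+1)`_(N j.+1).-1 = r * (f j.*2.+1)`_(N j).-1.
  case: (N j) sO NS => [|N'] sO NS; last by rewrite NS addnS /= coefR.
  by move: sO; rewrite leqn0 size_poly_eq0 => /eqP->; rewrite mulr0 !coef0 mulr0.
rewrite eE -(mulr_natl _ (N j.+1)) -(mulr_natl _ (m - j.*2.+1)) /e' exprS; move: (j.*2.+3%:R : F) k3 => q k3; field.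
exact: k3.
Qed.

(** For [m = 2k] the term [f m.+1] is an odd one with nonzero leading coefficient. For [m = 2k + 1]
    the last relation says that the derivative of [f m] cancels [R * f k.*2], whose degree is
    strictly larger. *)
Lemma recursion_absurd : False.
Proof.
have l0 : l != 0 by rewrite lead_coef_eq0.
have rj j : (- r) ^+ j * l != 0 by rewrite mulf_neq0 // expf_neq0 // oppr_eq0 r_neq0.
have [k mE] : exists k, m = k.*2 \/ m = k.*2.+1.
  exists m./2; rewrite -[in LHS](odd_double_half m) -[X in _ \/ X = _](odd_double_half m).
  by case: (odd m); [right|left].
case: mE => mE.
  have [] := @recursion_lead k; first by rewrite mE.
  move=> _ _ _ [e /andP[_]]; rewrite -mE fm coef0 => /implyP e0 /eqP.
  rewrite eq_sym mulNr oppr_eq0 mulf_eq0 (negPf (rj k)) orbF gt_eqF //.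
  by apply: e0; lia.
have [] := @recursion_lead k; first by rewrite mE.
move=> sE sO [g g0 gE] _.
have := fE (_ : k.*2 < m)%N; rewrite mE ltnSn subSnn mulr1n -mE fm mul0rn => /(_ isT).
move/(congr1 (fun p : {poly F} => p`_(n.*2 + N k))).
rewrite coef0 coefN coefD coef_deriv coefR // gE [(f m)`__]nth_default; last first.
  by rewrite mE (leq_trans sO) //; lia.
rewrite mul0rn add0r => /eqP; rewrite eq_sym oppr_eq0 mulf_eq0 (negPf r_neq0) /=.
by rewrite mulf_eq0 (negPf (rj k)) orbF gt_eqF.
Qed.
End Recursion.

Lemma no_first_integral m (H : {poly {poly F}}) : (0 < m)%N -> size H = m.+1 ->
  X0 H = - (m%:R%:P * 'X) * H -> False.
Proof.
(* Coefficients are listed from the highest power of [W] down. The value zero past [m] turns the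
   equation at [W^0] into one more instance of the recursion. *)
move=> m0 Hs XH; pose f i := if (i <= m)%N then H`_(m - i) else 0.
have key i : (H`_i)^`() + R * H`_i.+1 *+ i.+1 - H`_i.-1 *+ i.-1
    = - (m%:R * (if i == 0 then 0 else H`_i.-1)).
  rewrite -(coef_riccati R (derivation_deriv F)) XH mulNr coefN -mulrA coefCM coefXM.
  by [].
apply: (@recursion_absurd m f) => //.
- by rewrite /f leq0n subn0 -[m]/(m.+1.-1) -Hs -lead_coefE lead_coef_eq0 -size_poly_gt0 Hs.
- have := key m; rewrite /f m0 leq0n subn0 subn1 [H`_m.+1]nth_default ?Hs //.
  rewrite mulr0 mul0rn addr0; case: (m) m0 => // m' _ /=.
  move/eqP; rewrite subr_eq addrC => /eqP ->; rewrite -mulr_natl -[m'.+1]addn1 natrD; ring.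
- move=> i im; rewrite /f im (ltnW im).
  have := key (m - i.+1)%N.
  case: ltnP => im2.
    have -> : (m - i.+1 == 0)%N = false by lia.
    have -> : ((m - i.+1).+1 = m - i)%N by lia.
    have -> : ((m - i.+1).-1 = m - i.+2)%N by lia.
    move/eqP; rewrite subr_eq addrC => /eqP ->.
    rewrite -(mulr_natl _ i.+2) -(mulr_natl _ (m - i.+2)) !natrB //; ring.
  have -> : (m - i.+1)%N = 0 by lia.
  have -> : (m - i)%N = 1%N by lia.
  by rewrite eqxx /= subr0 mulr0 oppr0 mul0rn mulr1n => ->; rewrite oppr0.
- by rewrite /f ltnn.
Qed.
End Positivity.

(** * The discriminant of a Darboux polynomial *)

Lemma derivation_prod (A : comNzRingType) (D : A -> A) (I : finType) (f : I -> A) :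
  derivation D -> D (\prod_i f i) = \sum_i D (f i) * \prod_(j | j != i) f j.
Proof.
move=> hD.
suff h (r : seq I) : uniq r ->
    D (\prod_(i <- r) f i) = \sum_(i <- r) D (f i) * \prod_(j <- r | j != i) f j.
  by rewrite h ?index_enum_uniq.
elim: r => [|a r IH] /=; first by rewrite !big_nil (der1 hD).
case/andP=> ar ur; rewrite !big_cons eqxx /= (derM hD) IH //; congr (_ * _ + _).
  rewrite big_seq [RHS]big_seq_cond; apply: eq_bigl => i.
  by case: (boolP (i \in r)) => //= ir; apply/esym; apply: contraNneq ar => <-.
rewrite mulr_sumr big_seq [RHS]big_seq; apply: eq_bigr => i ir.
rewrite big_cons; have -> : a != i by apply: contraNneq ar => ->.
by rewrite mulrCA.
Qed.

(** Jacobi's formula: the Leibniz rule differentiates one row at a time, and each resulting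
    determinant is expanded along that row. *)
Lemma derivation_det (A : comNzRingType) (D : A -> A) n (M : 'M[A]_n) :
  derivation D -> D (\det M) = \tr (map_mx D M *m \adj M).
Proof.
move=> hD; rewrite /mxtrace.
have -> : D (\det M) = \sum_i \det (\matrix_(k, j) if k == i then D (M k j) else M k j).
  rewrite /determinant (der_sum hD) exchange_big /=; apply: eq_bigr => s _.
  rewrite (derM hD).
  have -> : D ((-1) ^+ perm.odd_perm s) = 0 by case: (perm.odd_perm s); rewrite ?(der1 hD) // expr1 (derN hD) (der1 hD) oppr0.
  rewrite mul0r add0r derivation_prod // mulr_sumr; apply: eq_bigr => i _; congr (_ * _).
  rewrite [RHS](bigD1 i) //= !mxE eqxx; congr (_ * _).
  by apply: eq_bigr => j /negPf ji; rewrite mxE ji.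
apply: eq_bigr => i _; rewrite (expand_det_row _ i) mxE; apply: eq_bigr => j _.
rewrite !mxE eqxx; congr (_ * _).
rewrite /cofactor; congr (_ * \det _); apply/matrixP => k l; rewrite !mxE.
by rewrite eq_sym (negPf (neq_lift _ _)).
Qed.

Section QuotientTrace.
Variables (K : fieldType) (D : K -> K) (rho : K) (F : {poly K}) (m : nat).
Hypothesis hD : derivation D.
Hypothesis Fm : F \is monic.
Hypothesis Fs : size F = m.+2.
Local Notation X := (riccati_field D rho).
Hypothesis FX : F %| X F.
Local Notation red p := (poly_rV (p %% F) : 'rV_(m.+1)).

(** Matrices, in the basis [1, .., W^m] of [K[W]/(F)] with vectors as rows, of multiplication by [z]
    and of the action of [X] on the basis. The latter passes to the quotient because [F] divides
    [X F]. *)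
Let mul_mx (z : {poly K}) : 'M[K]_m.+1 := \matrix_(i < m.+1) red ('X^i * z).
Let der_mx : 'M[K]_m.+1 := \matrix_(i < m.+1) red (X 'X^i).

Let F0 : F != 0. Proof. exact: monic_neq0. Qed.

Let size_red (p : {poly K}) : (size (p %% F)%R <= m.+1)%N.
Proof. by rewrite -ltnS -Fs ltn_modp. Qed.

Let red_small (p : {poly K}) : (size p <= m.+1)%N -> p %% F = p.
Proof. by move=> ps; rewrite modp_small // Fs ltnS. Qed.

Let small_sum (p : {poly K}) : (size p <= m.+1)%N -> p = \sum_(i < m.+1) p`_i *: 'X^i.
Proof.
move=> ps; rewrite -(@poly_def _ m.+1 (fun i => p`_i)); apply/polyP => i; rewrite coef_poly.
by case: ltnP => // mi; rewrite nth_default // (leq_trans ps).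
Qed.

Let red_sum (f : 'I_m.+1 -> {poly K}) (c : 'I_m.+1 -> K) :
  red (\sum_i c i *: f i) = (\row_i c i) *m \matrix_i red (f i).
Proof.
rewrite mulmx_sum_row.
have -> : (\sum_i c i *: f i) %% F = \sum_i c i *: (f i %% F).
  by rewrite (big_morph _ (modpD F) (mod0p F)); apply: eq_bigr => i _; rewrite modpZl.
by rewrite linear_sum; apply: eq_bigr => i _; rewrite linearZ /= mxE rowK.
Qed.

Let red_row p : red p = \row_i (p %% F)`_i.
Proof. by apply/rowP => i; rewrite !mxE. Qed.

Let red_modl p q : (p %% F * q) %% F = (p * q) %% F.
Proof. by rewrite mulrC modp_mul mulrC. Qed.

Let red_mul p z : red (p * z) = red p *m mul_mx z.
Proof.
rewrite -red_modl [X in red (X * z)]small_sum ?size_red // mulr_suml.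
under eq_bigr do rewrite -scalerAl.
by rewrite (red_sum (fun i => 'X^i * z)) red_row.
Qed.

Let X_red p : X (p %% F) %% F = X p %% F.
Proof.
rewrite [in RHS](divp_eq p F) (derD (derivation_riccati _ hD)) (derM (derivation_riccati _ hD)).
by rewrite !modpD modp_mull (eqP (dvdp_mull _ FX)) !add0r.
Qed.

Let red_add p q : red (p + q) = red p + red q.
Proof. by rewrite modpD linearD. Qed.

Let red_der p : red (X p) = map_mx D (red p) + red p *m der_mx.
Proof.
have hX := derivation_riccati rho hD.
rewrite -X_red; set q := p %% F.
have qs : (size q <= m.+1)%N by apply: size_red.
have -> : X q = map_poly D q + \sum_(i < m.+1) q`_i *: X 'X^i.
  rewrite {1}(small_sum qs) (der_sum hX).
  under eq_bigr do rewrite -mul_polyC (derM hX) riccati_C // !mul_polyC.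
  rewrite big_split /=; congr (_ + _); apply/esym.
  rewrite [LHS]small_sum; last exact: leq_trans (size_mapD _ _) qs.
  by apply: eq_bigr => i _; rewrite coef_mapD.
rewrite red_add (red_sum (fun i => X 'X^i)) -/der_mx.
have -> : \row_(i < m.+1) q`_i = poly_rV q by apply/rowP => i; rewrite !mxE.
congr (_ + _).
rewrite red_small; last exact: leq_trans (size_mapD _ _) qs.
by apply/rowP => i; rewrite !mxE coef_mapD.
Qed.

Let mul_mx_mul h z : mul_mx (h * z) = mul_mx h *m mul_mx z.
Proof. by apply/row_matrixP => i; rewrite row_mul !rowK mulrA red_mul. Qed.

Let mul_mx_mod p q : p %% F = q %% F -> mul_mx p = mul_mx q.
Proof. by move=> pq; apply/row_matrixP => i; rewrite !rowK -modp_mul pq modp_mul. Qed.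

Let mul_mx_add p q : mul_mx (p + q) = mul_mx p + mul_mx q.
Proof. by apply/row_matrixP => i; rewrite linearD /= !rowK mulrDr red_add. Qed.

Let mul_mx_C c : mul_mx c%:P = c%:M.
Proof.
apply/row_matrixP => i; rewrite rowK; apply/rowP => j.
rewrite mulrC mul_polyC modpZl red_small ?size_polyXn // !mxE coefZ coefXn.
by rewrite eq_sym -val_eqE /=; case: eqP; rewrite ?mulr1 ?mulr0.
Qed.

Let trace_mul_X : \tr (mul_mx 'X) = - F`_m.
Proof.
rewrite /mxtrace (bigD1 ord_max) //= big1 ?addr0 => [|i im]; rewrite !mxE -exprSr.
  have -> : 'X^(m.+1) %% F = 'X^(m.+1) - F.
    have e : 'X^(m.+1) = 1 * F + ('X^(m.+1) - F) by ring.
    rewrite {1}e modpD modp_mull add0r red_small //; apply/leq_sizeP => i mi.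
    rewrite coefB coefXn; case: (ltngtP i m.+1) mi => // [mi|->] _.
      by rewrite nth_default ?subr0 // Fs.
    by have := monicP Fm; rewrite lead_coefE Fs /= => ->; rewrite subrr.
  by rewrite coefB coefXn ltn_eqF // sub0r.
have {}im : (i < m)%N by rewrite ltn_neqAle -ltnS ltn_ord andbT.
by rewrite red_small ?size_polyXn // coefXn ltn_eqF.
Qed.

(** The Leibniz rule for [X] on the quotient algebra, read in coordinates. *)
Let der_mul_mx z :
  map_mx D (mul_mx z) + mul_mx z *m der_mx = der_mx *m mul_mx z + mul_mx (X z).
Proof.
apply/row_matrixP => i; rewrite !linearD /= !row_mul !rowK -map_row rowK -red_der.
by rewrite (derM (derivation_riccati _ hD)) red_add red_mul.
Qed.

(* The norm of [F'(w)] from [K[w]/(F)] down to [K] is a nonzero solution of the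
   first-order equation satisfied by the discriminant. *)
Lemma discriminant_der : coprimep F F^`() ->
  exists2 delta, delta != 0 & D delta = m.*2%:R * F`_m * delta.
Proof.
move=> cop; have hX := derivation_riccati rho hD.
have Fs1 : (1 < size F)%N by rewrite Fs.
have [mu XF] := riccati_cofactor hD Fs1 FX; rewrite Fs /= in XF.
have muE : mu = F`_m.
  have := congr1 (fun p : {poly K} => p`_m.+1) XF.
  have F1 : F`_m.+1 = 1 by have := monicP Fm; rewrite lead_coefE Fs.
  rewrite coef_linearM coef_riccati //= F1 (der1 hD) nth_default ?Fs // mulr0 mul0rn mulr1.
  rewrite -[F`_m *+ m]mulr_natl -[m.+1]addn1 natrD => h.
  have -> : mu = (mu - (m%:R + 1%:R) * F`_m) + (m%:R + 1%:R) * F`_m by ring.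
  by rewrite -h; ring.
(* By the commutator rule, [X] multiplies the class of [F'] by [h]. *)
pose h : {poly K} := mu%:P + (1 - m%:R)%:P * 'X.
have Xz : X F^`() %% F = (h * F^`()) %% F.
  rewrite riccati_deriv //.
  rewrite XF derivM derivB derivC derivZ derivX -[m.+1]addn1 natrD.
  have -> : (0 - (m%:R + 1%:R) *: 1) * F + (mu%:P - (m%:R + 1%:R) *: 'X) * F^`() + 2%:R * 'X * F^`()
     = (- (m%:R + 1%:R)%:P) * F + h * F^`().
    by rewrite /h -!mul_polyC !polyCD !polyCN; ring.
  by rewrite modpD modp_mull add0r.
set A := mul_mx F^`().
have Au : A \in unitmx.
  have [[u v] /= uv] := Bezout_eq1_coprimepP _ _ cop.
  suff /mulmx1_unit[] : mul_mx v *m A = 1%:M by [].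
  rewrite -mul_mx_mul -[1%:M]mul_mx_C; apply: mul_mx_mod.
  by rewrite polyC1 -uv modpD modp_mull add0r.
exists (\det A); first by rewrite -unitfE -unitmxE.
(* The derivative of [A] is a commutator with [der_mx] plus [mul_mx h *m A]. Against the adjugate
   the commutator has trace zero, which leaves the determinant times the trace of [mul_mx h], that
   is [2 m F_m]. *)
have DA : map_mx D A = der_mx *m A + mul_mx h *m A - A *m der_mx.
  by rewrite -mul_mx_mul -(mul_mx_mod Xz) -der_mul_mx addrK.
rewrite derivation_det // DA mulmxBl mulmxDl -!mulmxA mul_mx_adj linearB linearD /=.
rewrite [\tr (A *m _)]mxtrace_mulC -!mulmxA mul_adj_mx !mul_mx_scalar !linearZ /=.
rewrite addrAC subrr add0r mul_mx_add mul_mx_mul !mul_mx_C linearD /= mxtrace_scalar mul_scalar_mx.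
rewrite linearZ /= trace_mul_X muE -mul2n natrM mulrS -(mulr_natl _ m); ring.
Qed.

End QuotientTrace.

Lemma log_der_twist (K : fieldType) (k : nat) (nu f Df delta fm : K) : f != 0 ->
  k%:R * (f^-1 * (nu * f - Df)) * delta * (f * fm) + delta * (fm * Df *+ k)
  = k%:R * nu * (delta * (f * fm)).
Proof. by move=> f0; rewrite -(mulr_natl (fm * Df)); field. Qed.

(** * Reduction to degree one in [W] *)

Section Linear.
Variables (F : numClosedFieldType) (R : {poly F}) (n : nat).
Hypothesis n0 : (0 < n)%N.
Hypothesis sizeR : size R = n.*2.+1.
Local Notation X0 := (riccati_field (@deriv F) R).

(** With [z = p/q] in lowest terms, [p] divides [p' q], hence its own derivative, so this derivative
    vanishes; the same holds for [q]. *)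
Lemma log_derivative_poly (E : diff_ext F) (z : E) (nu : {poly F}) :
  z \in gen_pred ([::] : seq E) -> z != 0 ->
  @de_D _ E z = @de_iota _ E nu * z -> nu = 0.
Proof.
move=> /gen_nil[p0 [q0 [q00 zE]]] z0 Dz; have hD := derivation_de E.
have p00 : p0 != 0 by apply: contraNneq z0 => p00; rewrite zE p00 rmorph0 mul0r.
pose g := gcdp p0 q0; have g0 : g != 0 by rewrite gcdp_eq0 negb_and p00.
have [p pE] : exists p, p0 = p * g by apply/dvdpP; rewrite dvdp_gcdl.
have [q qE] : exists q, q0 = q * g by apply/dvdpP; rewrite dvdp_gcdr.
have cop : coprimep p q.
  have := coprimep_div_gcd (_ : (p0 != 0) || (q0 != 0)); rewrite p00 => /(_ isT).
  by rewrite -/g {1}pE {1}qE !mulpK.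
have pn0 : p != 0 by apply: contraNneq p00; rewrite pE => ->; rewrite mul0r.
have qn0 : q != 0 by apply: contraNneq q00; rewrite qE => ->; rewrite mul0r.
have iq0 : @de_iota _ E q != 0 by apply: iota_neq0.
have zE' : z = @de_iota _ E p / @de_iota _ E q.
  by rewrite zE pE qE !rmorphM /= -mulf_div divff ?mulr1 // iota_neq0.
have key : p^`() * q - p * q^`() = nu * p * q.
  apply: (@de_inj _ E); rewrite rmorphB !rmorphM /= -!de_Dpoly.
  move: Dz; rewrite zE' (der_div hD) // => /(congr1 (fun t => t * (@de_iota _ E q) ^+ 2)).
  by rewrite divfK ?expf_neq0 // => ->; field.
have small (f : {poly F}) : f != 0 -> f %| f^`() -> f^`() = 0.
  move=> f0 /dvdp_leq h; apply/eqP; apply: contraT => /h.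
  by rewrite leqNgt lt_size_deriv.
have p'0 : p^`() = 0.
  apply: small => //; rewrite -(Gauss_dvdpl _ cop).
  have -> : p^`() * q = p * (q^`() + nu * q) by rewrite -[LHS](subrK (p * q^`())) key; ring.
  exact: dvdp_mulIl.
have q'0 : q^`() = 0.
  apply: small => //; move: (cop); rewrite coprimep_sym => cop'; rewrite -(Gauss_dvdpr _ cop').
  have -> : p * q^`() = q * (p^`() - nu * p).
    by rewrite -[RHS]opprK -[LHS]opprK; congr (- _); apply: (@addrI _ (p^`() * q)); rewrite key; ring.
  exact: dvdp_mulIl.
move: key; rewrite p'0 q'0 mul0r mulr0 subrr => /esym/eqP.
by rewrite !mulf_eq0 (negPf pn0) (negPf qn0) !orbF => /eqP.
Qed.

(** The gcd divides [X G] and, by the commutator rule, also the image of the derivative of [G].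
    Being a combination of the two polynomials, it divides its own image. *)
Lemma gcd_darboux (E : diff_ext F) (rho : E) (G : {poly E}) :
  G %| riccati_field (@de_D _ E) rho G ->
  gcdp G G^`() %| riccati_field (@de_D _ E) rho (gcdp G G^`()).
Proof.
set X := riccati_field _ _; set g := gcdp _ _ => GX.
have hX : derivation X := derivation_riccati rho (derivation_de E).
have gG : g %| G := dvdp_gcdl _ _; have gG' : g %| G^`() := dvdp_gcdr _ _.
have gX : g %| X G := dvdp_trans gG GX.
have gX' : g %| X G^`().
  rewrite /X (riccati_deriv _ (derivation_de E)) dvdp_addl ?dvdp_mull //.
  case/dvdpP: GX => L; rewrite -/X => ->; rewrite derivM.
  by rewrite dvdp_addl ?dvdp_mull.
have [[u v] /= /eqpP[[a b] /= /andP[a0 b0] uv]] := Bezoutp G G^`().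
rewrite -/g in uv.
have -> : g = (b^-1 * a) *: (u * G + v * G^`()).
  by rewrite -scalerA uv scalerA mulVf ?scale1r.
rewrite [in X in _ %| X]scalerDr !scalerAl.
have -> : (b^-1 * a) *: (u * G + v * G^`()) = g.
  by rewrite -scalerA uv scalerA mulVf ?scale1r.
by rewrite (derD hX) !(derM hX) !dvdp_add ?dvdp_mull.
Qed.

Lemma linear_darboux m (H : {poly {poly F}}) (mu : {poly F}) :
  size H = m.+2 -> X0 H = (mu%:P - m.+1%:R%:P * 'X) * H ->
  exists (H' : {poly {poly F}}) (mu' : {poly F}), size H' = 2 /\ X0 H' = (mu'%:P - 'X) * H'.
Proof.
elim/ltn_ind: m H mu => m IH H mu Hs XH.
case: m IH Hs XH => [|m] IH Hs XH; first by exists H, mu; rewrite XH mul1r.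
set E := ratfun_ext F; set G := map_poly (@de_iota _ E) H.
have injE : injective (@de_iota _ E) := @de_inj _ E.
have Gs : size G = m.+3 by rewrite size_map_inj_poly ?rmorph0.
have GX : G %| riccati_field (@de_D _ E) (@de_iota _ E R) G.
  by rewrite map_iota_riccati XH rmorphM /= dvdp_mull.
have G0 : G != 0 by rewrite -size_poly_gt0 Gs.
have charE : forall k, k.+1%:R != 0 :> E.
  by apply: de_char0 => k; rewrite pnatr_eq0.
have G'0 : G^`() != 0.
  have : G^`()`_m.+1 != 0.
    rewrite coef_deriv -mulr_natr mulf_neq0 //.
    by rewrite -[m.+2]/(m.+3.-1) -Gs -lead_coefE lead_coef_eq0.
  by apply: contraNneq => ->; rewrite coef0.
have [cop|ncop] := boolP (coprimep G G^`()); last first.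
  set g := gcdp G G^`(); have gs1 : (1 < size g)%N.
    by rewrite ltn_neqAle eq_sym ncop size_poly_gt0 gcdp_eq0 negb_and G0.
  have gs : (size g < m.+3)%N.
    by rewrite -Gs (leq_ltn_trans _ (lt_size_deriv G0)) // dvdp_leq ?dvdp_gcdr.
  have gover : g \is a polyOver (gen_pred ([::] : seq E)).
    by apply/polyOverP => i; apply: ratfun_gen.
  (* The gcd over F(x) is brought back to [F[x]] and made primitive, so that the induction
     hypothesis applies to it. *)
  have [b [H1 [c [e [b0 H1E c0 XH1]]]]] := darboux_base gover gs1 (gcd_darboux GX).
  have H1s : size H1 = size g.
    have := congr1 (fun p : {poly E} => size p) H1E.
    by rewrite size_scale ?iota_neq0 // size_map_inj_poly ?rmorph0.
  have H10 : H1 != 0 by rewrite -size_poly_gt0 H1s ltnW.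
  have [H2 [mu2 [H2s XH2]]] := primitive_darboux c0 H10 XH1.
  move: gs1 gs XH2; rewrite -H1s -H2s.
  case E2 : (size H2) => [|[|k]] //= _ km XH2.
  exact: (IH k _ H2 mu2).
(* Otherwise the discriminant forces [mu = 0], which is impossible. *)
have f0 : H`_m.+2 != 0 by rewrite -[m.+2]/(m.+3.-1) -Hs -lead_coefE lead_coef_eq0 -size_poly_gt0 Hs.
have iE i : G`_i = @de_iota _ E H`_i by rewrite coef_map.
have lG : lead_coef G = @de_iota _ E H`_m.+2 by rewrite lead_coefE Gs iE.
have lG0 : (lead_coef G)^-1 != 0 by rewrite invr_eq0 lead_coef_eq0.
set Gm := (lead_coef G)^-1 *: G.
have Gmm : Gm \is monic by rewrite monicE lead_coefZ mulVf ?lead_coef_eq0.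
have Gms : size Gm = m.+3 by rewrite size_scale.
have hD := derivation_de E.
have GmX : Gm %| riccati_field (@de_D _ E) (@de_iota _ E R) Gm.
  rewrite /Gm -mul_polyC (derM (derivation_riccati _ hD)) mul_polyC dvdpZl //.
  by rewrite dvdp_add ?dvdp_mulIr ?dvdp_mull.
have copm : coprimep Gm Gm^`().
  by rewrite /Gm derivZ coprimepZl // coprimepZr.
have [delta delta0 Ddelta] := discriminant_der hD Gmm Gms GmX copm.
have f1E : H`_m.+1 = mu * H`_m.+2 - (H`_m.+2)^`().
  have := congr1 (fun p : {poly {poly F}} => p`_m.+2) XH.
  rewrite (coef_riccati R (derivation_deriv F)) [H`_m.+3]nth_default ?Hs // mulr0 mul0rn addr0.
  rewrite mulrBl coefB -mulrA !coefCM coefXM /= -(mulr_natl _ m.+1) -[m.+2]addn1 natrD addn1 => h.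
  apply/eqP; rewrite -subr_eq0; move/eqP: h; rewrite -subr_eq0 => /eqP h.
  by apply/eqP; apply: etrans h; ring.
(* Making [G] monic subtracted the logarithmic derivative of [f] from [mu]. The factor
   [f ^+ m.+1.*2] compensates for it, so the product has logarithmic derivative [m.+1.*2 * mu], a
   polynomial. *)
have mu0 : mu = 0.
  pose f := @de_iota _ E H`_m.+2; have fn0 : f != 0 by apply: iota_neq0.
  have Df : @de_D _ E f = @de_iota _ E (H`_m.+2)^`() by rewrite de_Dpoly.
  have /eqP : (m.+1.*2)%:R * mu = 0.
    apply: (@log_derivative_poly E (delta * f ^+ m.+1.*2)).
    - exact: ratfun_gen.
    - exact: (mulf_neq0 delta0 (expf_neq0 _ fn0)).
    rewrite (derM hD) (derXn hD) Ddelta coefZ iE f1E lG -/f rmorphB !rmorphM /= rmorph_nat -/f -Df.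
    rewrite doubleS /= exprS; exact: log_der_twist.
  by rewrite mulf_eq0 -polyC_natr polyC_eq0 pnatr_eq0 => /eqP.
case: (@no_first_integral F R n n0 sizeR m.+2 H) => //.
by rewrite XH mu0 polyC0 sub0r.
Qed.

Lemma liouvillian_spectral (P Q : {poly F}) : normal_potential P Q = R ->
  has_liouv_sol P Q -> exists M B : {poly F}, M != 0 /\ spectral_eq R M B.
Proof.
move=> RE [E [u [u0 sol [ts [tower uts]]]]].
have char0 k : k.+1%:R != 0 :> F by rewrite pnatr_eq0.
have tsD := tower_der R char0 tower.
have uS : u \in gen_pred ts by apply/gen_predP.
set iota := @de_iota _ E; set D := @de_D _ E in tsD *.
have hD : derivation D := derivation_de E.
have Dp p : D (iota p) = iota p^`() := de_Dpoly E p.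
pose w := D u / u + iota (2%:R^-1 *: P).
have wS : w \in gen_pred ts by rewrite rpredD ?rpred_div ?tsD // gen_poly.
have riccati : D w + w ^+ 2 = iota R.
  pose h := iota (2%:R^-1)%:P.
  have h2 : 2%:R * h = 1.
    by rewrite /h -(rmorph_nat iota) -rmorphM -polyC_natr -polyCM divff ?rmorph1 ?char0.
  have iP : iota P = 2%:R * (h * iota P) by rewrite mulrA h2 mul1r.
  have hP (p : {poly F}) : iota (2%:R^-1 *: p) = h * iota p by rewrite -mul_polyC rmorphM.
  have RE' : iota R = h * h * iota P ^+ 2 + h * D (iota P) - iota Q.
    rewrite -RE /normal_potential rmorphB rmorphD hP Dp -rmorphXn /=.
    rewrite -mul_polyC rmorphM -[in RHS]rmorphM -polyCM; congr (iota _%:P * _ + _ - _).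
    by rewrite -invfM -natrM.
  have Dh : D (h * iota P) = h * D (iota P).
    by rewrite (derM hD) /h Dp derivC rmorph0 mul0r add0r.
  have DDu : D (D u) = - iota P * D u - iota Q * u.
    by apply/eqP; rewrite -subr_eq0; apply/eqP; apply: etrans sol; rewrite /iota /D; ring.
  rewrite /w hP (derD hD) (der_div hD) // DDu RE' Dh {1}iP.
  by field; rewrite u0 (de_char0 E char0 1).
clearbody w.
(* By the Riccati equation for [w], the image of [W - w] is [w^2 - W^2]. *)
pose G : {poly E} := 'X - w%:P.
have GX : G %| riccati_field D (iota R) G.
  have hX := derivation_riccati (iota R) hD.
  rewrite /G (derB hX) riccati_C // riccati_X // -riccati polyCD !expr2 polyCM.
  have -> : (D w)%:P + w%:P * w%:P - 'X * 'X - (D w)%:P = - ('X + w%:P) * ('X - w%:P) by ring.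
  exact: dvdp_mulIr.
have Gover : G \is a polyOver (gen_pred ts) by rewrite polyOverXsubC.
have Gs : (1 < size G)%N by rewrite size_XsubC.
have [H0 [H0over H0s H0X]] := darboux_tower char0 tower Gover Gs GX.
have [b [H1 [c [e [b0 H1E c0 XH1]]]]] := darboux_base H0over H0s H0X.
have H1s : size H1 = size H0.
  have := congr1 (fun p : {poly E} => size p) H1E.
  by rewrite size_scale ?iota_neq0 // size_map_inj_poly ?rmorph0 //; exact: de_inj.
have H10 : H1 != 0 by rewrite -size_poly_gt0 H1s ltnW.
have [H2 [mu2 [H2s XH2]]] := primitive_darboux c0 H10 XH1.
have [H [mu [Hs XH]]] : exists (H' : {poly {poly F}}) (mu' : {poly F}),
    size H' = 2 /\ X0 H' = (mu'%:P - 'X) * H'.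
  move: H0s XH2; rewrite -H1s -H2s; case E2 : (size H2) => [|[|k]] //= _ XH2.
  exact: (@linear_darboux k H2 mu2).
have XHi i : (H`_i)^`() + R * H`_i.+1 *+ i.+1 - H`_i.-1 *+ i.-1
    = mu * H`_i - (if i == 0 then 0 else H`_i.-1).
  by rewrite -(coef_riccati R (derivation_deriv F)) XH mulrBl coefB coefCM coefXM.
(* Writing [H = f W + g], the equation at [W^1] gives [g = mu f - f']; substituted at [W^0] it
   becomes the spectral equation for [f] with [B = - mu]. *)
exists H`_1, (- mu); split.
  have -> : H`_1 = lead_coef H by rewrite lead_coefE Hs.
  by rewrite lead_coef_eq0 -size_poly_gt0 Hs.
have := XHi 1; have := XHi 0; rewrite /= [H`_2]nth_default ?Hs //.
rewrite mulr0 mul0rn addr0 !subr0 mulr1n => e0 e1.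
have {e1}fE : H`_0 = mu * H`_1 - (H`_1)^`() by rewrite e1; ring.
rewrite /spectral_eq derivN sqrrN; move: e0; rewrite fE derivB derivM => /eqP.
by rewrite -subr_eq0 => /eqP e0; apply/eqP; rewrite -oppr_eq0; apply/eqP; apply: etrans e0; ring.
Qed.

End Linear.

(** * Spectral varieties *)

Section Spectral.
Variables (F : numFieldType) (n : nat).
Hypothesis n0 : (0 < n)%N.

Section Analysis.
Variables (R M B : {poly F}) (d : nat).
Hypothesis sizeR : size R = n.*2.+1.
Hypothesis sizeM : size M = d.+1.
Hypothesis MB : spectral_eq R M B.

Let T := B^`() + B ^+ 2 - R.

Let TM : T * M = - (M^`()^`() + 2%:R * B * M^`()).
Proof. by apply/eqP; rewrite -subr_eq0 opprK addrC; apply/eqP. Qed.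

Lemma size_deriv_le (p : {poly F}) k : (size p <= k.+1)%N -> (size p^`() <= k)%N.
Proof.
move=> pk; have [->|p0] := eqVneq p 0; first by rewrite derivC size_poly0.
by rewrite -ltnS (leq_trans (lt_size_deriv p0)).
Qed.

Let M0 : M != 0. Proof. by rewrite -size_poly_gt0 sizeM. Qed.

Let size_rhs b : (size B <= b.+1)%N ->
  (size (M^`()^`() + 2%:R * B * M^`())%R <= b + d)%N.
Proof.
move=> Bb; apply: leq_trans (size_polyD _ _) _; rewrite geq_max.
have M's : (size M^`() <= d)%N by apply: size_deriv_le; rewrite sizeM.
apply/andP; split.
  by rewrite (leq_trans _ (leq_addl _ _)) // (leq_trans (size_poly _ _)) // (leq_trans (leq_pred _)).
rewrite -mulrA -polyC_natr mul_polyC (leq_trans (size_scale_leq _ _)) //.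
case: d M's => [|d'] M's; last by rewrite addnS size_mul_top.
by move: M's; rewrite leqn0 size_poly_eq0 => /eqP->; rewrite mulr0 size_poly0.
Qed.

Let sizeT b : (size B <= b.+1)%N -> (size T <= b)%N.
Proof.
move=> Bb; have [->|T0] := eqVneq T 0; first by rewrite size_poly0.
by have := size_rhs Bb; rewrite -size_polyN -TM size_mul // sizeM addnS /= leq_add2r.
Qed.

Let size_diff b : (size B <= b.+1)%N -> (size (B ^+ 2 - R)%R <= b)%N.
Proof.
move=> Bb; have -> : B ^+ 2 - R = T - B^`() by rewrite /T; ring.
apply: leq_trans (size_polyD _ _) _; rewrite geq_max sizeT //= size_polyN.
exact: size_deriv_le.
Qed.

(** In [T M = - (M'' + 2 B M')] the right side has degree below that of [B M], so [T], and with it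
    [B^2 - R], has degree below that of [B]. This forces [B^2] and [R] to have equal degrees. *)
Lemma spectral_sizeB : size B = n.+1.
Proof.
case: (posnP (size B)) => [|B0].
  move/eqP; rewrite size_poly_eq0 => /eqP B0.
  have := @size_diff 0; rewrite B0 size_poly0 => /(_ isT).
  by rewrite expr0n sub0r size_polyN sizeR.
have [b Bb] : exists b, size B = b.+1 by exists (size B).-1; rewrite prednK.
have B2 : size (B ^+ 2) = b.*2.+1.
  by rewrite expr2 size_mul -?size_poly_gt0 // Bb addnS /= -addnn addSn.
have Db : (size (B ^+ 2 - R)%R <= b)%N by apply: size_diff; rewrite Bb.
rewrite Bb; congr _.+1; case: (ltngtP b n) => // bn.
  by move: Db; rewrite addrC size_polyDl size_polyN ?sizeR ?B2; lia.
by move: Db; rewrite size_polyDl ?size_polyN ?sizeR ?B2; lia.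
Qed.

Lemma spectral_size_diff : (size (R - B ^+ 2)%R <= n)%N.
Proof. by rewrite -opprB size_polyN size_diff // spectral_sizeB. Qed.

(** The quantisation condition: at [x^(n - 1 + d)] the equation reads [T_(n-1) = - 2 d B_n], while
    [T_(n-1)] is also [n B_n] minus the coefficient sought. *)
Lemma spectral_coef_diff : (R - B ^+ 2)`_n.-1 = (n + d.*2)%:R * B`_n.
Proof.
have Bs := spectral_sizeB.
have Ts : (size T <= n.-1.+1)%N by rewrite prednK // sizeT // Bs.
have := congr1 (fun p : {poly F} => p`_(n.-1 + d)) TM.
rewrite coefM_top ?sizeM // coefN [X in - X]coefD.
have -> : M^`()^`()`_(n.-1 + d) = 0.
  rewrite nth_default //; have := size_deriv_le (_ : size M <= d.+1)%N; rewrite sizeM => /(_ (leqnn _)).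
  case: (d) => [|d']; first by rewrite leqn0 size_poly_eq0 => /eqP->; rewrite derivC size_poly0.
  by move/size_deriv_le/leq_trans; apply; rewrite addnS ltnW // ltnS leq_addl.
have M_d : M`_d != 0 by rewrite -[d]/(d.+1.-1) -sizeM -lead_coefE lead_coef_eq0.
have -> : (2%:R * B * M^`())`_(n.-1 + d) = 2%:R * B`_n * (d%:R * M`_d).
  rewrite -mulrA -polyC_natr coefCM -mulrA; congr (_ * _).
  case: (d) sizeM => [|d'] sM.
    rewrite mul0r mulr0; have /size1_polyC -> : (size M <= 1)%N by rewrite sM.
    by rewrite derivC mulr0 coef0.
  rewrite addnS -addSn prednK // coefM_top ?Bs // ?size_deriv_le ?sM //.
  by rewrite coef_deriv mulr_natl.
have -> : T`_n.-1 = n%:R * B`_n - (R - B ^+ 2)`_n.-1.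
  rewrite /T -addrA [LHS]coefD coef_deriv prednK // mulr_natl; congr (_ + _).
  by rewrite -coefN opprB.
rewrite add0r => h; apply: (mulIf M_d); apply/eqP; rewrite -subr_eq0 -oppr_eq0; apply/eqP.
move/eqP: h; rewrite -subr_eq0 => /eqP h; apply: etrans h.
by rewrite -muln2 natrD natrM; ring.
Qed.

End Analysis.

(** The product [(C - C') (C + C')] has degree below [n], whereas [C + C'] has degree [n] with
    leading coefficient 2. *)
Lemma monic_sqrt_unique (S C C' : {poly F}) :
  C \is monic -> C' \is monic -> size C = n.+1 -> size C' = n.+1 ->
  (size (C ^+ 2 - S)%R <= n)%N -> (size (C' ^+ 2 - S)%R <= n)%N -> C = C'.
Proof.
move=> Cm C'm Cs C's h h'; apply/eqP; rewrite -subr_eq0; apply/negPn/negP => CC'.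
have : (size ((C - C') * (C + C'))%R <= n)%N.
  have -> : (C - C') * (C + C') = C ^+ 2 - S - (C' ^+ 2 - S) by ring.
  by apply: leq_trans (size_polyD _ _) _; rewrite size_polyN geq_max h h'.
have Ds : (size (C + C')%R >= n.+1)%N.
  rewrite ltnNge; apply/negP => /leq_sizeP/(_ n (leqnn n))/eqP.
  rewrite coefD; have := monicP Cm; have := monicP C'm; rewrite !lead_coefE Cs C's /= => -> ->.
  by rewrite -(natrD _ 1 1) pnatr_eq0.
rewrite size_mul //; last by rewrite -size_poly_gt0 (leq_trans _ Ds).
rewrite -size_poly_gt0 in CC'; case: (size (C - C')) CC' => // k _ /=.
by move=> /(leq_trans (leq_addl _ _)) /(leq_trans Ds); rewrite ltnn.
Qed.

End Spectral.

(** * Regular functions on the parameter space *)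

Section Regular.
Variables (R : rcfType) (n : nat).
Local Notation C := R[i].
Local Notation T := (pt R n).
Implicit Types (v : T) (phi psi : T -> C) (Phi Psi : T -> {poly C}).

Definition lead_potential v : C := (Ppol v)`_n ^+ 2 / 4%:R - (Qpol v)`_(n.*2).
Local Notation r := lead_potential.

Definition eval_at v (f : {mpoly C[Ndim n]}) : C := meval (fun j => v ord0 j) f.

(* Regular functions [g / r^k] on the affine variety [P_2n = {r <> 0}]. *)
Definition regular phi : Prop :=
  exists (k : nat) (g : {mpoly C[Ndim n]}),
    forall v, Pspace R n v -> phi v * r v ^+ k = eval_at v g.

Lemma lead_potential_neq0 v : Pspace R n v -> r v != 0.
Proof. by []. Qed.

Lemma Ppol_coef v (i : 'I_n.+1) : (Ppol v)`_i = v ord0 (lshift _ i).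
Proof. by rewrite /Ppol coef_rVpoly_ord mxE. Qed.

Lemma Qpol_coef v (i : 'I_n.*2.+1) : (Qpol v)`_i = v ord0 (rshift _ i).
Proof. by rewrite /Qpol coef_rVpoly_ord mxE. Qed.

Lemma size_Ppol v : (size (Ppol v) <= n.+1)%N. Proof. exact: size_poly. Qed.
Lemma size_Qpol v : (size (Qpol v) <= n.*2.+1)%N. Proof. exact: size_poly. Qed.

Lemma lead_potential_mpoly : exists f, forall v, eval_at v f = r v.
Proof.
exists ('X_(lshift _ (ord_max : 'I_n.+1)) ^+ 2 * (4%:R^-1)%:MP - 'X_(rshift _ (ord_max : 'I_n.*2.+1))).
move=> v; rewrite /eval_at mevalB mevalM rmorphXn /= !mevalXU mevalC.
by rewrite /r -(Ppol_coef v ord_max) -(Qpol_coef v ord_max).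
Qed.

Lemma regular_ext phi psi : regular phi -> (forall v, Pspace R n v -> psi v = phi v) -> regular psi.
Proof. by move=> [k [g h]] e; exists k, g => v Pv; rewrite e // h. Qed.

Lemma regular_const c : regular (fun=> c).
Proof. by exists 0%N, c%:MP => v _; rewrite mulr1 /eval_at mevalC. Qed.

Lemma regular_add phi psi : regular phi -> regular psi -> regular (fun v => phi v + psi v).
Proof.
move=> [k [g h]] [l [g' h']]; have [rr rE] := lead_potential_mpoly.
exists (k + l)%N, (g * rr ^+ l + g' * rr ^+ k) => v Pv.
rewrite /eval_at mevalD !mevalM !rmorphXn /= -!/(eval_at v _) rE -h // -h' // exprD; ring.
Qed.

Lemma regular_mul phi psi : regular phi -> regular psi -> regular (fun v => phi v * psi v).
Proof.
move=> [k [g h]] [l [g' h']]; exists (k + l)%N, (g * g') => v Pv.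
by rewrite /eval_at mevalM -!/(eval_at v _) -h // -h' // exprD mulrACA.
Qed.

Lemma regular_opp phi : regular phi -> regular (fun v => - phi v).
Proof.
move=> h; apply: regular_ext (regular_mul (regular_const (-1)) h) _ => v _.
by rewrite mulN1r.
Qed.

Lemma regular_sum (I : Type) (s : seq I) (P : pred I) (phi : I -> T -> C) :
  (forall i, regular (phi i)) -> regular (fun v => \sum_(i <- s | P i) phi i v).
Proof.
move=> h; elim: s => [|i s IH].
  by apply: regular_ext (regular_const 0) _ => v _; rewrite big_nil.
case Pi : (P i); last by apply: regular_ext IH _ => v _; rewrite big_cons Pi.
by apply: regular_ext (regular_add (h i) IH) _ => v _; rewrite big_cons Pi.
Qed.

Lemma regular_lead : regular r.
Proof. by have [f h] := lead_potential_mpoly; exists 0%N, f => v _; rewrite mulr1 h. Qed.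

Lemma regular_leadV : regular (fun v => (r v)^-1).
Proof.
exists 1%N, 1%:MP => v Pv; rewrite /eval_at mevalC expr1 mulVf //.
Qed.

Definition regular_poly Phi : Prop := forall i, regular (fun v => (Phi v)`_i).

Lemma regular_poly_const p : regular_poly (fun=> p).
Proof. by move=> i; apply: regular_const. Qed.

Lemma regular_poly_add Phi Psi :
  regular_poly Phi -> regular_poly Psi -> regular_poly (fun v => Phi v + Psi v).
Proof.
by move=> h h' i; apply: regular_ext (regular_add (h i) (h' i)) _ => v _; rewrite coefD.
Qed.

Lemma regular_poly_opp Phi : regular_poly Phi -> regular_poly (fun v => - Phi v).
Proof.
by move=> h i; apply: regular_ext (regular_opp (h i)) _ => v _; rewrite coefN.
Qed.

Lemma regular_poly_mul Phi Psi :
  regular_poly Phi -> regular_poly Psi -> regular_poly (fun v => Phi v * Psi v).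
Proof.
move=> h h' i; apply: regular_ext.
  by apply: (@regular_sum 'I_i.+1 (index_enum _) xpredT) => j; apply: regular_mul (h j) (h' (i - j)%N).
by move=> v _; rewrite coefM.
Qed.

Lemma regular_poly_scale phi Phi :
  regular phi -> regular_poly Phi -> regular_poly (fun v => phi v *: Phi v).
Proof.
by move=> h h' i; apply: regular_ext (regular_mul h (h' i)) _ => v _; rewrite coefZ.
Qed.

Lemma regular_poly_deriv Phi : regular_poly Phi -> regular_poly (fun v => (Phi v)^`()).
Proof.
move=> h i; apply: regular_ext (regular_mul (regular_const i.+1%:R) (h i.+1)) _ => v _.
by rewrite coef_deriv mulr_natl.
Qed.

Lemma regular_coord j : regular (fun v => v ord0 j).
Proof. by exists 0%N, 'X_j => v _; rewrite mulr1 /eval_at mevalXU. Qed.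

Lemma regular_poly_P : regular_poly (@Ppol R n).
Proof.
move=> i; case: (ltnP i n.+1) => hi.
  by apply: regular_ext (regular_coord _) _ => v _; rewrite (Ppol_coef v (Ordinal hi)).
by apply: regular_ext (regular_const 0) _ => v _; rewrite nth_default // (leq_trans (size_Ppol v)).
Qed.

Lemma regular_poly_Q : regular_poly (@Qpol R n).
Proof.
move=> i; case: (ltnP i n.*2.+1) => hi.
  by apply: regular_ext (regular_coord _) _ => v _; rewrite (Qpol_coef v (Ordinal hi)).
by apply: regular_ext (regular_const 0) _ => v _; rewrite nth_default // (leq_trans (size_Qpol v)).
Qed.

Lemma regular_zero_locus (m : nat) (phi : 'I_m -> T -> C) (V : set T) :
  (forall l, regular (phi l)) ->
  (forall v, V v <-> Pspace R n v /\ forall l, phi l v = 0) -> alg_subvariety V.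
Proof.
move=> /choice[k /choice[g h]] VE; exists m, g => v; rewrite VE.
split=> -[Pv hv]; split=> // l; first by rewrite -/(eval_at v _) -h // hv mul0r.
have := hv l; rewrite -/(eval_at v _) -h // => /eqP; rewrite mulf_eq0 => /orP[/eqP//|].
by rewrite (negPf (expf_neq0 _ (lead_potential_neq0 Pv))).
Qed.

Definition potential v : {poly C} := normal_potential (Ppol v) (Qpol v).

Lemma regular_potential : regular_poly potential.
Proof.
rewrite /potential /normal_potential.
apply: regular_poly_add; last exact/regular_poly_opp/regular_poly_Q.
apply: regular_poly_add; apply: regular_poly_scale; try exact: regular_const.
  exact: regular_poly_mul regular_poly_P regular_poly_P.
exact/regular_poly_deriv/regular_poly_P.
Qed.

Hypothesis n0 : (0 < n)%N.

Lemma potential_lead v : (potential v)`_n.*2 = r v.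
Proof.
rewrite /potential /normal_potential coefB coefD !coefZ.
rewrite [_^`()`__]nth_default ?mulr0 ?addr0; last first.
  by rewrite (leq_trans (size_deriv_le (size_Ppol v))) // -addnn leq_addr.
by rewrite expr2 -addnn coefM_top ?size_Ppol // mulrC -expr2 /lead_potential addnn.
Qed.

Lemma size_potential v : Pspace R n v -> size (potential v) = n.*2.+1.
Proof.
move=> Pv; apply/eqP; rewrite eqn_leq; apply/andP; split; last first.
  rewrite ltnNge; apply/negP => /leq_sizeP/(_ _ (leqnn _))/eqP.
  by rewrite potential_lead (negPf (lead_potential_neq0 Pv)).
rewrite /potential /normal_potential; apply: leq_trans (size_polyD _ _) _.
rewrite size_polyN geq_max size_Qpol andbT; apply: leq_trans (size_polyD _ _) _.
rewrite geq_max; apply/andP; split; apply: leq_trans (size_scale_leq _ _) _.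
  by rewrite expr2 -addnn size_mul_top // size_Ppol.
by rewrite (leq_trans (size_deriv_le (size_Ppol v))) // -addnn -addnS leq_addr.
Qed.

Definition monic_potential v : {poly C} := (r v)^-1 *: potential v.

Lemma regular_monic_potential : regular_poly monic_potential.
Proof. exact: regular_poly_scale regular_leadV regular_potential. Qed.

(** The square root is built from the top down. A correction [a x^(n-k-1)] changes the coefficient
    of [x^(2n-k-1)] in the square by [2 a], as the root is monic; only division by 2 occurs, so
    regularity is preserved. *)
Lemma sqrt_family_upto k : (k <= n)%N -> exists Phi, regular_poly Phi /\
  forall v, Pspace R n v -> [/\ Phi v \is monic, size (Phi v) = n.+1 &
    (size (Phi v ^+ 2 - monic_potential v)%R <= n.*2 - k)%N].
Proof.
elim: k => [_|k IH kn].
  exists (fun=> 'X^n); split=> [|v Pv]; first exact: regular_poly_const.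
  rewrite monicXn size_polyXn -exprM muln2 subn0; split=> //.
  apply/leq_sizeP => j hj; rewrite coefB coefZ coefXn.
  case: (ltngtP j n.*2) hj => // [hj|->] _.
    by rewrite nth_default ?mulr0 ?subrr // size_potential.
  by rewrite potential_lead mulVf ?subrr ?lead_potential_neq0.
have [Phi [rPhi hPhi]] := IH (ltnW kn).
pose a v := - ((Phi v ^+ 2 - monic_potential v)`_(n.*2 - k.+1) / 2%:R).
have ra : regular a.
  apply/regular_opp/regular_mul/regular_const.
  apply: (regular_poly_add _ (regular_poly_opp regular_monic_potential)).
  exact: (regular_poly_mul rPhi rPhi).
exists (fun v => Phi v + a v *: 'X^(n - k.+1)); split=> [|v Pv].
  exact/regular_poly_add/regular_poly_scale/regular_poly_const.
have [Pm Ps Pd] := hPhi v Pv; set q := a v *: _.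
have qs : (size q <= (n - k.+1).+1)%N by rewrite (leq_trans (size_scale_leq _ _)) // size_polyXn.
have qn : (size q < size (Phi v))%N by rewrite Ps (leq_ltn_trans qs) //; lia.
split; first by rewrite monicE lead_coefDl // -monicE.
  by rewrite size_polyDl.
apply/leq_sizeP => j hj.
have -> : (Phi v + q) ^+ 2 - monic_potential v
   = (Phi v ^+ 2 - monic_potential v) + 2%:R * (Phi v * q) + q ^+ 2 by ring.
rewrite 2!coefD [(q ^+ 2)`_j]nth_default ?addr0; last first.
  by rewrite expr2 (leq_trans (size_mul_top qs qs)) //; lia.
rewrite -polyC_natr coefCM.
have [hj'|hj'] := ltnP (n.*2 - k.+1) j.
  have -> : (Phi v ^+ 2 - monic_potential v)`_j = 0.
    by rewrite nth_default // (leq_trans Pd) //; lia.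
  rewrite nth_default ?mulr0 ?addr0 //.
  by rewrite (leq_trans (size_mul_top (_ : size (Phi v) <= n.+1)%N qs)) ?Ps //; lia.
have -> : j = (n.*2 - k.+1)%N by lia.
have -> : (Phi v * q)`_(n.*2 - k.+1) = a v.
  have {1}-> : (n.*2 - k.+1 = n + (n - k.+1))%N by lia.
  rewrite coefM_top ?Ps // /q coefZ coefXn eqxx mulr1.
  by have := monicP Pm; rewrite lead_coefE Ps /= => ->; rewrite mul1r.
by rewrite /a mulrN [2%:R * _]mulrC divfK ?subrr ?pnatr_eq0.
Qed.

Lemma sqrt_family : exists Phi, regular_poly Phi /\
  forall v, Pspace R n v -> [/\ Phi v \is monic, size (Phi v) = n.+1 &
    (size (Phi v ^+ 2 - monic_potential v)%R <= n)%N].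
Proof.
have [Phi [rPhi hPhi]] := sqrt_family_upto (leqnn n); exists Phi; split=> // v Pv.
by have [? ? h] := hPhi v Pv; split=> //; rewrite (leq_trans h) //; lia.
Qed.

End Regular.

(** * The second-order operator acting on polynomial factors *)

Section SpectralOperator.
Variables (F : numFieldType) (n d : nat) (B T : {poly F}).
Hypothesis n0 : (0 < n)%N.
Hypothesis sB : (size B <= n.+1)%N.
Hypothesis sT : (size T <= n)%N.
Hypothesis T_top : T`_n.-1 = - 2%:R * d%:R * B`_n.

Definition spectral_op (Y : {poly F}) : {poly F} := Y^`()^`() + 2%:R * B * Y^`() + T * Y.

Lemma spectral_opZ c Y : spectral_op (c *: Y) = c *: spectral_op Y.
Proof. by rewrite /spectral_op !derivZ -!mul_polyC; ring. Qed.

Lemma size_spectral_op (Y : {poly F}) j : (size Y <= j.+1)%N -> (size (spectral_op Y) <= j + n)%N.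
Proof.
move=> Yj; have Y'j := size_deriv_le Yj.
apply: leq_trans (size_polyD _ _) _; rewrite geq_max; apply/andP; split; last first.
  by case: n n0 sT => // n' _ sT'; rewrite addnS addnC size_mul_top.
apply: leq_trans (size_polyD _ _) _; rewrite geq_max; apply/andP; split.
  by rewrite (leq_trans (size_poly _ _)) // (leq_trans (leq_pred _)) // (leq_trans Y'j) // leq_addr.
rewrite -mulrA -polyC_natr mul_polyC (leq_trans (size_scale_leq _ _)) //.
case: j Y'j {Yj} => [|j] Y'j; last by rewrite addSn addnC size_mul_top.
by move: Y'j; rewrite leqn0 size_poly_eq0 => /eqP->; rewrite mulr0 size_poly0.
Qed.

(** The operator is triangular in the degree, with pivot [2 B_n (j - d)]. By [T_top] the pivot
    vanishes at [j = d], and only there when [B_n] is nonzero. *)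
Lemma coef_spectral_op (Y : {poly F}) j : (size Y <= j.+1)%N ->
  (spectral_op Y)`_(j + n).-1 = 2%:R * B`_n * (j%:R - d%:R) * Y`_j.
Proof.
move=> Yj; have Y'j := size_deriv_le Yj.
rewrite 2!coefD -mulrA -polyC_natr coefCM.
have -> : Y^`()^`()`_(j + n).-1 = 0.
  rewrite nth_default //; case: j Y'j {Yj} => [|j].
    by rewrite leqn0 size_poly_eq0 => /eqP->; rewrite derivC size_poly0.
  by move/size_deriv_le/leq_trans; apply; lia.
have -> : (T * Y)`_(j + n).-1 = T`_n.-1 * Y`_j.
  have -> : (j + n).-1 = (n.-1 + j)%N by lia.
  by rewrite coefM_top // prednK.
have -> : (B * Y^`())`_(j + n).-1 = j%:R * B`_n * Y`_j.
  case: j Y'j {Yj} => [|j] Y'j.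
    by move: Y'j; rewrite leqn0 size_poly_eq0 => /eqP->; rewrite mulr0 coef0 !mul0r.
  have -> : (j.+1 + n).-1 = (n + j)%N by lia.
  by rewrite coefM_top // coef_deriv -mulr_natl; ring.
rewrite T_top; ring.
Qed.

Lemma spectral_op_inj (Y : {poly F}) : B`_n != 0 -> (size Y <= d)%N ->
  (size (spectral_op Y) < n)%N -> Y = 0.
Proof.
move=> b0 Yd LY; apply/eqP; apply: contraTT LY => Y0; rewrite -leqNgt.
have [j Yj] : exists j, size Y = j.+1 by exists (size Y).-1; rewrite prednK ?size_poly_gt0.
apply: (@leq_trans (j + n)); first exact: leq_addl.
have := @coef_spectral_op Y j; rewrite Yj => /(_ (leqnn _)) h.
rewrite -[(j + n)%N]prednK ?addn_gt0 ?n0 ?orbT // ltnNge.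
apply/negP => /leq_sizeP/(_ _ (leqnn _))/eqP; rewrite h.
rewrite !mulf_eq0 pnatr_eq0 (negPf b0) /= subr_eq0 eqr_nat.
have -> : Y`_j = lead_coef Y by rewrite lead_coefE Yj.
rewrite lead_coef_eq0 (negPf Y0) orbF; lia.
Qed.

End SpectralOperator.

(** * Defining equations of the spectral varieties *)

Section SpectralVariety.
Variables (R : rcfType) (n : nat).
Hypothesis n0 : (0 < n)%N.
Local Notation C := R[i].
Local Notation T := (pt R n).
Implicit Types (v : T).
Local Notation r := (@lead_potential R n).

Lemma LvarE d v : Lvar R n d v <->
  Pspace R n v /\ exists M B : {poly C}, size M = d.+1 /\ spectral_eq (potential v) M B.
Proof. by rewrite /Lvar /potential -phexp_spectral // pnatr_eq0. Qed.

Section Root.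
Variable Phi : T -> {poly C}.
Hypothesis hPhi : forall v, Pspace R n v -> [/\ Phi v \is monic, size (Phi v) = n.+1 &
    (size (Phi v ^+ 2 - monic_potential v)%R <= n)%N].

Definition defect v : C := (monic_potential v - Phi v ^+ 2)`_n.-1.

Lemma Phi_top v : Pspace R n v -> (Phi v)`_n = 1.
Proof. by move=> Pv; have [/monicP h Ps _] := hPhi Pv; rewrite lead_coefE Ps in h. Qed.

Lemma potentialE v : Pspace R n v -> potential v = r v *: monic_potential v.
Proof. by move=> Pv; rewrite scalerA divff ?scale1r ?lead_potential_neq0. Qed.

Lemma spectral_root d v M B : Pspace R n v -> size (M : {poly C}) = d.+1 -> spectral_eq (potential v) M B ->
  [/\ B = B`_n *: Phi v, B`_n ^+ 2 = r v & r v * defect v = (n + d.*2)%:R * B`_n].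
Proof.
move=> Pv Ms MB; have Rs := size_potential Pv.
have Bs := spectral_sizeB n0 Rs Ms MB.
have Ds := spectral_size_diff n0 Rs Ms MB.
have b0 : B`_n != 0.
  by have -> : B`_n = lead_coef B by [rewrite lead_coefE Bs]; rewrite lead_coef_eq0 -size_poly_gt0 Bs.
have b2 : B`_n ^+ 2 = r v.
  have := congr1 (fun p : {poly C} => p`_n.*2) (subrK (B ^+ 2) (potential v)).
  rewrite coefD nth_default ?add0r; last by rewrite (leq_trans Ds) // -addnn leq_addr.
  by rewrite potential_lead // expr2 -addnn coefM_top ?Bs // expr2.
have BE : B = B`_n *: Phi v.
  have [Pm Ps Pd] := hPhi Pv.
  suff -> : Phi v = (B`_n)^-1 *: B by rewrite scalerA divff ?scale1r.
  apply: (@monic_sqrt_unique _ n (monic_potential v)) => //.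
  - by rewrite monicE lead_coefZ lead_coefE Bs mulVf.
  - by rewrite size_scale // invr_eq0.
  have -> : ((B`_n)^-1 *: B) ^+ 2 - monic_potential v = - (r v)^-1 *: (potential v - B ^+ 2).
    by rewrite exprZn exprVn b2 scaleNr (scalerBr _ (potential v)) (opprB (_ *: potential v)).
  by rewrite (leq_trans (size_scale_leq _ _)).
split=> //; rewrite -(spectral_coef_diff n0 Rs Ms MB) /defect -coefZ scalerBr -potentialE //.
by rewrite -b2 -exprZn -BE.
Qed.

(** Squaring the quantisation condition eliminates [B_n], whose square is [r], and leaves a
    condition on the parameters alone. *)
Definition defect_sq v : C := r v * defect v ^+ 2.

Lemma Lvar_defect d v : Lvar R n d v -> defect_sq v = (n + d.*2)%:R ^+ 2.
Proof.
move=> /LvarE[Pv [M [B [Ms MB]]]]; have [_ b2 rd] := spectral_root Pv Ms MB.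
have r0 := lead_potential_neq0 Pv; apply: (mulfI r0).
by rewrite /defect_sq mulrA -expr2 -exprMn rd exprMn b2 mulrC.
Qed.

Section Degree.
Variable d : nat.

(** The leading coefficient of [B] is a priori only a square root of [r]; the quantisation condition
    forces it to be this rational expression. *)
Definition root_lead v : C := r v * defect v / (n + d.*2)%:R.
Local Notation b := root_lead.
Let B v := b v *: Phi v.
Let A v := (B v)^`() + B v ^+ 2 - potential v.

Let nd0 : (n + d.*2)%:R != 0 :> C.
Proof. by rewrite pnatr_eq0 addn_eq0 negb_and -lt0n n0. Qed.

Let b2 v : Pspace R n v -> defect_sq v = (n + d.*2)%:R ^+ 2 -> b v ^+ 2 = r v.
Proof.
rewrite /defect_sq /b => Pv h; rewrite expr_div_n exprMn.
have -> : r v ^+ 2 * defect v ^+ 2 = r v * (r v * defect v ^+ 2) by ring.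
by rewrite h mulfK ?expf_neq0.
Qed.

Let B_top v : Pspace R n v -> (B v)`_n = b v.
Proof. by move=> Pv; rewrite coefZ Phi_top ?mulr1. Qed.

Let B_size v : Pspace R n v -> (size (B v) <= n.+1)%N.
Proof. by move=> /hPhi[_ Ps _]; rewrite (leq_trans (size_scale_leq _ _)) ?Ps. Qed.

Let A_diff v : Pspace R n v -> defect_sq v = (n + d.*2)%:R ^+ 2 ->
  B v ^+ 2 - potential v = r v *: (Phi v ^+ 2 - monic_potential v).
Proof.
by move=> Pv h; rewrite /B exprZn b2 // potentialE // -scalerBr.
Qed.

Let A_size v : Pspace R n v -> defect_sq v = (n + d.*2)%:R ^+ 2 -> (size (A v) <= n)%N.
Proof.
move=> Pv h; rewrite /A -addrA A_diff //; apply: leq_trans (size_polyD _ _) _.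
rewrite geq_max size_deriv_le ?B_size //= (leq_trans (size_scale_leq _ _)) //.
by have [] := hPhi Pv.
Qed.

Let A_top v : Pspace R n v -> defect_sq v = (n + d.*2)%:R ^+ 2 ->
  (A v)`_n.-1 = - 2%:R * d%:R * (B v)`_n.
Proof.
move=> Pv h; rewrite /A -addrA A_diff // coefD coefZ coef_deriv prednK // B_top //.
have -> : (Phi v ^+ 2 - monic_potential v)`_n.-1 = - defect v by rewrite /defect -coefN opprB.
have -> : r v * - defect v = - ((n + d.*2)%:R * b v) by rewrite mulrN /b [X in _ = - X]mulrC divfK.
by rewrite -mulr_natl -muln2 natrD natrM; ring.
Qed.

Let L v := spectral_op (B v) (A v).

Hypothesis rPhi : regular_poly Phi.

Let regular_defect : regular defect.
Proof.
apply: (regular_poly_add (@regular_monic_potential _ _)).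
exact/regular_poly_opp/(regular_poly_mul rPhi rPhi).
Qed.

Let regular_b : regular b.
Proof. exact: (regular_mul (regular_mul (@regular_lead _ _) regular_defect) (@regular_const _ _ _)). Qed.

Let regular_B : regular_poly B.
Proof. exact: (regular_poly_scale regular_b rPhi). Qed.

Let regular_A : regular_poly A.
Proof.
apply: regular_poly_add; last exact/regular_poly_opp/regular_potential.
exact: (regular_poly_add (regular_poly_deriv regular_B) (regular_poly_mul regular_B regular_B)).
Qed.

Let regular_L Psi : regular_poly Psi -> regular_poly (fun v => L v (Psi v)).
Proof.
move=> h; rewrite /L /spectral_op.
have h' := regular_poly_deriv h; have h'' := regular_poly_deriv h'.
apply: (regular_poly_add _ (regular_poly_mul regular_A h)).
apply: (regular_poly_add h'' (regular_poly_mul (regular_poly_mul _ regular_B) h')).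
exact: regular_poly_const.
Qed.

Lemma factor_family_upto k : (k <= d)%N -> exists Psi, regular_poly Psi /\
  forall v, Pspace R n v -> defect_sq v = (n + d.*2)%:R ^+ 2 ->
  [/\ Psi v \is monic, size (Psi v) = d.+1 & (size (L v (Psi v)) <= (d + n).-1 - k)%N].
Proof.
elim: k => [_|k IH kd].
  exists (fun=> 'X^d); split=> [|v Pv h]; first exact: regular_poly_const.
  rewrite monicXn size_polyXn subn0; split=> //.
  apply/leq_sizeP => j hj; have sX : (size ('X^d : {poly C}) <= d.+1)%N by rewrite size_polyXn.
  have := size_spectral_op n0 (B_size Pv) (A_size Pv h) sX.
  case: (ltngtP j (d + n).-1) hj => // [hj|->] _.
    by move=> hs; rewrite nth_default // (leq_trans hs) //; lia.
  by rewrite (coef_spectral_op n0 (B_size Pv) (A_size Pv h) (A_top Pv h) sX) subrr mulr0 mul0r.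
have [Psi [rPsi hPsi]] := IH (ltnW kd).
(* The pivot at [x^(d-k-1)] is [- 2 b (k + 1)]; its inverse is regular because [1 / b = b / r] on
   the quantisation locus. *)
pose a v := (L v (Psi v))`_((d + n).-1 - k.+1) * b v / (2%:R * r v * k.+1%:R).
have ra : regular a.
  have h1 := regular_mul (regular_mul (regular_L rPsi ((d + n).-1 - k.+1)%N) regular_b)
    (regular_mul (@regular_leadV _ _) (@regular_const _ _ (2%:R * k.+1%:R)^-1)).
  apply: (regular_ext h1) => v _; rewrite /a -!invfM; congr (_ * _^-1); ring.
exists (fun v => Psi v + a v *: 'X^(d - k.+1)); split=> [|v Pv h].
  exact/regular_poly_add/regular_poly_scale/regular_poly_const.
have [Pm Ps Pd] := hPsi v Pv h; set q := a v *: _.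
have qs : (size q <= (d - k.+1).+1)%N by rewrite (leq_trans (size_scale_leq _ _)) // size_polyXn.
have qn : (size q < size (Psi v))%N by rewrite Ps (leq_ltn_trans qs) //; lia.
split; first by rewrite monicE lead_coefDl // -monicE.
  by rewrite size_polyDl.
have -> : L v (Psi v + q) = L v (Psi v) + L v q.
  by rewrite /L /spectral_op !derivD; ring.
have Lq := size_spectral_op n0 (B_size Pv) (A_size Pv h) qs.
apply/leq_sizeP => j hj; rewrite coefD.
have [hj'|hj'] := ltnP ((d + n).-1 - k.+1) j.
  rewrite nth_default; last by rewrite (leq_trans Pd) //; lia.
  by rewrite nth_default ?addr0 // (leq_trans Lq) //; lia.
have -> : j = ((d + n).-1 - k.+1)%N by lia.
have {2}-> : ((d + n).-1 - k.+1 = (d - k.+1 + n).-1)%N by lia.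
rewrite (coef_spectral_op n0 (B_size Pv) (A_size Pv h) (A_top Pv h) qs).
rewrite /q coefZ coefXn eqxx mulr1 B_top // natrB // /a -(b2 Pv h).
have b0 : b v != 0 by rewrite -sqrf_eq0 b2 // lead_potential_neq0.
have k0 : k.+1%:R != 0 :> C by rewrite pnatr_eq0.
have two0 : 2%:R != 0 :> C by rewrite pnatr_eq0.
move: (k.+1%:R : C) (2%:R : C) (b v) k0 two0 b0 => x y z x0 y0 z0; field.
by rewrite x0 y0 z0.
Qed.

Lemma spectral_opE v M : spectral_eq (potential v) M (B v) <-> L v M = 0.
Proof. by rewrite /spectral_eq /L /spectral_op /A. Qed.

Lemma Lvar_equations Psi : regular_poly Psi ->
  (forall v, Pspace R n v -> defect_sq v = (n + d.*2)%:R ^+ 2 ->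
  [/\ Psi v \is monic, size (Psi v) = d.+1 & (size (L v (Psi v)) <= n.-1)%N]) ->
  alg_subvariety (Lvar R n d).
Proof.
move=> rPsi hPsi.
(* One quantisation equation, at index 0, and the [n - 1] low coefficients that the choice of [Psi]
   could not cancel. *)
pose phi (l : 'I_n) v := if l == 0%N :> nat then defect_sq v - (n + d.*2)%:R ^+ 2
  else (L v (Psi v))`_l.-1.
apply: (@regular_zero_locus _ _ n phi) => [l|v].
  rewrite /phi; case: eqP => _; last exact: regular_L.
  apply: (regular_add _ (@regular_const _ _ _)).
  exact: (regular_mul (@regular_lead _ _) (regular_mul regular_defect regular_defect)).
split=> [hv|[Pv hv]].
  have [Pv [M [B' [Ms MB]]]] := (LvarE d v).1 hv; split=> // l.
  have h := Lvar_defect hv; rewrite /phi; case: eqP => _; first by rewrite h subrr.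
  have [B'E b'2 rd] := spectral_root Pv Ms MB.
  have BE : B' = B v by rewrite {1}B'E /B /b rd mulrAC divff ?mul1r.
  have [Pm Ps Pd] := hPsi v Pv h.
  have lM0 : lead_coef M != 0 by rewrite lead_coef_eq0 -size_poly_gt0 Ms.
  pose M' := (lead_coef M)^-1 *: M.
  have LM' : L v M' = 0.
    by rewrite BE in MB; move/spectral_opE: MB; rewrite /M' /L spectral_opZ => ->; rewrite scaler0.
  (* Both are monic of degree [d], so the difference has smaller degree; its image has degree below
     [n - 1], and no pivot vanishes below [d]. *)
  have Y0 : Psi v - M' = 0.
    apply: (spectral_op_inj n0 (B_size Pv) (A_size Pv h) (A_top Pv h)).
    - by rewrite B_top // -sqrf_eq0 b2 // lead_potential_neq0.
    - apply/leq_sizeP => j dj; rewrite coefB coefZ.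
      case: (ltngtP j d) dj => // [dj|->] _.
        by rewrite !nth_default ?mulr0 ?subrr ?Ms ?Ps.
      have := monicP Pm; rewrite lead_coefE Ps /= => ->.
      by rewrite -[X in _ * X]/(M`_(d.+1.-1)) -Ms -lead_coefE mulVf ?subrr.
    - have -> : spectral_op (B v) (A v) (Psi v - M') = L v (Psi v) - L v M'.
        by rewrite /L /spectral_op !derivB; ring.
      by rewrite LM' subr0; lia.
  by rewrite (subr0_eq Y0) LM' coef0.
have h : defect_sq v = (n + d.*2)%:R ^+ 2.
  by apply: subr0_eq; have := hv (Ordinal n0).
have [Pm Ps Pd] := hPsi v Pv h.
apply/LvarE; split=> //; exists (Psi v), (B v); split=> //; apply/spectral_opE.
apply/polyP => j; rewrite coef0; case: (ltnP j n.-1) => jn; last first.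
  by rewrite nth_default // (leq_trans Pd).
have jn' : (j.+1 < n)%N by lia.
by have := hv (Ordinal jn').
Qed.

End Degree.
End Root.

Lemma Lvar_algebraic d : alg_subvariety (Lvar R n d).
Proof.
have [Phi [rPhi hPhi]] := @sqrt_family R n n0.
have [Psi [rPsi hPsi]] := factor_family_upto hPhi rPhi (leqnn d).
apply: (Lvar_equations hPhi rPhi rPsi) => v Pv h; have [? ? hs] := hPsi v Pv h.
by split=> //; rewrite (leq_trans hs) //; lia.
Qed.

(** A single function, chosen independently of [d], separates the varieties; disjointness and local
    finiteness both follow. *)
Lemma Lvar_degree : exists G : T -> C, regular G /\
  forall d v, Lvar R n d v -> G v = (n + d.*2)%:R ^+ 2.
Proof.
have [Phi [rPhi hPhi]] := @sqrt_family R n n0.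
exists (defect_sq Phi); split; last exact: Lvar_defect.
have rd : regular (defect Phi).
  apply: (regular_poly_add (@regular_monic_potential _ _)).
  exact/regular_poly_opp/(regular_poly_mul rPhi rPhi).
exact: (regular_mul (@regular_lead _ _) (regular_mul rd rd)).
Qed.

End SpectralVariety.

(** * Local finiteness *)

Section Compact.
Local Open Scope classical_set_scope.
Variables (R : realType) (n : nat).
Local Notation C := R[i].
Local Notation T := (pt R n).

Lemma coord_cvg (v : T) j : (fun w : T => (w ord0 j : C^o)) w @[w --> v] --> (v ord0 j : C^o).
Proof. exact: (@coord_continuous _ _ _ ord0 j v). Qed.

Lemma eval_at_continuous (f : {mpoly C[Ndim n]}) : continuous (fun w : T => eval_at w f : C^o).
Proof.
elim/mpolyind: f => [|c m p _ _ IH] v.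
  rewrite (_ : (fun _ => _) = cst (0 : C^o)); first exact: cst_continuous.
  by apply/funext => w; rewrite /eval_at meval0.
rewrite (_ : (fun _ => _) = ((cst (c : C^o) \* (fun w : T => \prod_i w ord0 i ^+ m i : C^o))
   \+ (fun w => eval_at w p : C^o))); last first.
  by apply/funext => w; rewrite /eval_at mevalD mevalZ mevalX.
apply: cvgD (IH v); apply: cvgM; first exact: cvg_cst.
elim: (index_enum _) => [|i s IHs].
  rewrite (_ : (fun _ => _) = cst (1 : C^o)); first by rewrite big_nil; exact: cvg_cst.
  by apply/funext => w; rewrite big_nil.
rewrite (_ : (fun _ => _) = ((fun w : T => w ord0 i ^+ m i : C^o) \*
   (fun w : T => \prod_(j <- s) w ord0 j ^+ m j : C^o))); last first.
  by apply/funext => w; rewrite big_cons.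
rewrite big_cons; apply: cvgM IHs.
elim: (m i) => [|k IHk].
  rewrite (_ : (fun _ => _) = cst (1 : C^o)); first by rewrite expr0; exact: cvg_cst.
  by apply/funext => w; rewrite expr0.
rewrite (_ : (fun _ => _) = ((fun w : T => w ord0 i : C^o) \* (fun w : T => w ord0 i ^+ k : C^o))).
  by rewrite exprS; apply: cvgM IHk; exact: coord_cvg.
by apply/funext => w; rewrite /= exprS.
Qed.

Lemma natr_bound (z : C) : exists m : nat, `|z| < m%:R.
Proof.
rewrite normc_def; set x := Num.sqrt _.
exists (Num.truncn x).+1; rewrite -(rmorph_nat (real_complex R)) ltcR.
by rewrite -truncn_lt_nat // sqrtr_ge0.
Qed.

Lemma regular_bounded (phi : T -> C) (K : set T) : regular phi ->
  compact K -> K `<=` Pspace R n -> exists m : nat, forall v, K v -> `|phi v| < m%:R.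
Proof.
move=> [k [g hg]] /compact_near_coveringP cK KP.
have [r rE] := lead_potential_mpoly R n.
(* A quotient of polynomials agreeing with [phi] on the parameter space, where it is continuous. *)
pose psi (v : T) : C^o := eval_at v g * (eval_at v r ^+ k)^-1.
have psi_cont v : Pspace R n v -> {for v, continuous psi}.
  move=> Pv; have cg := @eval_at_continuous g v.
  suff cr : {for v, continuous (fun w : T => eval_at w r ^+ k : C^o)}.
    by apply: (cvgM cg (cvgV _ cr)); rewrite expf_neq0 // rE.
  elim: (k) => [|j IH].
    have -> : (fun w : T => eval_at w r ^+ 0 : C^o) = cst (1 : C^o).
      by apply/funext => w; rewrite expr0.
    exact: cst_continuous.
  have -> : (fun w : T => eval_at w r ^+ j.+1 : C^o)
     = ((fun w : T => eval_at w r : C^o) \* (fun w : T => eval_at w r ^+ j : C^o)).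
    by apply/funext => w; rewrite /= exprS.
  exact: (cvgM (@eval_at_continuous r v) IH).
have psiE v : Pspace R n v -> phi v = psi v.
  by move=> Pv; rewrite /psi rE -hg // mulfK // expf_neq0.
have : \forall m \near \oo, K `<=` (fun v => `|psi v| < m%:R).
  apply: (cK nat \oo (fun m v => `|psi v| < m%:R)) => v Kv.
  have [m0 hm0] := natr_bound (psi v).
  have h1 : \forall w \near v, `|psi w| < m0%:R.
    by have := @cvgr_norm_lt C C^o _ (nbhs v) _ psi (psi v) (psi_cont v (KP v Kv)) m0%:R; apply.
  exists ([set w | `|psi w| < m0%:R], [set m | (m0 <= m)%N]).
    by split => //=; exact: nbhs_infty_ge.
  by move=> [w m] [/= hw hm]; rewrite (lt_le_trans hw) // ler_nat.
move=> [m _ hm]; exists m => v Kv; rewrite psiE; last exact: KP.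
exact: (hm m (leqnn m)).
Qed.

Lemma Lvar_compact_bounded (K : set T) : (0 < n)%N -> compact K -> K `<=` Pspace R n ->
  exists M : nat, forall d : nat, K `&` Lvar R n d !=set0 -> (d < M)%N.
Proof.
move=> n0 cK KP; have [G [rG hG]] := @Lvar_degree R n n0.
have [m hm] := regular_bounded rG cK KP.
exists m => d [v [Kv Lv]]; have := hm v Kv; rewrite (hG d v Lv) -natrX normr_nat ltr_nat.
by apply: leq_ltn_trans; rewrite -mulnn; nia.
Qed.

End Compact.

(** * Equilibrium configurations *)

Section Electrostatics.
Local Open Scope classical_set_scope.
Variables (R : realType).

(** The derivative of [exp(V) h^2] is [exp(V) h (2 h' + V' h)], and its first two factors do not
    vanish at [z]. *)
Lemma critical_point (V h : {poly R}) (z : R) : -1 < z < 1 -> h.[z] != 0 ->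
  (forall t, -1 <= t <= 1 -> expR V.[t] * h.[t] ^+ 2 <= expR V.[z] * h.[z] ^+ 2) ->
  2%:R * h^`().[z] + V^`().[z] * h.[z] = 0.
Proof.
move=> /andP[z1 z2] hz zmax.
pose f : R -> R := (expR \o horner V) * (horner (h ^+ 2)).
have df (t : R) : is_derive t 1 f (expR V.[t] * (h ^+ 2)^`().[t] + (h ^+ 2).[t] * (expR V.[t] * V^`().[t])).
  have d1 : is_derive t (1 : R) (expR \o horner V) (expR V.[t] * V^`().[t]).
    exact: is_derive1_comp.
  exact: is_deriveM.
have d0 : is_derive z 1 f 0.
  apply: (@derive1_at_max _ f (-1) 1 z).
  - lra.
  - by move=> t _; have [] := df t.
  - by rewrite in_itv /= z1 z2.
  - move=> t; rewrite in_itv /= => /andP[t1 t2]; rewrite /f !fctE /= !horner_exp.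
    by apply: zmax; rewrite !ltW.
have [_ e1] := df z; have [_ e0] := d0; move: e1; rewrite e0 expr2 derivM hornerD !hornerM => e1.
apply: (mulfI hz); apply: (mulfI (lt0r_neq0 (expR_gt0 V.[z]))).
rewrite !mulr0; apply: etrans (esym e1). ring.
Qed.

Section Configuration.
Variables (V : {poly R}) (d : nat).
Implicit Types x y z : 'rV[R]_d.

(** The inner product runs over ordered pairs, so this is the square of the Vandermonde product
    times [exp] of the sum of the [V(x_i)]; accordingly [V] will be twice a primitive of [B]. *)
Definition energy x : R :=
  \prod_i (expR V.[x ord0 i] * \prod_(j | j != i) `|x ord0 i - x ord0 j|).

Lemma continuous_bigprod (T : topologicalType) (I : Type) (s : seq I) (P : pred I)
    (f : I -> T -> R) :
  (forall i, continuous (f i)) -> continuous (fun v => \prod_(i <- s | P i) f i v).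
Proof.
move=> cf; elim: s => [|i s IH].
  have -> : (fun v => \prod_(i <- [::] | P i) f i v) = cst 1.
    by apply/funext => v; rewrite big_nil.
  exact: cst_continuous.
case Pi : (P i); last first.
  by have -> : (fun v => \prod_(i0 <- i :: s | P i0) f i0 v) = (fun v => \prod_(i <- s | P i) f i v)
    by apply/funext => v; rewrite big_cons Pi.
have -> : (fun v => \prod_(i0 <- i :: s | P i0) f i0 v) = f i \* (fun v => \prod_(i <- s | P i) f i v).
  by apply/funext => v; rewrite big_cons Pi.
by move=> v; exact: (cvgM (cf i v) (IH v)).
Qed.

Lemma continuous_energy : continuous energy.
Proof.
apply: continuous_bigprod => i v.
have cc j : {for v, continuous (fun x => x ord0 j)} by exact: coord_continuous.
have c1 : {for v, continuous (horner V \o (fun x => x ord0 i))}.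
  by apply: continuous_comp; [exact: cc | exact: continuous_horner].
have c2 : {for v, continuous (expR \o (horner V \o (fun x => x ord0 i)))}.
  by apply: continuous_comp; [exact: c1 | exact: continuous_expR].
apply: (cvgM c2); apply: continuous_bigprod => j w.
have cc' k : {for w, continuous (fun x => x ord0 k)} by exact: coord_continuous.
have cB : {for w, continuous (fun x => x ord0 i - x ord0 j)}.
  by apply: continuousB; exact: cc'.
exact: (continuous_comp cB (@norm_continuous _ _ _)).
Qed.

Definition move_to x (i : 'I_d) (t : R) : 'rV[R]_d := \row_j (if j == i then t else x ord0 j).

Lemma energy_move x i : exists c : R, forall t,
  energy (move_to x i t) = c * (expR V.[t] * (\prod_(j | j != i) ('X - (x ord0 j)%:P)).[t] ^+ 2).
Proof.
exists (\prod_(k | k != i) (expR V.[x ord0 k] * \prod_(j | (j != k) && (j != i)) `|x ord0 k - x ord0 j|)).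
move=> t; rewrite /energy (bigD1 i) //=.
have mi : move_to x i t ord0 i = t by rewrite mxE eqxx.
have mk k : k != i -> move_to x i t ord0 k = x ord0 k by rewrite mxE => /negPf ->.
rewrite mi.
under eq_bigr do rewrite distrC.
set p := \prod_(j | j != i) `|_ - t|.
have pE : p = \prod_(k | k != i) `|x ord0 k - t| by apply: eq_bigr => k /mk ->.
have -> : \prod_(k | k != i) (expR V.[move_to x i t ord0 k] *
    \prod_(j | j != k) `|move_to x i t ord0 k - move_to x i t ord0 j|)
  = \prod_(k | k != i) ((expR V.[x ord0 k] * \prod_(j | (j != k) && (j != i)) `|x ord0 k - x ord0 j|)
     * `|x ord0 k - t|).
  apply: eq_bigr => k ki; rewrite (bigD1 i) 1?eq_sym //= mi mk // -mulrA; congr (_ * _).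
  by rewrite mulrC; congr (_ * _); apply: eq_bigr => j /andP[_ ji]; rewrite mk.
rewrite big_split /= -pE horner_prod.
have -> : (\prod_(j | j != i) ('X - (x ord0 j)%:P).[t]) ^+ 2 = p ^+ 2.
  rewrite pE -[RHS]ger0_norm ?sqr_ge0 // -[LHS]ger0_norm ?sqr_ge0 // !normrX; congr (_ ^+ 2).
  rewrite !normr_prod; apply: eq_bigr => k _; rewrite hornerXsubC normr_id distrC //.
by ring.
Qed.

Lemma move_to_id x i : move_to x i (x ord0 i) = x.
Proof. by apply/rowP => j; rewrite mxE; case: eqP => [->|]. Qed.

Lemma energy_gt0_inj x : 0 < energy x -> injective (x ord0).
Proof.
move=> e0 i j ij; apply/eqP; apply: contraTT e0 => ne; rewrite -leNgt.
by rewrite /energy (bigD1 i) //= (bigD1 j) 1?eq_sym //= ij subrr normr0 !(mul0r, mulr0).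
Qed.

Definition box : set 'rV[R]_d := [set x | forall i, `[-1, 1] (x ord0 i)].

(** A maximum on the compact box is interior, hence critical in each coordinate. With
    [M = (x - z_i) h_i] one has [M'(z_i) = h_i(z_i)] and [M''(z_i) = 2 h_i'(z_i)], so criticality
    says that [M'' + V' M'] vanishes at every [z_i], and the [z_i] are distinct because the energy
    is positive. *)
Lemma equilibrium y : box y -> 0 < energy y ->
  (forall z i, box z -> `|z ord0 i| = 1 -> energy z < energy y) ->
  exists M : {poly R}, [/\ M \is monic, size M = d.+1 & M %| M^`()^`() + V^`() * M^`()].
Proof.
move=> ybox ey bdry.
have [z zbox zmax] : exists2 z, z \in box & forall t, t \in box -> energy t <= energy z.
  apply: compact_EVT_max; first by exists y.
    exact: (@rV_compact R d (fun=> `[-1, 1]) (fun=> @segment_compact _ _ _)).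
  by apply: continuous_subspaceT; exact: continuous_energy.
rewrite inE in zbox; have {}zmax t : box t -> energy t <= energy z by move=> tb; apply: zmax; rewrite inE.
have ez : 0 < energy z by rewrite (lt_le_trans ey) // zmax.
have zinj := energy_gt0_inj ez.
have zint i : -1 < z ord0 i < 1.
  have := zbox i; rewrite /= in_itv /= => /andP[z1 z2].
  have : `|z ord0 i| != 1.
    by apply/eqP => zi; have := bdry z i zbox zi; rewrite ltNge zmax.
  rewrite !lt_neqAle z1 z2 !andbT => ne; apply/andP; split.
    by apply: contraNneq ne => <-; rewrite normrN1.
  by apply: contraNneq ne => ->; rewrite normr1.
pose h i := \prod_(j | j != i) ('X - (z ord0 j)%:P).
have crit i : 2%:R * (h i)^`().[z ord0 i] + V^`().[z ord0 i] * (h i).[z ord0 i] = 0.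
  have [c cE] := energy_move z i.
  have := cE (z ord0 i); rewrite move_to_id => zE.
  have [c0 hz0] : 0 < c /\ (h i).[z ord0 i] != 0.
    have hz0 : (h i).[z ord0 i] != 0.
      by apply: contraTneq ez => hz; rewrite zE -/(h i) hz expr0n mulr0 mulr0 ltxx.
    split=> //; move: ez; rewrite zE pmulr_lgt0 // mulr_gt0 ?expR_gt0 //.
    by rewrite lt0r sqr_ge0 sqrf_eq0 hz0.
  apply: critical_point => // t tb.
  rewrite -(ler_pM2l c0) -cE -zE zmax // => j; rewrite mxE; case: eqP => _ //.
exists (\prod_i ('X - (z ord0 i)%:P)); split.
- exact: monic_prod_XsubC.
- by rewrite size_prod_XsubC /index_enum -enumT size_enum_ord.
have -> : \prod_i ('X - (z ord0 i)%:P) = \prod_(t <- [seq z ord0 i | i <- index_enum 'I_d]) ('X - t%:P).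
  by rewrite big_map.
apply: uniq_roots_dvdp; last by rewrite uniq_rootsE map_inj_uniq ?index_enum_uniq.
apply/allP => t /mapP[i _ ->]; rewrite big_map (bigD1 i) //= -/(h i) /root.
rewrite derivM derivXsubC mul1r derivD derivM derivXsubC mul1r.
rewrite !(hornerD, hornerM, hornerN, hornerX, hornerC) subrr; apply/eqP; apply: etrans (crit i); ring.
Qed.

End Configuration.
End Electrostatics.

(** * Confinement by a steep linear force *)

Section Threshold.
Local Open Scope classical_set_scope.
Variables (R : realType) (n : nat).
Hypothesis n0 : (0 < n)%N.

Section Bounds.
Variable B : {poly R}.
Hypothesis Bs : (size B <= n.+1)%N.
Hypothesis Bj : forall j, j != 1%N -> 0 <= B`_j <= 1.

Definition twice_primitive : {poly R} :=
  \poly_(i < n.+2) (if i is j.+1 then 2%:R * B`_j / j.+1%:R else 0).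

Lemma deriv_twice_primitive : deriv twice_primitive = 2%:R * B.
Proof.
apply/polyP => j; rewrite coef_deriv coef_poly -polyC_natr coefCM ltnS.
case: ltnP => hj; first by rewrite -[LHS]mulr_natr divfK ?pnatr_eq0.
by rewrite nth_default ?mulr0 ?mul0rn // (leq_trans Bs).
Qed.

(** On [-1,1] each coefficient of [B] other than the linear one contributes at most 2, so the
    potential is [B_1 x^2] up to a constant depending only on [n]. *)
Lemma twice_primitive_bound x : `|x| <= 1 ->
  `|twice_primitive.[x] - B`_1 * x ^+ 2| <= (2 * n.+1)%:R.
Proof.
move=> x1; rewrite horner_poly big_ord_recl /= mul0r add0r.
rewrite (bigD1 (Ordinal (n0 : (1 < n.+1)%N))) //=.
have -> : 2%:R * B`_1 / 2%:R * x ^+ 2 = B`_1 * x ^+ 2 by field.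
rewrite addrAC subrr add0r (le_trans (ler_norm_sum _ _ _)) //.
apply: (@le_trans _ _ (\sum_(i < n.+1 | i != Ordinal (n0 : (1 < n.+1)%N)) 2%:R)).
  apply: ler_sum => i i1; rewrite /bump /= add1n.
  have /andP[b0 b1] : 0 <= B`_i <= 1 by apply: Bj; apply: contraNneq i1 => i1; apply/eqP/val_inj.
  rewrite !normrM normfV normr_nat (ger0_norm b0) [`|x ^+ _|]normrX normr_nat.
  rewrite -[leRHS]mulr1 -mulrA -mulrA ler_pM2l ?ltr0n //.
  rewrite mulr_ile1 // ?mulr_ge0 ?invr_ge0 ?ler0n ?exprn_ge0 //.
  rewrite mulr_ile1 // ?invr_ge0 ?ler0n ?exprn_ge0 //.
    by rewrite invf_le1 ?ltr0n // ler1n.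
  by rewrite exprn_ile1.
rewrite sumr_const -[leLHS]mulr_natr -natrM ler_nat leq_mul2l /=.
by rewrite (leq_trans (max_card _)) // card_ord.
Qed.

End Bounds.

Variable d : nat.
Hypothesis d0 : (0 < d)%N.

(** A test configuration of distinct points near the origin. Its coordinates have squares summing to
    at most 1/4, against at least 1 for a configuration touching the boundary. *)
Let y : 'rV[R]_d := \row_i (i%:R / (2 * d * d)%:R).
Let vy : R := \prod_i \prod_(j | j != i) `|y ord0 i - y ord0 j|.
Let c0 : R := (2 * n.+1)%:R.

Let dR : 0 < (2 * d * d)%:R :> R. Proof. by rewrite ltr0n !muln_gt0 d0. Qed.

Let y_ge0 i : 0 <= y ord0 i. Proof. by rewrite mxE divr_ge0 ?ler0n. Qed.

Let y_sqr_le i : y ord0 i ^+ 2 <= (4%:R * d%:R)^-1.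
Proof.
have d0' : 0 < d%:R :> R by rewrite ltr0n.
have d1 : 1 <= d%:R :> R by rewrite ler1n.
have yi : y ord0 i <= (2%:R * d%:R)^-1.
  rewrite mxE ler_pdivrMr // !natrM mulrA mulVf ?mul1r ?ler_nat 1?ltnW //.
  by rewrite mulf_neq0 ?pnatr_eq0 // -lt0n.
rewrite (@le_trans _ _ ((2%:R * d%:R)^-1 ^+ 2)) //.
  by rewrite lerXn2r ?nnegrE ?y_ge0 // invr_ge0 mulr_ge0 ?ler0n.
rewrite exprVn lef_pV2 ?posrE ?exprn_gt0 ?mulr_gt0 ?ltr0n //.
by rewrite exprMn -natrX ler_pM2l ?ltr0n // expr2 ler_peMl // ltW.
Qed.

Let vy_gt0 : 0 < vy.
Proof.
apply: prodr_gt0 => i _; apply: prodr_gt0 => j ji.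
rewrite normr_gt0 subr_eq0 !mxE; apply: contraNneq ji.
move/(congr1 (fun t => t * (2 * d * d)%:R)); rewrite !divfK ?(gt_eqF dR) //.
by move/eqP; rewrite eqr_nat eq_sym.
Qed.

Let K : R := expR c0 * 2%:R ^+ d.
Let c : R := K ^+ d * expR (c0 *+ d) / vy.

(** Each distance is at most 2 and, as [B_1 <= 0], each weight at most [exp c0]; the coordinate on
    the boundary contributes the additional factor [exp B_1]. *)
Lemma energy_upper (B : {poly R}) (z : 'rV[R]_d) i0 : (size B <= n.+1)%N ->
  (forall j, j != 1%N -> 0 <= B`_j <= 1) -> B`_1 <= 0 ->
  box z -> `|z ord0 i0| = 1 -> energy (twice_primitive B) z <= K ^+ d * expR B`_1.
Proof.
move=> Bs Bj B1 zbox zi0.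
have z1 i : `|z ord0 i| <= 1 by have := zbox i; rewrite /= in_itv /= ler_norml.
have V_le i : (twice_primitive B).[z ord0 i] <= B`_1 * (z ord0 i) ^+ 2 + c0.
  have := twice_primitive_bound Bj (z1 i); rewrite ler_norml => /andP[_ h].
  by rewrite -lerBlDl.
have -> : K ^+ d * expR B`_1 = \prod_(i < d) (K * (if i == i0 then expR B`_1 else 1)).
  rewrite big_split /= prodr_const card_ord; congr (_ * _).
  by rewrite (bigD1 i0) //= eqxx big1 ?mulr1 // => i /negPf ->.
apply: ler_prod => i _; rewrite mulr_ge0 ?expR_ge0 ?prodr_ge0 //=.
rewrite /K mulrAC; apply: ler_pM; rewrite ?expR_ge0 ?prodr_ge0 //.
  case: eqP => [->|_]; last first.
    rewrite mulr1 ler_expR (le_trans (V_le i)) // gerDr.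
    by rewrite mulr_le0_ge0 ?sqr_ge0.
  rewrite -expRD ler_expR (le_trans (V_le i0)) //.
  by rewrite -[z ord0 i0 ^+ 2]real_normK ?num_real // zi0 expr1n mulr1 addrC.
rewrite big_mkcond /= -[in leRHS](card_ord d) -prodr_const.
apply: ler_prod => j _; case: eqP => _ /=; first by rewrite ler01 ler1n.
rewrite normr_ge0 (le_trans (ler_normB _ _)) //.
by rewrite -[2%:R](natrD _ 1 1) lerD.
Qed.

Lemma energy_lower (B : {poly R}) : (size B <= n.+1)%N ->
  (forall j, j != 1%N -> 0 <= B`_j <= 1) -> B`_1 <= 0 ->
  expR (B`_1 / 4%:R) * expR (- (c0 *+ d)) * vy <= energy (twice_primitive B) y.
Proof.
move=> Bs Bj B1; rewrite /energy big_split /= ler_wpM2r ?(ltW vy_gt0) //.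
have d0' : 0 < d%:R :> R by rewrite ltr0n.
have -> : expR (B`_1 / 4%:R) * expR (- (c0 *+ d)) = \prod_(i < d) expR (B`_1 / (4%:R * d%:R) - c0).
  rewrite prodr_const card_ord -expRM_natl -expRD; congr expR.
  rewrite mulrBr -[c0 *+ d]mulr_natl; congr (_ - _).
  have := lt0r_neq0 d0'; move: (d%:R : R) => q q0; field; exact: q0.
apply: ler_prod => i _; rewrite expR_ge0 ler_expR /=.
have yi1 : `|y ord0 i| <= 1.
  rewrite ger0_norm // -[leRHS](expr1n _ 2) -(@ler_pXn2r _ 2) ?nnegrE ?expr1n //.
  rewrite (le_trans (y_sqr_le i)) // invf_le1 ?mulr_gt0 ?ltr0n //.
  by rewrite -natrM ler1n muln_gt0.
have := twice_primitive_bound Bj yi1; rewrite ler_norml => /andP[+ _].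
rewrite lerBrDr addrC; apply: le_trans; rewrite lerD2r.
by rewrite ler_wnM2l // y_sqr_le.
Qed.

(* Stieltjes: when [B] is dominated by a steep linear restoring force, a
   configuration maximising the energy on the box cannot touch the boundary. *)
Lemma stieltjes_pos : exists2 T : R, 0 < T & forall B : {poly R}, (size B <= n.+1)%N ->
  (forall j, j != 1%N -> 0 <= B`_j <= 1) -> B`_1 <= - T ->
  exists M : {poly R}, [/\ M \is monic, size M = d.+1 & M %| deriv (deriv M) + 2%:R * B * deriv M].
Proof.
have cpos : 0 < c.
  by rewrite divr_gt0 // mulr_gt0 ?expR_gt0 // exprn_gt0 // mulr_gt0 ?expR_gt0 // exprn_gt0 ?ltr0n.
(* The upper bound falls below the lower one as soon as [c exp(3 B_1 / 4) < 1]; with this threshold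
   that follows from [1 + x <= exp x] at [x = - 3 B_1 / 4]. *)
exists (4%:R / 3%:R * c) => [|B Bs Bj B1]; first by rewrite mulr_gt0 // divr_gt0 ?ltr0n.
have B10 : B`_1 <= 0.
  rewrite (le_trans B1) // oppr_le0 mulr_ge0 ?(ltW cpos) // divr_ge0 ?ler0n //.
have lower := energy_lower Bs Bj B10.
have ybox : box y.
  move=> i; rewrite /= in_itv /= -ler_norml ger0_norm //.
  rewrite -[leRHS](expr1n _ 2) -(@ler_pXn2r _ 2) ?nnegrE ?expr1n //.
  rewrite (le_trans (y_sqr_le i)) // invf_le1 ?mulr_gt0 ?ltr0n //.
  by rewrite -natrM ler1n muln_gt0.
have ey : 0 < energy (twice_primitive B) y.
  by rewrite (lt_le_trans _ lower) // !mulr_gt0 ?expR_gt0.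
have [|M [Mm Ms MV]] := @equilibrium R (twice_primitive B) d y ybox ey; last first.
  by exists M; split=> //; rewrite -deriv_twice_primitive.
move=> z i zbox zi; apply: le_lt_trans (energy_upper Bs Bj B10 zbox zi) _.
apply: lt_le_trans lower.
set e := expR (- (c0 *+ d)).
have eE : expR (c0 *+ d) = e^-1 by rewrite /e expRN invrK.
have e0 : 0 < e := expR_gt0 _.
have KE : K ^+ d = c * vy * e.
  by rewrite /c eE divfK ?gt_eqF // mulfVK ?gt_eqF.
have -> : K ^+ d * expR B`_1 = c * expR B`_1 * (e * vy) by rewrite KE; ring.
rewrite -[X in _ < X]mulrA ltr_pM2r ?mulr_gt0 //.
have -> : expR B`_1 = expR (B`_1 / 4%:R) * expR (3%:R / 4%:R * B`_1).
  by rewrite -expRD; congr expR; field.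
rewrite mulrCA gtr_pMr ?expR_gt0 // -[3%:R / _ * _]opprK expRN.
rewrite ltr_pdivrMr ?expR_gt0 // mul1r (lt_le_trans _ (expR_ge1Dx _)) //.
have : 4%:R / 3%:R * c <= - B`_1 by rewrite lerNr.
lra.
Qed.

End Threshold.

(** * Codimension *)

Section TriangularDensity.
Variables (F : idomainType).

(** A monomial is determined by its last exponent together with the others, so the leading
    coefficient of [f] reappears uncancelled in [muni f]. *)
Lemma muni_eq0 m (f : {mpoly F[m.+1]}) : muni f = 0 -> f = 0.
Proof.
move=> f0; apply/eqP; apply: contraT => fn0.
have : f@_(mlead f) != 0 by rewrite mleadc_eq0.
set m0 := mlead f; set m1 := [multinom m0 (widen_ord (leqnSn m) i) | i < m].
have := congr1 (fun p : {poly {mpoly F[m]}} => (p`_(m0 ord_max))@_m1) f0.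
rewrite muniE coef_sum coef0 mcoeff0 raddf_sum /=.
rewrite (bigD1_seq m0) ?msupp_uniq ?mlead_supp //= big1 ?addr0.
  by rewrite coefZ coefXn eqxx mulr1 mcoeffZ mcoeffX eqxx mulr1 => ->; rewrite eqxx.
move=> mm mm0; rewrite coefZ coefXn; case: eqP => [e|_]; last by rewrite mulr0 mcoeff0.
rewrite mulr1 mcoeffZ mcoeffX; case: eqP => [e'|_]; last by rewrite mulr0.
case/eqP: mm0; apply/mnmP => i; case: (ltnP i m) => im.
  have := congr1 (fun t : 'X_{1..m} => t (Ordinal im)) e'; rewrite !mnmE.
  by have -> : widen_ord (leqnSn m) (Ordinal im) = i by apply/val_inj.
by have -> : i = ord_max by apply/val_inj/eqP; rewrite eqn_leq im -ltnS ltn_ord.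
Qed.

Lemma meval_muni m (x : 'I_m.+1 -> F) (f : {mpoly F[m.+1]}) :
  meval x f = (map_poly (meval (fun i : 'I_m => x (widen_ord (leqnSn m) i))) (muni f)).[x ord_max].
Proof.
rewrite mevalE muniE rmorph_sum horner_sum; apply: eq_bigr => mm _ /=.
rewrite map_polyZ /= map_polyXn hornerZ hornerXn mevalZ mevalX big_ord_recr /= mulrA.
by congr (_ * _ * _); apply: eq_bigr => i _; rewrite mnmE.
Qed.

(* A polynomial vanishing on a set of points whose coordinates can be chosen
   one after the other, each among infinitely many values, is zero. *)
Lemma mpoly_vanish m (Psi : (nat -> nat) -> nat -> F) (f : {mpoly F[m]}) :
  (forall k k' i, (i < m)%N -> (forall j, (j < i)%N -> k j = k' j) ->
     (Psi k i = Psi k' i <-> k i = k' i)) ->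
  (forall k, meval (fun i : 'I_m => Psi k i) f = 0) -> f = 0.
Proof.
elim: m f => [|m IH] f hPsi hf.
  have [c fE] : exists c, f = c%:MP by exists f@_0%MM; apply: nvar0_mpolyC.
  by have := hf id; rewrite fE mevalC => ->.
apply: muni_eq0; apply/polyP => e; rewrite coef0; apply: IH => [k k' i im|k].
  by apply: hPsi; rewrite ltnS ltnW.
pose ev := meval (fun i : 'I_m => Psi k i); pose q := map_poly ev (muni f).
suff q0 : q = 0 by have := congr1 (fun p : {poly F} => p`_e) q0; rewrite coef_map coef0.
(* Varying only the last parameter keeps the other coordinates, hence [q], fixed while producing
   infinitely many roots of [q]. *)
pose kt (t : nat) (j : nat) := if j == m then t else k j.
have agree t i : (i < m)%N -> Psi (kt t) i = Psi k i.
  move=> im; apply/hPsi; rewrite 1?ltnS 1?ltnW //; last by rewrite /kt ltn_eqF.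
  by move=> j ji; rewrite /kt ltn_eqF // (ltn_trans ji).
have roots t : root q (Psi (kt t) m).
  apply/eqP; have := hf (kt t); rewrite meval_muni /= => h; rewrite -[RHS]h /q.
  congr (_.[_]); apply/polyP => j; rewrite !coef_map /=; apply: meval_eq => i /=.
  by rewrite agree.
apply/eqP; apply: contraT => q0.
have := @max_poly_roots _ q [seq Psi (kt t) m | t <- iota 0 (size q)] q0.
rewrite size_map size_iota ltnn; apply.
  by apply/allP => _ /mapP[t _ ->].
rewrite map_inj_uniq ?iota_uniq // => t t' h.
suff : kt t m = kt t' m by rewrite /kt eqxx.
by apply: (hPsi (kt t) (kt t') m _ _).1 h => // j jm; rewrite /kt ltn_eqF // ltn_eqF.
Qed.

End TriangularDensity.

(** * Points of the varieties with independent top coordinates *)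

Section Codimension.
Variables (R : realType) (n d : nat).
Hypothesis n0 : (0 < n)%N.
Local Notation C := R[i].
Local Notation toC := (real_complex R).

Lemma stieltjes : exists2 T : R, 0 < T & forall B : {poly R}, (size B <= n.+1)%N ->
  (forall j, j != 1%N -> 0 <= B`_j <= 1) -> B`_1 <= - T ->
  exists M : {poly R}, [/\ M \is monic, size M = d.+1 & M %| deriv (deriv M) + 2%:R * B * deriv M].
Proof.
case: (posnP d) => [->|d0]; last exact: stieltjes_pos.
exists 1 => // B _ _ _; exists 1; rewrite monic1 size_poly1; split=> //.
exact: dvd1p.
Qed.

(** With [H = (M'' + 2 B M') / M], the potential [B^2 + B' + H] admits the solution [M]. Both [B']
    and [H] have degree below [n], so the coefficients of [Q] from [x^n] on depend only on [P] and
    [B^2]. *)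
Lemma Lvar_point (P : {poly C}) (B M : {poly R}) :
  (size P <= n.+1)%N -> size B = n.+1 -> M \is monic -> size M = d.+1 ->
  M %| deriv (deriv M) + 2%:R * B * deriv M ->
  exists v : pt R n, [/\ Lvar R n d v, Ppol v = P &
    forall e, (Qpol v)`_(n + e) = (4%:R^-1 *: P ^+ 2 + 2%:R^-1 *: deriv P)`_(n + e)
       - toC (B ^+ 2)`_(n + e)].
Proof.
move=> Ps Bs Mm Ms /dvdpP[H HE].
have Hs : (size H <= n)%N.
  have [->|H0] := eqVneq H 0; first by rewrite size_poly0.
  have sB : (size B <= n.+1)%N by rewrite Bs.
  have sM : (size M <= d.+1)%N by rewrite Ms.
  have := @size_spectral_op _ n B 0 n0 sB _ M d sM; rewrite size_poly0 => /(_ isT).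
  rewrite /spectral_op mul0r addr0 HE size_mul //; last by rewrite -size_poly_gt0 Ms.
  by rewrite Ms addnS /= addnC leq_add2l.
pose R0 := B ^+ 2 + deriv B + H.
have R0n e : R0`_(n + e) = (B ^+ 2)`_(n + e).
  rewrite /R0 -addrA coefD [X in _ + X]nth_default ?addr0 //.
  rewrite (leq_trans (size_polyD _ _)) // geq_max (leq_trans Hs) ?leq_addr // andbT.
  by rewrite (leq_trans (size_deriv_le (eq_leq Bs))) // leq_addr.
have R0s : (size R0 <= n.*2.+1)%N.
  rewrite -addnn; apply/leq_sizeP => j hj.
  have -> : j = (n + (j - n))%N by lia.
  rewrite R0n nth_default // expr2.
  by rewrite (leq_trans (size_mul_top (eq_leq Bs) (eq_leq Bs))) //; lia.
pose Rc := map_poly toC R0.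
pose Q := 4%:R^-1 *: P ^+ 2 + 2%:R^-1 *: deriv P - Rc.
have Qs : (size Q <= n.*2.+1)%N.
  rewrite (leq_trans (size_polyD _ _)) // size_polyN geq_max (leq_trans (size_poly _ _)) // andbT.
  rewrite (leq_trans (size_polyD _ _)) // geq_max.
  rewrite (leq_trans (size_scale_leq _ _)) /=; last by rewrite expr2 -addnn size_mul_top.
  rewrite (leq_trans (size_scale_leq _ _)) // (leq_trans (size_deriv_le Ps)) //; lia.
pose v : pt R n := row_mx (poly_rV P) (poly_rV Q).
have PE : Ppol v = P by rewrite /Ppol row_mxKl poly_rV_K.
have QE : Qpol v = Q by rewrite /Qpol row_mxKr poly_rV_K.
have potE : potential v = Rc.
  by rewrite /potential /normal_potential PE QE /Q; ring.
have Pv : Pspace R n v.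
  rewrite /Pspace -/(lead_potential v) -potential_lead // potE coef_map /= -addnn R0n.
  rewrite expr2 coefM_top ?Bs // fmorph_eq0 mulf_neq0 //.
    by rewrite -[n]/(n.+1.-1) -Bs -lead_coefE lead_coef_eq0 -size_poly_gt0 Bs.
  by rewrite -[n]/(n.+1.-1) -Bs -lead_coefE lead_coef_eq0 -size_poly_gt0 Bs.
exists v; split=> //; last first.
  by move=> e; rewrite QE /Q coefB coef_map /= R0n.
apply/LvarE; split=> //; exists (map_poly toC M), (map_poly toC B).
rewrite size_map_poly; split=> //; rewrite /spectral_eq potE !deriv_map /Rc.
have -> : 2%:R = map_poly toC 2%:R by rewrite rmorph_nat.
rewrite -!(rmorphXn, rmorphM, rmorphD, rmorphB) /= HE.
have -> : H * M + (deriv B + B ^+ 2 - R0) * M = 0 by rewrite /R0; ring.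
by rewrite rmorph0.
Qed.

Variable T : R.
Hypothesis T0 : 0 < T.

(** Infinitely many admissible values for each coefficient of [B]: at most [- T] for the linear one,
    in (0,1] for the others. *)
Definition steep_coef (j t : nat) : R := if j == 1%N then - (T + t%:R) else t.+1%:R^-1.

Lemma steep_coef_inj j : injective (steep_coef j).
Proof.
move=> t t'; rewrite /steep_coef; case: eqP => _.
  by move/oppr_inj/addrI/eqP; rewrite eqr_nat => /eqP.
by move/invr_inj/eqP; rewrite eqr_nat => /eqP[].
Qed.

(** The parameters [k 0, .., k n] are reserved for [P]; the next ones give the coefficients of [B]
    from the top one down. *)
Definition steep_poly (k : nat -> nat) : {poly R} :=
  \poly_(j < n.+1) steep_coef j (k (n.*2.+1 - j)%N).

Definition nat_poly (k : nat -> nat) : {poly C} := \poly_(i < n.+1) (k i)%:R.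

Lemma steep_poly_top k : (steep_poly k)`_n != 0.
Proof.
rewrite coef_poly ltnSn /steep_coef; case: (n == 1%N); last by rewrite invr_eq0 pnatr_eq0.
by rewrite oppr_eq0 gt_eqF // ltr_wpDr.
Qed.

(** All top coefficients in the family have the same sign. *)
Lemma steep_poly_top_add k k' : (steep_poly k)`_n + (steep_poly k')`_n != 0.
Proof.
rewrite !coef_poly ltnSn /steep_coef; case: (n == 1%N); last by rewrite gt_eqF // addr_gt0 // invr_gt0.
by rewrite -opprD oppr_eq0 gt_eqF // addr_gt0 // ltr_wpDr.
Qed.

Lemma size_steep_poly k : size (steep_poly k) = n.+1.
Proof. by apply: size_poly_eq; have := steep_poly_top k; rewrite coef_poly ltnSn. Qed.

Definition top_coord (k : nat -> nat) (i : nat) : C :=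
  if (i <= n)%N then (k i)%:R else
  (4%:R^-1 *: nat_poly k ^+ 2 + 2%:R^-1 *: deriv (nat_poly k))`_(n + (n.*2.+1 - i))
  - toC (steep_poly k ^+ 2)`_(n + (n.*2.+1 - i)).

(** If the coefficients of two polynomials [B] agree above degree [e], the coefficients of [x^(n+e)]
    in their squares differ by the difference at [x^e] times the sum of the top coefficients, which
    is nonzero. *)
Lemma top_coord_triangular k k' i : (i < n.*2.+2)%N ->
  (forall j, (j < i)%N -> k j = k' j) -> (top_coord k i = top_coord k' i <-> k i = k' i).
Proof.
move=> ib kk'; rewrite /top_coord; case: leqP => [_|ni].
  by split=> [/eqP|->//]; rewrite eqr_nat => /eqP.
have -> : nat_poly k' = nat_poly k.
  by apply/polyP => j; rewrite !coef_poly; case: ltnP => // jn; rewrite kk' // (leq_trans jn).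
set e := (n.*2.+1 - i)%N; have en : (e <= n)%N by rewrite /e; lia.
have ie : (n.*2.+1 - e = i)%N by rewrite /e; lia.
have diff : (steep_poly k ^+ 2)`_(n + e) - (steep_poly k' ^+ 2)`_(n + e)
  = (steep_coef e (k i) - steep_coef e (k' i)) * ((steep_poly k)`_n + (steep_poly k')`_n).
  rewrite -coefB addnC.
  have -> : steep_poly k ^+ 2 - steep_poly k' ^+ 2
    = (steep_poly k - steep_poly k') * (steep_poly k + steep_poly k') by ring.
  rewrite coefM_top ?coefD.
  - by rewrite coefN !(coef_poly _ _ e) ltnS en ie.
  - apply/leq_sizeP => j ej; rewrite coefB !coef_poly; case: ltnP => jn; last by rewrite subrr.
    by rewrite kk' ?subrr //; lia.
  - by rewrite (leq_trans (size_polyD _ _)) // !size_steep_poly maxnn.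
split=> [/addrI/oppr_inj/(fmorph_inj toC)/eqP|kki].
  rewrite -subr_eq0 diff mulf_eq0 (negPf (steep_poly_top_add _ _)) orbF subr_eq0.
  by move/eqP/steep_coef_inj.
congr (_ - toC _); apply/eqP; rewrite -subr_eq0 diff kki subrr mul0r //.
Qed.

Lemma nat_poly_coef k i : (i <= n)%N -> (nat_poly k)`_i = (k i)%:R.
Proof. by move=> hi; rewrite coef_poly ltnS hi. Qed.

(* The coordinates p_0, .., p_n, q_2n, q_(2n-1), .., q_n, in this order. *)
Definition top_index (i : nat) : nat := if (i <= n)%N then i else (4 * n + 2 - i)%N.

Lemma top_index_lt (i : 'I_(Ndim n - n)) : (top_index i < Ndim n)%N.
Proof. by have := ltn_ord i; rewrite /top_index; case: ifP; lia. Qed.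

Lemma top_index_inj : injective (fun i => Ordinal (top_index_lt i)).
Proof.
move=> i j [] h; apply/val_inj => /=; have := ltn_ord i; have := ltn_ord j; move: h.
by rewrite /top_index; case: ifP; case: ifP; lia.
Qed.

Hypothesis hT : forall B : {poly R}, (size B <= n.+1)%N ->
  (forall j, j != 1%N -> 0 <= B`_j <= 1) -> B`_1 <= - T ->
  exists M : {poly R}, [/\ M \is monic, size M = d.+1 & M %| deriv (deriv M) + 2%:R * B * deriv M].

Lemma Lvar_top_coord k : exists v : pt R n, Lvar R n d v /\
  forall i : 'I_(Ndim n - n), v ord0 (Ordinal (top_index_lt i)) = top_coord k i.
Proof.
have [|||M [Mm Ms MB]] := hT (B := steep_poly k).
- by rewrite size_steep_poly.
- move=> j j1; rewrite coef_poly /steep_coef (negPf j1); case: ifP => _; last by rewrite lexx ler01.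
  by rewrite invr_ge0 ler0n invf_le1 ?ltr0n // ler1n.
- by rewrite coef_poly ltnS n0 /steep_coef eqxx lerN2 lerDl.
have nPs : (size (nat_poly k) <= n.+1)%N by apply: size_poly.
have [v [Lv PE QE]] := Lvar_point nPs (size_steep_poly k) Mm Ms MB.
exists v; split=> // i; have ib := ltn_ord i.
rewrite /top_coord; case: leqP => ni.
  have -> : Ordinal (top_index_lt i) = lshift _ (Ordinal (ni : (i < n.+1)%N)).
    by apply/val_inj; rewrite /= /top_index ni.
  by rewrite -Ppol_coef PE nat_poly_coef.
have eb : (n + (n.*2.+1 - i) < n.*2.+1)%N by lia.
have -> : Ordinal (top_index_lt i) = rshift _ (Ordinal eb).
  by apply/val_inj; rewrite /= /top_index leqNgt ni /=; lia.
by rewrite -Qpol_coef /= QE.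
Qed.

Lemma Lvar_codim_of_steep : codim_le (Lvar R n d) n.
Proof.
exists (fun i => Ordinal (top_index_lt i)); split; first exact: top_index_inj.
move=> f hf; apply: (@mpoly_vanish _ _ top_coord f).
  by move=> k k' i ib; apply: top_coord_triangular; lia.
move=> k; have [v [Lv vE]] := Lvar_top_coord k.
by rewrite -(hf v Lv); apply: (@mpoly.meval_eq (Ndim n - n) C) => i; rewrite vE.
Qed.

End Codimension.

Lemma Lvar_codim (R : realType) (n d : nat) : (0 < n)%N -> codim_le (Lvar R n d) n.
Proof. by move=> n0; have [T T0 hT] := stieltjes R d n0; exact: (Lvar_codim_of_steep n0 T0 hT). Qed.

Lemma Lvar_nonempty (R : realType) (n d : nat) : (0 < n)%N -> exists v, Lvar R n d v.
Proof.
move=> n0; have [T T0 hT] := stieltjes R d n0.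
by have [v [Lv _]] := Lvar_top_coord n0 T0 hT id; exists v.
Qed.

(** The exponential alone forms a tower of length one. *)
Lemma phexp_liouvillian (F : fieldType) (d : nat) (P Q : {poly F}) :
  has_phexp_sol d P Q -> has_liouv_sol P Q.
Proof.
move=> [E [M [A [e [Ms e0 De sol]]]]].
exists E, (@de_iota _ E M * e); split=> //.
  by rewrite mulf_neq0 // iota_neq0 // -size_poly_gt0 Ms.
exists [:: e]; split.
  by case=> // _; apply: Or33; split=> //=; rewrite De mulfK //.
by apply/gen_predP; rewrite rpredM ?gen_poly // gen_mem // mem_head.
Qed.

Lemma Lspec_bigcup (R : realType) (n : nat) : (0 < n)%N ->
  Lspec R n = (\bigcup_(d in [set: nat]) Lvar R n d)%classic.
Proof.
move=> n0; apply/seteqP; split=> v.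
  move=> [Pv liouv].
  have [M [B [M0 MB]]] := liouvillian_spectral n0 (size_potential Pv) erefl liouv.
  exists (size M).-1 => //; apply/LvarE; split=> //; exists M, B; split=> //.
  by rewrite prednK // size_poly_gt0.
by move=> [d _ [Pv /phexp_liouvillian]].
Qed.

Unset Implicit Arguments.
Local Open Scope classical_set_scope.

Theorem theorem1 (R : realType) (n : nat) (hn : (1 <= n)%N) :
  (* (a) *)
  (forall m : nat, exists d : nat, (m <= d)%N /\ Lvar R n d !=set0)
  (* (b) *)
  /\ (forall d : nat, Lvar R n d !=set0 ->
        alg_subvariety (Lvar R n d) /\ codim_le (Lvar R n d) n)
  (* (c) *)
  /\ (forall d k : nat, d <> k -> Lvar R n d `&` Lvar R n k = set0)
  (* (d) *)
  /\ (forall K : set (pt R n), compact K -> K `<=` Pspace R n ->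
        exists M : nat, forall d : nat, K `&` Lvar R n d !=set0 -> (d < M)%N)
  (* moreover *)
  /\ Lspec R n = \bigcup_(d in [set: nat]) Lvar R n d.
Proof.
split; first by move=> m; exists m; split=> //; exact: Lvar_nonempty.
split; first by move=> d _; split; [exact: Lvar_algebraic | exact: Lvar_codim].
split.
  move=> d k dk; have [G [_ hG]] := @Lvar_degree R n hn.
  rewrite -subset0 => v [/hG Gd /hG]; rewrite Gd => /eqP.
  by rewrite -!natrX eqr_nat eqn_exp2r // eqn_add2l => /eqP/double_inj.
split; first by move=> K; exact: Lvar_compact_bounded.
exact: Lspec_bigcup.
Qed.
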